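(* Let $d\ge 1$ be an integer and let $1-\frac1d<\alpha<1$. The relaxed shape optimization problem $$\min\{\mathbf{X}_\alpha(\nu) : \nu \le 1,\ \nu\in \mathrm{Prob}(\mathbb{R}^d)\},\qquad \mathbf{X}_\alpha(\nu)=d_\alpha(\delta_0,\nu),$$ admits at least one minimizer.
   Context: $\Gamma$ is the set of $1$-Lipschitz curves $\gamma$ in $\mathbb{R}^d$ parameterized on $[0,\infty]$, with the topology of uniform convergence on compact sets, and $L(\gamma)=\int_0^\infty|\dot\gamma(t)|\,dt$. An irrigation plan is a Borel probability measure $\eta$ on $\Gamma$ with $\int_\Gamma L(\gamma)\,d\eta(\gamma)<\infty$; it is concentrated on curves of finite length, for which $\gamma(\infty):=\lim_{t\to\infty}\gamma(t)$ exists. For $\mu,\nu\in\mathrm{Prob}(\mathbb{R}^d)$ (Borel probability measures), $\mathrm{IP}(\mu,\nu)$ is the set of irrigation plans whose push-forwards under $\gamma\mapsto\gamma(0)$ and $\gamma\mapsto\gamma(\infty)$ are $\mu$ and $\nu$ respectively. The multiplicity is $\theta_\eta(x)=\eta(\{\gamma\in\Gamma: x \text{ belongs to the image of }\gamma\})$, $Z_\eta(\gamma)=\int_0^\infty\theta_\eta(\gamma(t))^{\alpha-1}|\dot\gamma(t)|\,dt$ (with $0^{\alpha-1}=\infty$, $\infty\times 0=0$), and the irrigation cost is $\mathbf{I}_\alpha(\eta)=\int_\Gamma Z_\eta(\gamma)\,d\eta(\gamma)$. The irrigation distance is $d_\alpha(\mu,\nu)=\inf\{\mathbf{I}_\alpha(\eta):\eta\in\mathrm{IP}(\mu,\nu)\}\in[0,\infty]$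 (infimum over the empty set being $+\infty$). The notation $\nu\le 1$ means that $\nu$ is absolutely continuous with respect to Lebesgue measure with density at most $1$ almost everywhere. $\delta_0$ is the Dirac mass at the origin. *)

(* Defs.v *)
From HB Require Import structures.
From mathcomp Require Import all_boot all_order all_algebra.
From mathcomp Require Import all_classical all_reals all_analysis.
From mathcomp Require Import measurable_realfun.

Set Implicit Arguments.
Unset Strict Implicit.
Unset Printing Implicit Defensive.
Import Order.TTheory GRing.Theory Num.Theory.
Import numFieldNormedType.Exports.
Local Open Scope classical_set_scope.
Local Open Scope ring_scope.

(* R^d with its Borel sigma-algebra. *)
Definition Rd (R : realType) (d : nat) :=
  g_sigma_algebraType (@open 'rV[R]_d).
HB.instance Definition _ R d := Measurable.on (@Rd R d).

(* The library norm on 'rV[R]_d is the sup norm. *)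
Definition enorm (R : realType) (d : nat) (x : 'rV[R]_d) : R :=
  Num.sqrt (\sum_i x ord0 i ^+ 2).

Section lebesgue_Rd.
Context {R : realType}.
Implicit Type d : nat.

Lemma Rd_open_measurable d (U : set 'rV[R]_d) :
  open U -> measurable (U : set (Rd R d)).
Proof. by move=> oU; exact: sub_gen_smallest. Qed.

Definition Rd_cons d (p : measurableTypeR R * Rd R d) : Rd R d.+1 :=
  @row_mx R 1 1 d (const_mx p.1) p.2.

Definition Rd_uncons d (v : Rd R d.+1) : measurableTypeR R * Rd R d :=
  ((v : 'rV_d.+1) ord0 ord0, rsubmx (v : 'rV_(1 + d))).

Lemma Rd_cons0 d p : (@Rd_cons d p : 'rV_d.+1) ord0 ord0 = p.1.
Proof.
have -> : @ord0 d = lshift d (@ord0 0) by exact/val_inj.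
by apply: etrans (row_mxEl _ _ _ _) _; rewrite mxE.
Qed.

Lemma Rd_consS d p j :
  (@Rd_cons d p : 'rV_d.+1) ord0 (rshift 1 j) = (p.2 : 'rV_d) ord0 j.
Proof. exact: row_mxEr. Qed.

Lemma Rd_consK d : cancel (@Rd_cons d) (@Rd_uncons d).
Proof.
move=> p; rewrite /Rd_uncons Rd_cons0 [X in (_, X)]row_mxKr.
by case: p.
Qed.

Definition rball d (c : 'rV[rat]_d * nat) : set 'rV[R]_d :=
  ball (map_mx ratr c.1 : 'rV[R]_d) (c.2.+1%:R^-1).

Lemma rball_cover d (U : set 'rV[R]_d) : open U ->
  U = \bigcup_(c in [set c | rball c `<=` U]) rball c.
Proof.
move=> oU; apply/seteqP; split => [x Ux|x [c /= cU /cU]]//.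
have /nbhs_ballP[e /= e0 xeU] : nbhs x U by exact: open_nbhs_nbhs.
have [n ne] : exists n : nat, n.+1%:R^-1 < e / 2.
  by have [n _ /(_ n (leqnn _))] := near_infty_natSinv_lt (PosNum (divr_gt0 e0 (ltr0Sn _ 1))); exists n.
have n0 : 0 < n.+1%:R^-1 :> R by rewrite invr_gt0.
have /choice[q qx] : forall i, exists q : rat, `|ratr q - x ord0 i| < n.+1%:R^-1.
  move=> i; have [q] := @rat_in_itvoo R (x ord0 i) (x ord0 i + n.+1%:R^-1) (ltr_pwDr n0 (lexx _)).
  rewrite in_itv /= => /andP[q1 q2]; exists q.
  by rewrite ger0_norm ?subr_ge0 1?ltW// ltrBlDl.
exists (\row_i q i, n).
  move=> y [_ qy]; apply: xeU; split => // i j; rewrite ord1 /ball /=.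
  have := qy ord0 j; rewrite /ball /= !mxE => h.
  rewrite (_ : _ - _ = (x ord0 j - ratr (q j)) + (ratr (q j) - y ord0 j)); last first.
    by rewrite addrA subrK.
  rewrite (le_lt_trans (ler_normD _ _))// [ltRHS]splitr ltrD//.
    by rewrite distrC (lt_trans (qx _)).
  exact: lt_trans ne.
by split => // i j; rewrite ord1 /ball /= !mxE; exact: qx.
Qed.

Lemma measurable_Rd_cons d : measurable_fun setT (@Rd_cons d).
Proof.
have E : @measurable _ (Rd R d.+1) = <<s @open 'rV[R]_d.+1 >> by [].
apply: (measurability _ E).
move=> _ [U oU <-]; rewrite setTI (rball_cover oU) preimage_bigcup.
rewrite bigcup_mkcond; apply: countable_bigcupT_measurable => // c.
case: ifP => // _.
rewrite (_ : _ @^-1` _ =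
  (ball (ratr (c.1 ord0 ord0) : R) c.2.+1%:R^-1) `*`
  (ball (map_mx ratr (rsubmx (c.1 : 'rV_(1 + d))) : 'rV[R]_d) c.2.+1%:R^-1)).
  apply: measurableX; last by apply: Rd_open_measurable; exact: ball_open.
  exact: measurable_ball.
apply/seteqP; split => p /=.
  move=> [c0 h]; split; last split => // i j.
    by have := h ord0 (@ord0 d); rewrite Rd_cons0 !mxE.
  by have := h ord0 (rshift 1 j); rewrite Rd_consS !ord1 !mxE.
move=> [h0 [c0 h]]; split => // i j; rewrite ord1.
case: (split_ordP (j : 'I_(1 + d))) => k ->.
  have -> : lshift d k = @ord0 d by apply/val_inj; rewrite /= ord1.
  by rewrite Rd_cons0 mxE.
by rewrite Rd_consS; have := h ord0 k; rewrite !mxE.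
Qed.

Lemma measurable_Rd_uncons d : measurable_fun setT (@Rd_uncons d).
Proof.
apply/measurable_fun_pairP; split.
  apply: (measurability _ (RGenOpens.measurableE R)).
  move=> _ [_ [a [b ->] <-]]; rewrite setTI; apply: Rd_open_measurable.
  apply: open_comp; last exact: interval_open.
  by move=> v _; exact: coord_continuous.
have E : @measurable _ (Rd R d) = <<s @open 'rV[R]_d >> by [].
apply: (measurability _ E).
move=> _ [U oU <-]; rewrite setTI; apply: Rd_open_measurable.
by apply: open_comp => // v _; exact: continuous_rsubmx.
Qed.

Section lebesgue_Rd_step.
Context {d : nat} (m : {sigma_finite_measure set (Rd R d) -> \bar R}).

Definition lebesgue_step : set (Rd R d.+1) -> \bar R :=
  pushforward (lebesgue_measure \x m)%E (@Rd_cons d).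

Let step0 : lebesgue_step set0 = 0%E.
Proof. by rewrite /lebesgue_step /pushforward preimage_set0 measure0. Qed.

Let step_ge0 A : (0 <= lebesgue_step A)%E.
Proof. exact: (measure_ge0 (lebesgue_measure \x m)%E). Qed.

Let step_sigma_additive : semi_sigma_additive lebesgue_step.
Proof.
exact: (@measure_semi_sigma_additive _ _ _
  (measure_function_pushforward__canonical__measure_function_Measure
     (lebesgue_measure \x m)%E (@measurable_Rd_cons d))).
Qed.

HB.instance Definition _ :=
  isMeasure.Build _ _ _ lebesgue_step step0 step_ge0 step_sigma_additive.

Let step_sigma_finite : sigma_finite setT lebesgue_step.
Proof.
have /sigma_finiteP[F [FT ndF Foo]] :=
  sigma_finiteT (@lebesgue_measure R : {sigma_finite_measure set _ -> \bar R}).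
have /sigma_finiteP[G [GT ndG Goo]] := sigma_finiteT m.
exists (fun n => @Rd_uncons d @^-1` (F n `*` G n)).
  rewrite -preimage_bigcup (_ : \bigcup_i _ = setT) ?preimage_setT//.
  apply/seteqP; split => // -[x y] _.
  have [i _ Fx] : (\bigcup_i F i) x by rewrite -FT.
  have [j _ Gy] : (\bigcup_i G i) y by rewrite -GT.
  exists (maxn i j) => //; split => /=.
    by move: x Fx; exact/subsetPset/ndF/leq_maxl.
  by move: y Gy; exact/subsetPset/ndG/leq_maxr.
move=> n; have [mF Fn] := Foo n; have [mG Gn] := Goo n.
have mFG := measurableX mF mG; split.
  by rewrite -[X in measurable X]setTI; exact: measurable_Rd_uncons.
rewrite /lebesgue_step /pushforward -comp_preimage.
rewrite (_ : _ \o _ = id); last exact/funext/Rd_consK.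
by rewrite preimage_id product_measure1E// lte_mul_pinfty// ge0_fin_numE.
Qed.

HB.instance Definition _ :=
  Measure_isSigmaFinite.Build _ _ _ lebesgue_step step_sigma_finite.

End lebesgue_Rd_step.

(* The d-fold product of the one-dimensional Lebesgue measure. *)
Fixpoint lebesgue_Rd (d : nat) : {sigma_finite_measure set (Rd R d) -> \bar R} :=
  match d with
  | 0 => \d_((0 : 'rV[R]_0) : Rd R 0)
  | d'.+1 => lebesgue_step (lebesgue_Rd d')
  end.

End lebesgue_Rd.

Definition density_le1 {R : realType} {d : nat} (nu : probability (Rd R d) R) :=
  exists f : Rd R d -> R,
    [/\ measurable_fun setT f, (forall x, 0 <= f x),
        {ae lebesgue_Rd d, forall x, f x <= 1} &
        forall A, measurable A ->
          nu A = (\int[lebesgue_Rd d]_(x in A) (f x)%:E)%E].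

(* A map on [0, +oo) is encoded by its extension to R that is constant on
   (-oo, 0]. *)
Record curve (R : realType) (d : nat) := Curve {
  curve_fun :> R -> 'rV[R]_d ;
  curve_lipschitz : forall s t, 0 <= s -> 0 <= t ->
    enorm (curve_fun t - curve_fun s) <= `|t - s| ;
  curve_nonpos : forall t, t <= 0 -> curve_fun t = curve_fun 0 }.

Section curve_instances.
Context {R : realType} {d : nat}.

HB.instance Definition _ := gen_eqMixin (curve R d).
HB.instance Definition _ := gen_choiceMixin (curve R d).

Lemma curve0_lipschitz (s t : R) : 0 <= s -> 0 <= t ->
  enorm ((0 : 'rV[R]_d) - 0) <= `|t - s|.
Proof.
move=> _ _; rewrite /enorm big1 ?sqrtr0// => i _.
by rewrite subr0 mxE expr0n.
Qed.

HB.instance Definition _ :=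
  isPointed.Build (curve R d) (Curve curve0_lipschitz (fun _ _ => erefl)).

HB.instance Definition _ := Topological.copy (curve R d)
  (@initial_topology (curve R d)
    {family (@compactly_in R `[0, +oo[), R -> 'rV[R]_d} (@curve_fun R d)).

End curve_instances.

(* Gamma with its Borel sigma-algebra. *)
Definition Gamma (R : realType) (d : nat) :=
  g_sigma_algebraType (@open (curve R d)).
HB.instance Definition _ R d := Measurable.on (@Gamma R d).

Section irrigation.
Context {R : realType} {d : nat}.
Implicit Types (g : curve R d) (eta : probability (Gamma R d) R).
Implicit Types mu nu : probability (Rd R d) R.
Local Notation leb := (@lebesgue_measure R).
Local Open Scope ereal_scope.

Definition curve_start g : Rd R d := g 0%R.

(* Meaningful when the limit exists, e.g. when g has finite length. *)
Definition curve_end g : Rd R d := lim (g t @[t --> +oo%R]).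

Definition curve_image g : set (Rd R d) := g @` `[0%R, +oo[.

Definition speed g (t : R) : R := enorm (derive1 g t).

Definition curve_length g : \bar R := \int[leb]_(t in `[0%R, +oo[) (speed g t)%:E.

Definition irrigation_plan eta := \int[eta]_g curve_length g < +oo.

Definition IP mu nu : set (probability (Gamma R d) R) :=
  [set eta | [/\ irrigation_plan eta,
    (forall A, measurable A -> pushforward eta curve_start A = mu A) &
    (forall A, measurable A -> pushforward eta curve_end A = nu A)]].

Definition multiplicity eta (x : Rd R d) : \bar R :=
  eta [set g | curve_image g x].

(* 0 `^ r is 0 in the library when r <> 0. *)
Definition pow_infty (x : \bar R) (r : R) : \bar R :=
  if x == 0 then +oo else x `^ r.

Definition Z_eta (alpha : R) eta g : \bar R :=
  \int[leb]_(t in `[0%R, +oo[)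
    (pow_infty (multiplicity eta (g t)) (alpha - 1) * (speed g t)%:E).

Definition irrigation_cost (alpha : R) eta : \bar R :=
  \int[eta]_g Z_eta alpha eta g.

Definition d_alpha (alpha : R) mu nu : \bar R :=
  ereal_inf [set irrigation_cost alpha eta | eta in IP mu nu].

Definition X_alpha (alpha : R) nu : \bar R :=
  d_alpha alpha (\d_((0%R : 'rV[R]_d) : Rd R d)) nu.

End irrigation.

(* Main.v *)
Require Import Defs.
From HB Require Import structures.
From mathcomp Require Import all_boot all_order all_algebra.
From mathcomp Require Import all_classical all_reals all_analysis.
From mathcomp Require Import measurable_realfun lra ring.

(* Take a minimizing sequence of plans [eta n] and let P be the Loeb measure on
   sequences of curves obtained from the [eta n] and a free ultrafilter on nat.
   Almost every sequence starts at the origin and has bounded lengths, since the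
   length is at most [Z_eta]; it then has an ultralimit when its curves are
   parameterized by arc length.  The image of P under this ultralimit is the
   minimizing plan.  Multiplicity is upper semicontinuous along the ultralimit,
   hence the cost of a curve is lower semicontinuous, and a Fatou lemma for P
   bounds the cost of the limit plan.  Endpoints converge as well, so the limit
   measure charges no open set more than Lebesgue measure does; by outer
   regularity and Radon-Nikodym its density is at most 1.  Finally, if no
   competitor has finite cost, every admissible measure is a minimizer. *)

Set Implicit Arguments.
Unset Strict Implicit.
Unset Printing Implicit Defensive.
Import Order.TTheory GRing.Theory Num.Theory.
Import numFieldNormedType.Exports.
Local Open Scope classical_set_scope.
Local Open Scope ring_scope.

(** A limit taken in the given parameterization would lose mass: a curve may stand still for longer
    and longer before it moves on, and then its length and its endpoint escape to infinite time. Arc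
    length removes this, since a bound on the lengths confines all motion to a bounded parameter
    interval, after which the limit curve rests at its endpoint. The Loeb space carries all the
    plans [eta n] at once and its points are the sequences of curves themselves, so limits are taken
    one sequence at a time, in place of tightness and subsequences; its countable additivity comes
    from saturation. The second obstacle is measurability: [Z_eta] and the speed are only ever
    integrated in the sense of lower integrals. The estimates therefore pass through lower bounds on
    finitely many sets or cells, and this dictates the form of the Fatou lemma, of the dyadic sums
    and of the approximation from inside by internal sets. *)

(** * Limits along a free ultrafilter on the natural numbers *)

Fact free_ultrafilter_exists : exists U : set_system nat, UltraFilter U /\ \oo `<=` U.
Proof. exact: ultraFilterLemma. Qed.

Definition hyper : set_system nat := sval (cid free_ultrafilter_exists).

Global Instance hyper_ultra : UltraFilter hyper.
Proof. by rewrite /hyper; case: cid => ? []. Qed.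

Lemma hyper_free : \oo `<=` hyper.
Proof. by rewrite /hyper; case: cid => ? []. Qed.

Lemma hyperP (P : nat -> Prop) :
  (\forall n \near hyper, P n) \/ (\forall n \near hyper, ~ P n).
Proof. exact: in_ultra_setVsetC. Qed.

Lemma hyperN (P : nat -> Prop) :
  ~ (\forall n \near hyper, P n) -> \forall n \near hyper, ~ P n.
Proof. by case: (hyperP P). Qed.

Lemma hyper_both (P Q : nat -> Prop) :
  (\forall n \near hyper, P n) -> (\forall n \near hyper, Q n) ->
  exists n, P n /\ Q n.
Proof.
move=> hP hQ; have : \forall n \near hyper, P n /\ Q n by near do split.
exact: filter_ex.
Unshelve. all: by end_near. Qed.

Lemma fmap_hyper_ultra {T : Type} (f : nat -> T) : UltraFilter (f @ hyper).
Proof.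
split=> [|G PG sG]; first exact: fmap_proper_filter.
apply/seteqP; split=> // A GA.
have [//|nA] := hyperP (fun n => A (f n)).
have GnA : G (~` A) by exact: sG.
have FG : Filter G by exact: PG.
have [x [Ax nAx]] := @filter_ex _ G PG _ (filterI GA GnA); by case: nAx.
Qed.

(** Compactness of [[-M, M]], in its ultrafilter form; it takes the place of the extraction of
    convergent subsequences. *)
Lemma hyper_bounded_cvg {R : realType} (x : nat -> R) (M : R) :
  (\forall n \near hyper, `|x n| <= M) ->
  exists2 l, x n @[n --> hyper] --> l & `|l| <= M.
Proof.
move=> xM.
have := @segment_compact R (- M) M; rewrite compact_ultra => /(_ _ (fmap_hyper_ultra x)).
case.
  by apply: filterS xM => n /= nM; rewrite /mkset in_itv /= -ler_norml.
by move=> l [lM xl]; exists l => //; rewrite ler_norml -[X in is_true X]/(l \in `[_, _]).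
Qed.

(* Countable saturation of the ultrapower, read on representatives. *)
Lemma hyper_saturation {T : Type} (Q : nat -> nat -> T -> Prop) (t0 : T) :
  (forall m n t, Q m.+1 n t -> Q m n t) ->
  (forall m, \forall n \near hyper, exists t, Q m n t) ->
  exists u : nat -> T, forall m, \forall n \near hyper, Q m n (u n).
Proof.
move=> Qdec Qex.
have Qle m m' n t : (m <= m')%N -> Q m' n t -> Q m n t.
  by move=> /subnK <-; elim: (m' - m)%N => // k ih; rewrite addSn => /Qdec.
(* Choose [t] meeting the strongest solvable condition among those of index at most [N]; the
   conditions are nested, so it meets the weaker ones too. The diagonal choice [N = n] then serves
   every fixed [m], because [m <= n] for almost all [n]. *)
have H N n : exists t, forall m, (m <= N)%N -> (exists t, Q m n t) -> Q m n t.
  elim: N => [|N [t ih]].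
    have [[t Qt]|nQ] := pselect (exists t, Q 0 n t).
      by exists t => m; rewrite leqn0 => /eqP ->.
    by exists t0 => m; rewrite leqn0 => /eqP -> /nQ.
  have [[t' Qt']|nQ] := pselect (exists t, Q N.+1 n t).
    by exists t' => m mN _; exact: Qle Qt'.
  exists t => m; rewrite leq_eqVlt => /predU1P[->//|]; rewrite ltnS; exact: ih.
have [u uP] := choice (fun n => H n n).
exists u => m.
have mn : \forall n \near hyper, (m <= n)%N by apply: hyper_free; exact: nbhs_infty_ge.
near=> n; apply: uP; near: n => //; exact: Qex.
Unshelve. all: by end_near. Qed.

(** * Loeb measures *)

Section internal.
Context {T : pointedType}.
Implicit Types A B : nat -> set T.

Definition internal A : set (nat -> T) := [set w | \forall n \near hyper, A n (w n)].

Lemma internalC A : ~` internal A = internal (fun n => ~` A n).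
Proof.
apply/seteqP; split=> w /=; first exact: hyperN.
by move=> nA Aw; have [n []] := hyper_both nA Aw.
Qed.

Lemma internalI A B : internal A `&` internal B = internal (fun n => A n `&` B n).
Proof.
apply/seteqP; split=> w /=; first by case=> ? ?; near do split.
by move=> AB; split; apply: filterS AB => n [].
Unshelve. all: by end_near. Qed.

Lemma internalU A B : internal A `|` internal B = internal (fun n => A n `|` B n).
Proof.
apply: setC_inj; rewrite setCU !internalC internalI; congr internal.
by apply/funext => n; rewrite setCU.
Qed.

Lemma internal0 : internal (fun=> set0) = set0.
Proof. by apply/seteqP; split=> // w /filter_ex[]. Qed.

(** A counterexample chosen at every bad index would form a sequence in the first internal set and
    not in the second. Consequently an internal set determines its components for almost all [n]. *)
Lemma internal_subP A B : internal A `<=` internal B ->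
  \forall n \near hyper, A n `<=` B n.
Proof.
move=> AB; apply: contrapT => /hyperN nAB.
have H n : exists t, ~ (A n `<=` B n) -> A n t /\ ~ B n t.
  have [AnB|/existsNP[t /not_implyP tP]] := pselect (A n `<=` B n).
    by exists point.
  by exists t.
have [w wP] := choice H.
have Aw : internal A w by apply: filterS nAB => n /wP[].
have Bw := AB _ Aw.
by have [n [/wP[]]] := hyper_both nAB Bw.
Qed.

Lemma internal_eqP A B : internal A = internal B ->
  \forall n \near hyper, A n = B n.
Proof.
move=> AB; have h1 : internal A `<=` internal B by rewrite AB.
have h2 : internal B `<=` internal A by rewrite AB.
near=> n; apply/seteqP; split; near: n; exact: internal_subP.
Unshelve. all: by end_near. Qed.

(** Otherwise every [A m] has, for almost all [n], a point outside [B n], and saturation produces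
    one sequence lying in all the [internal (A m)] but not in [internal B]. This compactness is the
    source of countable additivity. *)
Lemma internal_cap_sub (A : nat -> nat -> set T) B :
  (forall m n, A m.+1 n `<=` A m n) ->
  \bigcap_m internal (A m) `<=` internal B ->
  exists m, \forall n \near hyper, A m n `<=` B n.
Proof.
move=> Adec AB; apply: contrapT => /forallNP nAB.
have [//||u uP] := @hyper_saturation T (fun m n t => A m n t /\ ~ B n t) point.
- by move=> m n t [/Adec ? ?].
- move=> m; have /hyperN := nAB m; apply: filterS => n.
  by move=> /existsNP[t /not_implyP tP]; exists t.
have /AB Bu : (\bigcap_m internal (A m)) u by move=> m _; apply: filterS (uP m) => n [].
by have [n [[]]] := hyper_both (uP 0%N) Bu.
Qed.

Lemma internal_cup_sub A (B : nat -> nat -> set T) :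
  (forall m n, B m n `<=` B m.+1 n) ->
  internal A `<=` \bigcup_m internal (B m) ->
  exists m, \forall n \near hyper, A n `<=` B m n.
Proof.
move=> Binc AB.
have [||m mP] := @internal_cap_sub (fun m n => ~` B m n) (fun n => ~` A n).
- by move=> m n; apply: subsetC.
- move=> w wB; rewrite -internalC => /AB[m _ Bw].
  by have := wB m I; rewrite -internalC.
by exists m; apply: filterS mP => n BA t At; apply: contrapT => /BA.
Qed.

End internal.

(* An alias of [nat -> T] carrying the algebra of internal sets. *)
Definition loeb (T : Type) := nat -> T.

Section loeb_algebra.
Context {d : measure_display} {T : measurableType d}.

HB.instance Definition _ := Pointed.copy (loeb T) (nat -> T).

Definition loeb_measurable : set (set (loeb T)) :=
  [set X | exists2 A : nat -> set T, (forall n, measurable (A n)) & X = internal A].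

Let loeb0 : loeb_measurable set0.
Proof. by exists (fun=> set0) => //; rewrite internal0. Qed.

Let loebU : setU_closed loeb_measurable.
Proof.
move=> _ _ [A mA ->] [B mB ->]; exists (fun n => A n `|` B n).
  by move=> n; exact: measurableU.
by rewrite internalU.
Qed.

Let loebC : setC_closed loeb_measurable.
Proof.
move=> _ [A mA ->]; exists (fun n => ~` A n).
  by move=> n; exact: measurableC.
by rewrite internalC.
Qed.

HB.instance Definition _ := isAlgebraOfSets.Build d (loeb T) loeb0 loebU loebC.

End loeb_algebra.

Section loeb_content.
Context {R : realType} {d : measure_display} {T : measurableType d}.
Variable eta : nat -> probability T R.

Definition slice (X : set (loeb T)) : nat -> set T :=
  xget (fun=> set0) [set A | (forall n, measurable (A n)) /\ X = internal A].

Lemma sliceP X : (measurable X : Prop) ->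
  (forall n, measurable (slice X n)) /\ X = internal (slice X).
Proof.
move=> [A mA XA]; rewrite /slice.
by case: xgetP => [B -> []//|/(_ A)]; case.
Qed.

Definition loeb_content (X : set (loeb T)) : \bar R :=
  (lim (fine (eta n (slice X n)) @[n --> hyper]))%:E.

(** Two representations of an internal set agree for almost all [n], so the choice made by [slice]
    does not affect the limit; the limit exists because probabilities stay in [[0, 1]]. *)
Lemma loeb_contentE (A : nat -> set T) : (forall n, measurable (A n)) ->
  (fun n => fine (eta n (A n))) @ hyper -->
  fine (loeb_content (internal A)).
Proof.
move=> mA.
have mX : measurable (internal A : set (loeb T)) by exists A.
have [mS SA] := sliceP mX.
have : \forall n \near hyper, `|fine (eta n (slice (internal A) n))| <= 1.
  apply: nearW => n; rewrite ger0_norm ?fine_ge0//.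
  by rewrite -lee_fin fineK ?fin_num_measure// probability_le1.
move=> /hyper_bounded_cvg[l xl _].
rewrite /= (cvg_lim _ xl)//.
apply: cvg_trans xl; apply: near_eq_cvg.
by apply: filterS (internal_eqP SA) => n /= <-.
Qed.

Lemma loeb_content_ge0 X : (0 <= loeb_content X)%E.
Proof.
rewrite lee_fin.
have [/cvg_ex[/= l xl]|] := pselect (cvg (fine (eta n (slice X n)) @[n --> hyper])); last first.
  by move=> /dvgP ->.
rewrite (cvg_lim _ xl)//; apply: (cvgr_to_ge xl).
by apply: nearW => n; rewrite fine_ge0.
Qed.

Let loeb_content0 : loeb_content set0 = 0%E.
Proof.
have /= := @loeb_contentE (fun=> set0) (fun=> measurable0).
rewrite internal0 => h; congr EFin; apply: cvg_unique h _ => //.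
by apply: cvg_near_cst; apply: nearW => n; rewrite measure0.
Qed.

Let loeb_content_additive : measure_function.semi_additive loeb_content.
Proof.
apply/(additive2P loeb_content0) => _ _ [A mA ->] [B mB ->].
rewrite internalI -internal0 => AB0.
have /loeb_contentE h : forall n, measurable (A n `|` B n).
  by move=> n; exact: measurableU.
rewrite internalU -EFinD; congr EFin; apply: cvg_unique h _ => //.
apply: cvg_trans (cvgD (loeb_contentE mA) (loeb_contentE mB)).
apply: near_eq_cvg; apply: filterS (internal_eqP AB0) => n AB /=.
by rewrite measureU// fineD// fin_num_measure.
Qed.

HB.instance Definition _ := isContent.Build d (loeb T) R loeb_content
  loeb_content_ge0 loeb_content_additive.

(** By saturation, a countable union of internal sets that is itself internal is already a finite
    union. When the sets are disjoint, all but finitely many are thus empty, and finite additivity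
    suffices. *)
Let loeb_content_sigma : semi_sigma_additive loeb_content.
Proof.
move=> F mF tF mUF.
have /choice[A mA] : forall k, exists A : nat -> set T,
    (forall n, measurable (A n)) /\ F k = internal A.
  by move=> k; have [A ? ?] := mF k; exists A.
have E m : internal (fun n => \big[setU/set0]_(k < m) A k n) = \big[setU/set0]_(k < m) F k.
  elim: m => [|m ih]; first by rewrite big_ord0 -internal0; congr internal; apply/funext => n;
    rewrite big_ord0.
  rewrite big_ord_recr -ih (mA m).2 [RHS]internalU; congr internal.
  by apply/funext => n; rewrite big_ord_recr.
have [mS SE] := sliceP mUF.
have [||m mP] := @internal_cup_sub T (slice (\bigcup_n F n))
  (fun m n => \big[setU/set0]_(k < m) A k n).
- by move=> m n t; rewrite big_ord_recr; left.
- by rewrite -SE => t [k _ Fkt]; exists k.+1 => //; rewrite E big_ord_recr; right.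
have UFE : \bigcup_n F n = \big[setU/set0]_(k < m) F k.
  apply/seteqP; split; last by apply: bigsetU_bigcup.
  by rewrite {1}SE -E => w Sw; apply: filterS2 mP Sw => n; exact.
have F0 k : (m <= k)%N -> F k = set0.
  move=> mk; apply/seteqP; split => // w Fkw.
  have : (\bigcup_n F n) w by exists k.
  rewrite UFE -bigcup_mkord => -[j /= jm Fjw].
  by have := tF j k I I (ex_intro _ w (conj Fjw Fkw)) => jk; rewrite jk ltnNge mk in jm.
rewrite UFE measure_semi_additive//; last by rewrite -UFE.
apply: cvg_near_cst; near=> n.
have mn : (m <= n)%N by near: n; exact: nbhs_infty_ge.
rewrite -(subnKC mn) /= big_mkord.
rewrite big_split_ord /= [X in _ + X]big1 ?adde0// => i _.
by rewrite F0 ?leq_addr// measure0.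
Unshelve. all: by end_near. Qed.

HB.instance Definition _ := Content_isMeasure.Build d (loeb T) R loeb_content
  loeb_content_sigma.

Definition loeb_sigma := g_sigma_algebraType (@measurable _ (loeb T)).

Definition loeb_measure : set loeb_sigma -> \bar R := measure_extension loeb_content.

HB.instance Definition _ := Measure.on loeb_measure.

Lemma loeb_measureE (A : nat -> set T) : (forall n, measurable (A n)) ->
  loeb_measure (internal A) = loeb_content (internal A).
Proof.
by move=> mA; rewrite /loeb_measure /measure_extension measurable_mu_extE//; exists A.
Qed.

Let loeb_measureT : loeb_measure setT = 1%E.
Proof.
have E : (setT : set loeb_sigma) = internal (fun=> setT).
  by apply/seteqP; split => // w _; exact: filterT.
rewrite E loeb_measureE//.
have /= := @loeb_contentE (fun=> setT) (fun=> measurableT).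
move=> h; congr EFin; apply: cvg_unique h _ => //.
by apply: cvg_near_cst; apply: nearW => n; rewrite probability_setT.
Qed.

HB.instance Definition _ := Measure_isProbability.Build _ _ _ loeb_measure loeb_measureT.

End loeb_content.

(** * Integrals of functions that need not be measurable *)

Section lower_integral.
Context d (T : measurableType d) (R : realType) (mu : {measure set T -> \bar R}).
Local Open Scope ereal_scope.
Import HBNNSimple.

(* No measurability: the library integral of a nonnegative function is the
   supremum of the integrals of the simple functions below it. *)
Lemma ge0_le_lower_integral (D : set T) (f g : T -> \bar R) :
  (forall x, D x -> 0 <= f x) -> (forall x, D x -> f x <= g x) ->
  \int[mu]_(x in D) f x <= \int[mu]_(x in D) g x.
Proof.
move=> f0 fg; have g0 x : D x -> 0 <= g x by move=> Dx; exact: le_trans (f0 x Dx) (fg x Dx).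
rewrite !ge0_integralE//; apply: le_ereal_sup => _ [h /= hf <-]; exists h => //= x.
apply: le_trans (hf x) _; rewrite /patch; case: ifPn => // /set_mem; exact: fg.
Qed.

Lemma lower_integral_le (f : T -> \bar R) (C : \bar R) : (forall x, 0 <= f x) ->
  (forall h : {nnsfun T >-> R}, (forall x, (h x)%:E <= f x) ->
    \int[mu]_x (h x)%:E <= C) ->
  \int[mu]_x f x <= C.
Proof.
move=> f0 hC; rewrite ge0_integralTE//; apply: ge_ereal_sup => _ [h /= hf <-].
by rewrite -integralT_nnsfun; exact: hC.
Qed.

End lower_integral.

Section layer_cake.
Context {R : realFieldType}.
Implicit Types (x e : R).

(** Discrete layer cake: the sum is [e] times the number of positive multiples of [e] below [x], up
    to the [K]-th. With its strict counterpart [le_layer_sum] it reduces an integral to the measures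
    of finitely many superlevel sets, at the price of one step [e]. *)
Lemma layer_sum_le x e K : 0 <= e -> 0 <= x ->
  \sum_(i < K) (e * (i.+1%:R * e <= x)%R%:R) <= x.
Proof.
move=> e0 x0; elim: K => [|K ih]; first by rewrite big_ord0.
have [h|h] := boolP (K.+1%:R * e <= x).
  apply: le_trans h; rewrite mulr_natl -[X in _ *+ X](card_ord K.+1) -sumr_const.
  by apply: ler_sum => i _; rewrite ler_piMr// lern1 leq_b1.
by rewrite big_ord_recr /= (negbTE h) mulr0 addr0.
Qed.

Lemma le_layer_sum x e K : 0 <= e -> x <= K.+1%:R * e ->
  x <= e + \sum_(i < K) (e * (i.+1%:R * e < x)%R%:R).
Proof.
move=> e0; elim: K x => [|K ih] x; first by rewrite mul1r big_ord0 addr0.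
rewrite big_ord_recr /=; have [h hx|h _] := ltP.
  rewrite mulr1 (eq_bigr (fun=> e)); last first.
    move=> i _; rewrite (le_lt_trans _ h) ?mulr1// ler_wpM2r// ler_nat.
    by rewrite ltnS ltnW.
  rewrite sumr_const card_ord; apply: le_trans hx _.
  by rewrite mulr_natl !mulrS [_ *+ K + e]addrC.
by rewrite mulr0 addr0; exact: ih.
Qed.

End layer_cake.

Section loeb_fatou.
Context {R : realType} {d : measure_display} {T : measurableType d}.
Variable eta : nat -> probability T R.
Import HBNNSimple.
Local Notation P := (loeb_measure eta).
Local Notation Omega := (@loeb_sigma d T).

(* No measurability is required of the sets [S n]. *)
Lemma loeb_inner (X : set Omega) (S : nat -> set T) (e : R) : 0 < e ->
  measurable X -> X `<=` internal S ->
  exists B : nat -> set T, [/\ forall n, measurable (B n),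
    \forall n \near hyper, B n `<=` S n &
    (P X - e%:E <= P (internal B))%E].
Proof.
move=> e0 mX XS.
have Pfin : P (~` X) \is a fin_num by apply: fin_num_measure; exact: measurableC.
(* The Loeb measure comes from an outer measure: the complement of [X] has a countable cover by
   internal sets of nearly the same total content. *)
have [_ [F [mF XF] <-] Fe] : exists2 x, [set (\sum_(0 <= k <oo) loeb_content eta (A k))%E
      | A in measurable_cover (~` X : set (loeb T))] x & (x < P (~` X) + e%:E)%E.
  exact: lb_ereal_inf_adherent.
have /choice[A mA] : forall k, exists A : nat -> set T,
    (forall n, measurable (A n)) /\ F k = internal A.
  by move=> k; have [A ? ?] := mF k; exists A.
(* Complements of the finite partial covers. The internal sets they define decrease to a subset of
   [X], so by saturation one [D m n] lies in [S n] for almost all [n]. *)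
pose D m n := ~` \big[setU/set0]_(k < m) A k n.
have mD m n : measurable (D m n).
  by apply/measurableC/bigsetU_measurable => k _; exact: (mA k).1.
have mU m : measurable (\big[setU/set0]_(k < m) F k : set Omega).
  by apply: bigsetU_measurable => k _; apply: sub_sigma_algebra; exact: mF.
have DE m : internal (D m) = ~` (\big[setU/set0]_(k < m) F k).
  rewrite -internalC; congr (~` _).
  elim: m => [|m ih]; first by rewrite big_ord0 -internal0; congr internal; apply/funext => n;
    rewrite big_ord0.
  rewrite big_ord_recr -ih (mA m).2 [RHS]internalU; congr internal.
  by apply/funext => n; rewrite big_ord_recr.
have [||m mP] := @internal_cap_sub T D S.
- by move=> m n; apply: subsetC; rewrite big_ord_recr; left.
- apply: subset_trans XS => w wD; apply: contrapT => /XF[k _ Fkw].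
  by have := wD k.+1 I; rewrite DE big_ord_recr /=; apply; right.
exists (D m); split => //.
rewrite [in leRHS]DE probability_setC//.
rewrite -[X in P X](setCK X) probability_setC; last exact: measurableC.
rewrite -[in leLHS]addeA leeD2l//.
rewrite -fin_num_oppeD// leeN2.
apply: le_trans (ltW Fe).
apply: (@le_trans _ _ (\sum_(0 <= k < m) loeb_content eta (F k))%E).
  apply: (@le_trans _ _ (\sum_(k < m) P (F k))%E).
    apply: content_subadditive => // k _; apply: sub_sigma_algebra; exact: mF.
  rewrite big_mkord; apply: lee_sum => k _.
  by rewrite (mA k).2 loeb_measureE//; exact: (mA k).1.
by apply: nneseries_lim_ge => k _ _; exact: loeb_content_ge0.
Qed.

Lemma integral_sum_indic d' (T' : measurableType d') (mu : {measure set T' -> \bar R})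
    K (a : 'I_K -> R) (A : 'I_K -> set T') : (forall i, 0 <= a i) ->
  (forall i, measurable (A i)) ->
  (\int[mu]_x (\sum_(i < K) a i * \1_(A i) x)%:E = \sum_(i < K) (a i)%:E * mu (A i))%E.
Proof.
move=> a0 mA; under eq_integral do rewrite -sumEFin.
rewrite ge0_integral_sum//.
- apply: eq_bigr => i _; under eq_integral do rewrite EFinM.
  rewrite ge0_integralZl_EFin//.
  + by rewrite integral_indic// setIT.
  + by apply/measurable_EFinP; exact: measurable_indic.
- by move=> i; apply/measurable_EFinP; apply: measurable_funM => //; exact: measurable_indic.
- by move=> i x _; rewrite lee_fin mulr_ge0.
Qed.

(* Neither [F n] nor [G] is assumed measurable. *)
Lemma loeb_fatou d' (T' : measurableType d') (f : Omega -> T')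
    (mu : probability T' R) (F : nat -> T -> \bar R) (G : T' -> \bar R)
    (N : set Omega) (C : R) :
  measurable_fun setT f -> (forall A, measurable A -> mu A = P (f @^-1` A)) ->
  (forall n x, 0 <= F n x)%E -> (forall y, 0 <= G y)%E ->
  measurable N -> P N = 0%E ->
  (\forall n \near hyper, \int[eta n]_x F n x <= C%:E)%E ->
  (forall w, ~ N w -> forall c : R, (c%:E < G (f w))%E ->
    \forall n \near hyper, (c%:E <= F n (w n))%E) ->
  (\int[mu]_y G y <= C%:E)%E.
Proof.
move=> mf muE F0 G0 mN PN0 FC GF.
apply: lower_integral_le => // h hG.
have [M hM] : exists M : R, forall y, h y <= M.
  have [M [_ /(_ (M + 1))]] := simple_bounded h.
  rewrite ltrDl ltr01 => /(_ isT) hM; exists (M + 1) => y.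
  exact: le_trans (ler_norm _) (hM y I).
apply/lee_addgt0Pr => e' e'0; rewrite [e']splitr; set e := e' / 2.
have e0 : 0 < e by rewrite divr_gt0.
have e_ge0 : 0 <= e := ltW e0.
clearbody e.
pose K := Num.truncn (M / e).
have MK : M <= K.+1%:R * e by rewrite -ler_pdivrMr// ltW// truncnS_gt.
pose Y i := [set y | i.+1%:R * e < h y].
have mY i : measurable (Y i).
  rewrite /Y (_ : [set _ | _] = h @^-1` `]i.+1%:R * e, +oo[); last first.
    by apply/seteqP; split => y /=; rewrite in_itv/= andbT.
  by rewrite -[X in measurable X]setTI; apply: measurable_funP.
have mfY i : measurable (f @^-1` Y i) by rewrite -[X in measurable X]setTI; exact: mf.
pose S i n := [set x | ((i.+1%:R * e)%:E <= F n x)%E].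
(* Precision [1 / (K + 1)]: the [K] errors, each multiplied by [e], add up to at most [e]. The other
   half of [e'] pays for the rounding in the layer cake. *)
have /choice[B BP] : forall i, exists B : nat -> set T, [/\ forall n, measurable (B n),
    \forall n \near hyper, B n `<=` S i n &
    (P (f @^-1` Y i `\` N) - (K.+1%:R^-1)%:E <= P (internal B))%E].
  move=> i; apply: loeb_inner; rewrite ?invr_gt0//; first exact: measurableD.
  by move=> w [Yw Nw]; apply: GF => //; apply: lt_le_trans (hG _); rewrite lte_fin.
have mB i n : measurable (B i n) by have [mB _ _] := BP i; exact: mB.
pose b i n := fine (eta n (B i n)).
pose beta i := fine (loeb_content eta (internal (B i))).
have bB i : b i n @[n --> hyper] --> beta i.
  exact: loeb_contentE.
(* For almost every [n] the sets [B i n] lie in the superlevel sets of [F n], so the sum at index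
   [n] is at most the integral of [F n]; the bound passes to the ultralimit. *)
have betaC : \sum_(i < K) e * beta i <= C.
  have : (\sum_(i < K) e * b i n) @[n --> hyper] --> \sum_(i < K) e * beta i.
    by apply: cvg_big => [|i _]; [exact: add_continuous|exact: cvgMr].
  move=> /cvgr_to_le; apply.
  have : \forall n \near hyper, forall i : 'I_K, B i n `<=` S i n.
    by apply: filter_forall => i; have [] := BP i.
  apply: filterS2 FC => n FnC BS.
  rewrite -lee_fin; apply: le_trans FnC.
  apply: (@le_trans _ _ (\int[eta n]_x (\sum_(i < K) e * \1_(B i n) x)%:E)%E).
    rewrite integral_sum_indic//.
    rewrite -sumEFin; apply: lee_sum => i _.
    by rewrite EFinM fineK// ?fin_num_measure.
  apply: ge0_le_lower_integral => x _.
    by rewrite lee_fin sumr_ge0 => // i _; rewrite mulr_ge0// indicE.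
  have := F0 n x; case Fnx : (F n x) => [r| |]; [|by move=> _; rewrite leey|by []].
  rewrite !lee_fin => r0; apply: le_trans (layer_sum_le K e_ge0 r0).
  apply: ler_sum => i _; rewrite ler_wpM2l // indicE ler_nat.
  case: (boolP (x \in _)) => //= /set_mem/(BS i).
  by rewrite /S /= Fnx lee_fin => ->.
apply: (@le_trans _ _ (\int[mu]_y (e%:E + (\sum_(i < K) e * \1_(Y i) y)%:E))%E).
  apply: ge0_le_lower_integral => y _; first by rewrite lee_fin.
  rewrite -EFinD lee_fin.
  apply: le_trans (le_layer_sum e_ge0 (le_trans (hM y) MK)) _.
  rewrite lerD2l; apply: ler_sum => i _; rewrite ler_wpM2l // indicE.
  by rewrite ler_nat; case: ltP => // h'; rewrite mem_set.
rewrite ge0_integralD//=; last 2 first.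
- by move=> y _; rewrite lee_fin sumr_ge0 => // i _; rewrite mulr_ge0// indicE.
- apply/measurable_EFinP; apply: measurable_sum => i.
  by apply: measurable_funM => //; exact: measurable_indic.
rewrite integral_cst// [X in (_ * X + _)%E](probability_setT mu) mule1.
rewrite integral_sum_indic// EFinD addeA [leRHS]addeC leeD2l//.
rewrite -EFinD; apply: (@le_trans _ _ (\sum_(i < K) e * (beta i + K.+1%:R^-1))%:E).
  rewrite -sumEFin; apply: lee_sum => i _.
  rewrite EFinM lee_wpmul2l ?lee_fin//.
  have [_ _ BPi] := BP i.
  have muY : mu (Y i) = P (f @^-1` Y i `\` N).
    rewrite muE// [LHS](@measureDI _ _ _ P _ N)//.
    rewrite [X in (_ + X)%E](_ : _ = 0%E) ?adde0//.
    by apply: (subset_measure0 _ _ _ PN0) => //; exact: measurableI.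
  rewrite [leLHS]muY EFinD -leeBlDr// /beta fineK; first by rewrite -loeb_measureE.
  by rewrite -loeb_measureE// fin_num_measure//; apply: sub_sigma_algebra; exists (B i).
rewrite lee_fin; under eq_bigr do rewrite mulrDr.
rewrite big_split /= lerD// sumr_const card_ord.
rewrite -mulrnAr ler_piMr// -[leLHS]mulr_natl ler_pdivrMr// mul1r ler_nat.
exact: leqnSn.
Qed.

End loeb_fatou.

(** * Lipschitz functions and the speed of a curve *)

Section lipschitz_ftc.
Context {R : realType}.
Variable f : R -> R.
Hypothesis f_lip : forall x y, `|f y - f x| <= `|y - x|.
Local Notation mu := (@lebesgue_measure R).

(* Adding the identity makes a 1-Lipschitz function monotone, with a
   Stieltjes measure at most twice the Lebesgue measure. *)
Definition lip_cumulative (x : R) := f x + x.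

Let F_nd : nondecreasing lip_cumulative.
Proof.
move=> x y xy; rewrite /lip_cumulative -subr_ge0.
have := f_lip x y; rewrite (ger0_norm (_ : 0 <= y - x)) ?subr_ge0// ler_norml => /andP[+ _].
lra.
Qed.

Lemma lip_continuous : continuous f.
Proof.
move=> x; apply/(@cvgrPdist_le _ _ _ (nbhs x)) => e e0; near=> y.
apply: le_trans (f_lip _ _) _; near: y.
by apply: cvgr_dist_le.
Unshelve. all: by end_near. Qed.

Let F_rc : right_continuous lip_cumulative.
Proof.
apply: right_continuousW => x; apply: cvgD => //; exact: lip_continuous.
Qed.

HB.instance Definition _ := isCumulative.Build R _ R lip_cumulative F_nd F_rc.

Local Notation LS := (lebesgue_stieltjes_measure lip_cumulative).

Lemma lip_stieltjes_itv (a b : R) : a <= b ->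
  LS `]a, b]%classic = (f b - f a + (b - a))%:E.
Proof.
move=> ab; rewrite /lebesgue_stieltjes_measure /measure_extension.
rewrite measurable_mu_extE/=; last exact: is_ocitv.
by rewrite wlength_itv_bnd// /lip_cumulative; congr EFin; lra.
Qed.

(** Both outer measures use the same covers by half-open intervals, and on each interval the
    increment of [f + id] is at most twice the length. *)
Lemma lip_stieltjes_le (A : set R) : (LS A <= 2%:E * mu A)%E.
Proof.
rewrite -lee_pdivrMl//; apply: le_ereal_inf_tmp => _ [B [mB AB] <-].
rewrite lee_pdivrMl// -nneseriesZl//.
apply: (@le_trans _ _ (\sum_(0 <= k <oo) wlength lip_cumulative (B k))%E).
  by apply: ereal_inf_lbound; exists B.
apply: lee_nneseries => // k _; have [a [b ->]] : exists a b, B k = `]a, b]%classic.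
  by have [[a b] _ <-] := mB k; exists a, b.
have [ab|ba] := leP a b; last first.
  rewrite set_itv_ge; last by rewrite bnd_simp -leNgt ltW.
  by rewrite [leLHS]wlength0 [X in (_ * X)%E]wlength0 mule0.
rewrite [leLHS]wlength_itv_bnd// [X in (_ * X)%E]wlength_itv_bnd// -EFinM lee_fin
  /lip_cumulative /=.
have := f_lip a b; rewrite (ger0_norm (_ : 0 <= b - a)) ?subr_ge0// ler_norml => /andP[_ +].
lra.
Qed.

(** The Stieltjes measure of [f + id], restricted to []a, b]] to be finite, is absolutely
    continuous. Its Radon-Nikodym density minus [1] represents the increments of [f], and Lebesgue
    differentiation identifies it with the derivative almost everywhere. *)
Lemma lip_derivable_ae_itv (a b : R) : a < b ->
  exists r : R -> R, [/\ mu.-integrable `]a, b] (EFin \o r),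
    forall s t, a <= s -> s <= t -> t <= b ->
      f t - f s = (\int[mu]_(x in `]s, t]) r x)%R &
    {ae mu, forall x, a < x < b -> derivable f x 1 /\ derive1 f x = r x}].
Proof.
move=> ab; have mD : measurable (`]a, b]%classic : set (measurableTypeR R)) by [].
have Doo : (LS `]a, b]%classic < +oo)%E by rewrite lip_stieltjes_itv ?ltry// ltW.
pose nu := mfrestr mD Doo.
have numu : nu `<< mu.
  apply/null_content_dominatesP => A mA muA0.
  apply/eqP; rewrite eq_le measure_ge0 andbT.
  apply: le_trans (le_measure _ _ _ (@subIsetl _ _ _)) _; rewrite ?inE//.
    exact: measurableI.
  by apply: le_trans (lip_stieltjes_le A) _; rewrite muA0 mule0.
have [q [q0 qfin qint qE]] := radon_nikodym_sigma_finite numu.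
pose r x := fine (q x).
have rq x : (r x)%:E = q x by rewrite fineK.
have rE s t : a <= s -> s <= t -> t <= b ->
    (\int[mu]_(x in `]s, t]) r x)%R = f t - f s + (t - s).
  move=> as_ st tb.
  rewrite /Rintegral; under eq_integral do rewrite rq.
  rewrite -qE//= /nu /mfrestr /mrestr.
  rewrite (_ : _ `&` _ = `]s, t]%classic) ?lip_stieltjes_itv//.
  apply/seteqP; split => [x []//|x /=]; rewrite !in_itv/= => /andP[sx xt].
  rewrite sx xt; split => //; apply/andP; split; first exact: le_lt_trans sx.
  exact: le_trans tb.
have rint : mu.-integrable setT (EFin \o r).
  by rewrite (_ : _ \o _ = q)//; apply/funext => x; rewrite /= rq.
have cint (s t : R) : mu.-integrable `]s, t] (EFin \o cst 1).
  apply/integrableP; split; first exact/measurable_EFinP.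
  under eq_integral do rewrite /= normr1.
  rewrite integral_cst// mul1e [ltLHS](lebesgue_measure_itv `]s, t]).
  by case: ifP => // _; rewrite -EFinB ltry.
have rints (s t : R) : mu.-integrable `]s, t] (EFin \o r).
  exact: integrableS rint.
exists (fun x => r x - 1); split.
- exact: (integrableB _ (rints a b) (cint a b)).
- move=> s t as_ st tb.
  rewrite RintegralB// rE// Rintegral_cst// mul1r.
  rewrite [X in fine X](lebesgue_measure_itv `]s, t]).
  rewrite /= lte_fin; case: ltP => ts; first by rewrite -EFinB /=; lra.
  have -> : s = t by lra.
  by rewrite /=; lra.
- have := FTC1 _ (open_integrable_locally openT rint).
  move=> /(_ (BRight a))/=.
  have ri y : mu.-integrable [set` Interval (BRight a) (BRight y)] (EFin \o r).
    exact: integrableS rint.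
  move=> /(_ ri); apply: filterS; first exact: (ae_filter_ringOfSetsType mu).
  move=> x /= + /andP[ax xb] => /(_ ax)[].
  set G := fun y => _ => dG GE.
  have Gx : is_derive x 1 G (r x) by apply: DeriveDef => //; rewrite -derive1E.
  pose c := f a + a.
  have fG : \near x, c + G x - x = f x.
    near=> y; have ay : a <= y by rewrite ltW//; near: y; exact: lt_nbhsr.
    rewrite /G /= rE// ?lexx//; first by rewrite /c; lra.
    by rewrite ltW//; near: y; exact: lt_nbhsl.
  have fx : is_derive x 1 f (0 + r x - 1).
exact: near_eq_is_derive fG _.
  by split; [exact: ex_derive|rewrite derive1E derive_val add0r].
Unshelve. all: by end_near. Qed.

Definition diff_quot (n : nat) (t : R) : R := n.+1%:R * (f (n.+1%:R^-1 + t) - f t).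

Lemma measurable_diff_quot n : measurable_fun setT (diff_quot n).
Proof.
apply: measurable_funM => //; apply: measurable_funB.
  apply: measurableT_comp; last exact: measurable_funD.
  by apply: continuous_measurable_fun; exact: lip_continuous.
by apply: continuous_measurable_fun; exact: lip_continuous.
Qed.

Lemma diff_quot_bounded t : bounded_fun (diff_quot ^~ t).
Proof.
exists 1; split => // M M1 n _; rewrite /= /diff_quot normrM ger0_norm//.
apply: le_trans (ltW M1); rewrite -ler_pdivlMl// mulr1.
apply: le_trans (f_lip _ _) _.
by rewrite addrK ger0_norm.
Qed.

Lemma diff_quot_cvg t : derivable f t 1 -> diff_quot ^~ t @ \oo --> derive1 f t.
Proof.
move=> dft.
have hft : h^-1 *: (f (h + t) - f t) @[h --> 0^'] --> derive1 f t.
  have E : (fun h : R => h^-1 *: (f (h *: (1 : R) + t) - f t)) =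
           (fun h => h^-1 *: (f (h + t) - f t)).
    by apply/funext => h; rewrite [X in f (X + t)]mulr1.
  by rewrite derive1E /derive -E; move: dft => /cvg_ex[l hl]; rewrite (cvg_lim _ hl).
have h0 : n.+1%:R^-1 @[n --> \oo] --> (0:R)^'.
  move=> A A0; change (\forall n \near \oo, A (n.+1%:R^-1)).
  have H : \forall n \near \oo, @harmonic R n != 0 -> A (harmonic n).
    exact: (cvg_harmonic A0).
  by apply: filterS H => n; apply; rewrite invr_eq0 pnatr_eq0.
have := cvg_comp _ _ h0 hft; apply: cvg_trans; apply: near_eq_cvg.
by near=> n; rewrite /= invrK.
Unshelve. all: by end_near. Qed.

(** The densities obtained on different intervals are determined only up to null sets. The upper
    limit of the difference quotients is one measurable function on the whole line that equals the
    derivative wherever the latter exists. *)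
Lemma lip_derivable_ae : exists q : R -> R, [/\ measurable_fun setT q,
  {ae mu, forall x, derivable f x 1 /\ derive1 f x = q x} &
  forall s t, s <= t -> mu.-integrable `]s, t] (EFin \o q) /\
    f t - f s = (\int[mu]_(x in `]s, t]) q x)%R].
Proof.
pose q t := limn_sup (diff_quot ^~ t).
have mq : measurable_fun setT q.
  apply: measurable_fun_limn_sup => [t _|t _|n].
  - exact/bounded_fun_has_ubound/diff_quot_bounded.
  - exact/bounded_fun_has_lbound/diff_quot_bounded.
  - exact: measurable_diff_quot.
have qE t : derivable f t 1 -> derive1 f t = q t.
  by move=> /diff_quot_cvg/cvg_limn_inf_sup h; rewrite /q h.
have dae : {ae mu, forall x, derivable f x 1}.
  rewrite /almost_everywhere; apply: (@negligibleS _ _ _ mu (\bigcup_n [set x | - n.+1%:R < x <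
    n.+1%:R /\ ~ derivable f x 1])).
    move=> x /= nd; exists (Num.bound `|x|) => //=; split => //.
    rewrite -ltr_norml; apply: lt_trans (archi_boundP (normr_ge0 x)) _.
    by rewrite ltr_nat.
  apply: negligible_bigcup => n.
  have [|r [_ _]] := @lip_derivable_ae_itv (- n.+1%:R) n.+1%:R; first by rewrite gtrN.
  apply: negligibleS => x /= [xn nd] h.
  by apply: nd; have [] := h xn.
exists q; split => //.
  apply: filterS dae; first exact: (ae_filter_ringOfSetsType mu).
  by move=> x dx; split => //; exact: qE.
move=> s t; rewrite le_eqVlt => /predU1P[<-|st].
  rewrite set_itv_ge ?bnd_simp// Rintegral_set0 subrr; split => //.
  exact: integrable_set0.
have [r [rint rE rae]] := lip_derivable_ae_itv st.
have rq : ae_eq mu `]s, t]%classic (EFin \o r) (EFin \o q).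
  have t0 : {ae mu, forall x, x != t}.
    exists [set t]; split => //; first exact: lebesgue_measure_set1.
    by move=> x /= /negP; rewrite negbK => /eqP.
  have FF := ae_filter_ringOfSetsType mu.
  apply: filterS2 rae t0 => x h xt; rewrite /= in_itv/= => /andP[sx xt'].
  have [dx <-] : derivable f x 1 /\ derive1 f x = r x.
    by apply: h; rewrite sx lt_neqAle xt.
  by rewrite qE.
have mr : measurable_fun `]s, t] (EFin \o r) by exact: measurable_int rint.
have mqt : measurable_fun `]s, t] (EFin \o q).
  by apply/measurable_EFinP; exact: measurable_funTS.
split.
  apply/integrableP; split => //.
  rewrite -(@ge0_ae_eq_integral _ _ _ mu _ (fun x => `|(EFin \o r) x|%E))//.
  - by move/integrableP : rint => [].
  - exact: measurableT_comp.
  - exact: measurableT_comp.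
  - by apply: filterS rq => x h Dx; rewrite h.
rewrite rE ?lexx ?ltW// /Rintegral; congr fine.
exact: ae_eq_integral.
Qed.

End lipschitz_ftc.

(** * The Euclidean norm on row vectors *)

Section enorm_theory.
Context {R : realType} {d : nat}.
Implicit Types x y : 'rV[R]_d.

Lemma sqr_enorm x : enorm x ^+ 2 = \sum_i x ord0 i ^+ 2.
Proof. by rewrite sqr_sqrtr// sumr_ge0// => i _; exact: sqr_ge0. Qed.

Lemma enorm_ge0 x : 0 <= enorm x.
Proof. exact: sqrtr_ge0. Qed.
Hint Resolve enorm_ge0 : core.

Lemma enorm0 : enorm (0 : 'rV[R]_d) = 0.
Proof. by rewrite /enorm big1 ?sqrtr0// => i _; rewrite mxE expr0n. Qed.

Lemma enormN x : enorm (- x) = enorm x.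
Proof. by rewrite /enorm; congr Num.sqrt; apply: eq_bigr => i _; rewrite mxE sqrrN. Qed.

Lemma enormB x y : enorm (x - y) = enorm (y - x).
Proof. by rewrite -enormN opprB. Qed.

Lemma enormZ (c : R) x : enorm (c *: x) = `|c| * enorm x.
Proof.
rewrite /enorm -sqrtr_sqr -sqrtrM ?sqr_ge0//; congr Num.sqrt.
by rewrite mulr_sumr; apply: eq_bigr => i _; rewrite mxE exprMn.
Qed.

Lemma coord_le_enorm x i : `|x ord0 i| <= enorm x.
Proof.
rewrite -sqrtr_sqr /enorm ler_wsqrtr// (bigD1 i)//= lerDl sumr_ge0// => j _.
exact: sqr_ge0.
Qed.

Lemma enorm_eq0 x : enorm x = 0 -> x = 0.
Proof.
move=> x0; apply/rowP => i; rewrite mxE; apply/normr0_eq0/eqP.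
by rewrite eq_le normr_ge0 andbT -x0 coord_le_enorm.
Qed.

(** Cauchy-Schwarz: the difference of the two sides, multiplied by [2 |x| |y|], is the sum of the
    squares of [|y| x_i - |x| y_i]. *)
Lemma enorm_dot x y : \sum_i x ord0 i * y ord0 i <= enorm x * enorm y.
Proof.
have [/enorm_eq0 ->|x0] := eqVneq (enorm x) 0.
  by rewrite enorm0 mul0r big1// => i _; rewrite mxE mul0r.
have [/enorm_eq0 ->|y0] := eqVneq (enorm y) 0.
  by rewrite enorm0 mulr0 big1// => i _; rewrite mxE mulr0.
have xy0 : 0 < enorm x * enorm y *+ 2.
  by rewrite pmulrn_lgt0// mulr_gt0// lt0r ?x0 ?y0 /=.
rewrite -(ler_pM2l xy0) -subr_ge0.
have -> : enorm x * enorm y *+ 2 * (enorm x * enorm y) -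
    enorm x * enorm y *+ 2 * (\sum_i x ord0 i * y ord0 i) =
    \sum_i (enorm y * x ord0 i - enorm x * y ord0 i) ^+ 2.
  rewrite [RHS](eq_bigr (fun i => enorm y ^+ 2 * x ord0 i ^+ 2 +
      enorm x ^+ 2 * y ord0 i ^+ 2 -
      enorm x * enorm y *+ 2 * (x ord0 i * y ord0 i))); last by move=> i _; ring.
  by rewrite sumrB big_split /= -!mulr_sumr -!sqr_enorm; ring.
by apply: sumr_ge0 => i _; exact: sqr_ge0.
Qed.

Lemma ler_enormD x y : enorm (x + y) <= enorm x + enorm y.
Proof.
rewrite -(@ler_pXn2r _ 2)// ?nnegrE// ?addr_ge0//.
rewrite sqr_enorm sqrrD.
under eq_bigr do rewrite mxE sqrrD.
rewrite !big_split /= -!sqr_enorm lerD2r lerD2l mulr2n.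
by apply: lerD; exact: enorm_dot.
Qed.

Lemma ler_enorm_trans x y z : enorm (x - z) <= enorm (x - y) + enorm (y - z).
Proof. by rewrite (le_trans _ (ler_enormD _ _))// addrA subrK. Qed.

Lemma mx_norm_le_enorm x : `|x| <= enorm x.
Proof.
rewrite [leLHS]/Num.Def.normr/= mx_normrE; apply: bigmax_le => // -[i j] _ /=.
by rewrite ord1 coord_le_enorm.
Qed.

Lemma coord_le_mx_norm x i : `|x ord0 i| <= `|x|.
Proof. by rewrite [leRHS]/Num.Def.normr/= mx_normrE; apply: (le_bigmax _ _ (ord0, i)). Qed.

Lemma enorm_le_sum x : enorm x <= \sum_i `|x ord0 i|.
Proof.
rewrite -(@ler_pXn2r _ 2)// ?nnegrE// ?sumr_ge0//.
rewrite sqr_enorm expr2 mulr_suml; apply: ler_sum => i _.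
rewrite -real_normK ?num_real// expr2 ler_wpM2l// (bigD1 i)//= lerDl sumr_ge0//.
Qed.

Lemma enorm_le_mx_norm x : enorm x <= d%:R * `|x|.
Proof.
apply: le_trans (enorm_le_sum x) _; rewrite mulr_natl -[X in _ *+ X]card_ord -sumr_const.
by apply: ler_sum => i _; exact: coord_le_mx_norm.
Qed.

Lemma enorm_continuous : continuous (@enorm R d).
Proof.
move=> x; apply/(@cvgrPdist_le _ _ _ (nbhs x)) => e e0.
(* Dividing by [d.+1] instead of [d] keeps the divisor positive when [d = 0]. *)
have e0' : 0 < e / d.+1%:R by rewrite divr_gt0.
near=> y.
have H : enorm (x - y) <= e.
  apply: le_trans (enorm_le_mx_norm _) _.
  apply: (@le_trans _ _ (d.+1%:R * `|x - y|)); first by rewrite ler_wpM2r// ler_nat.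
  rewrite mulrC -ler_pdivlMr//; near: y; exact: cvgr_dist_le.
rewrite ler_norml; apply/andP; split.
  rewrite lerBrDl lerBlDr; apply: le_trans (lerD (lexx _) H).
  by rewrite enormB addrC -{1}(subrK x y) ler_enormD.
rewrite lerBlDr; apply: le_trans (lerD H (lexx _)).
by rewrite -{1}(subrK y x) ler_enormD.
Unshelve. all: by end_near. Qed.

End enorm_theory.
#[global] Hint Resolve enorm_ge0 : core.

Section curve_speed.
Context {R : realType} {d : nat}.
Implicit Types (g : curve R d) (s t : R).
Local Notation leb := (@lebesgue_measure R).

(** By [curve_nonpos] the curve factors through [t |-> max t 0], which is 1-Lipschitz. This gives
    the bound on the whole line, as the results on Lipschitz functions require. *)
Lemma curve_lip g s t : enorm (g t - g s) <= `|t - s|.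
Proof.
have H u : g u = g (Num.max u 0).
  by case: (leP 0 u) => // u0; rewrite curve_nonpos// ltW.
rewrite (H t) (H s); apply: le_trans (curve_lipschitz _ _ _) _; rewrite ?le_max ?lexx ?orbT//.
by case: (leP 0 t) => ?; case: (leP 0 s) => ?; rewrite ler_norml; apply/andP; split;
  have := ler_norm (t - s); have := ler_norm (s - t); rewrite distrC; lra.
Qed.

Lemma coord_lip g i s t : `|g t ord0 i - g s ord0 i| <= `|t - s|.
Proof.
by apply: le_trans (curve_lip g s t); have := coord_le_enorm (g t - g s) i; rewrite !mxE.
Qed.

Lemma speed_ge0 g t : 0 <= speed g t.
Proof. exact: enorm_ge0. Qed.

(** A divergent limit takes the default value, here the zero vector. Hence the speed vanishes where
    the derivative fails to exist. *)
Lemma ndrv_derive1 (f : R -> 'rV[R]_d) t : ~ derivable f t 1 -> derive1 f t = 0.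
Proof.
move=> nd; rewrite derive1E /derive dvgP//.
by apply/rowP => i; rewrite !mxE.
Qed.

Lemma speed_le1 g t : speed g t <= 1.
Proof.
rewrite /speed; have [dg|ndg] := pselect (derivable g t 1); last first.
  by rewrite ndrv_derive1// enorm0.
rewrite derive1E; have := dg; rewrite /derive => /cvg_ex[l hl]; rewrite (cvg_lim _ hl)//.
have := cvg_comp _ _ hl (@enorm_continuous R d l).
move=> /cvgr_to_le; apply; near=> h.
rewrite /= enormZ.
have h0 : h != 0 by near: h; exact: nbhs_dnbhs_neq.
rewrite normrV ?unitfE// ler_pdivrMl ?normr_gt0// mulr1.
apply: le_trans (curve_lip _ _ _) _.
by rewrite addrK [h *: 1]mulr1.
Unshelve. all: by end_near. Qed.

(* A measurable substitute for the speed, whose own measurability is not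
   needed. *)
Lemma speed_minorant g : exists p : R -> R, [/\ measurable_fun setT p,
  (forall t, 0 <= p t <= speed g t) &
  forall s t, s <= t ->
    ((enorm (g t - g s))%:E <= \int[leb]_(u in `]s, t]) (p u)%:E)%E].
Proof.
have /choice[q qP] := fun i => lip_derivable_ae (coord_lip g i).
pose qv t : 'rV[R]_d := \row_i q i t.
have mqv : measurable_fun setT (fun t => enorm (qv t)).
  have ms : measurable_fun setT (@Num.sqrt R).
    by apply: continuous_measurable_fun => x; exact: sqrt_continuous.
  apply: (measurableT_comp ms).
  apply: measurable_sum => i; apply: measurable_funX.
  rewrite (_ : (fun x => _) = q i); first by have [] := qP i.
  by apply/funext => x; rewrite mxE.
have : leb.-negligible (~` [set t | derivable g t 1 /\ derive1 g t = qv t]).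
  have : forall i, leb.-negligible (~` [set t | derivable (fun t => g t ord0 i) t 1 /\
      derive1 (fun t => g t ord0 i) t = q i t]).
    by move=> i; have [_ h _] := qP i.
  move=> hi; apply: (@negligibleS _ _ _ leb (\bigcup_k
      (if insub k is Some i then ~` [set t | derivable (fun t => g t ord0 i) t 1 /\
      derive1 (fun t => g t ord0 i) t = q i t] else set0))).
    move=> t nt; apply: contrapT => nU; apply: nt.
    have H i : derivable (fun t => g t ord0 i) t 1 /\ derive1 (fun t => g t ord0 i) t = q i t.
      by apply: contrapT => ni; apply: nU; exists i => //=; rewrite valK.
    have dg : derivable g t 1.
      by apply/derivable_mxP => j i; rewrite (ord1 j); have [] := H i.
    split => //; rewrite derive1E derive_mx//; apply/rowP => i; rewrite !mxE.
    by have [_ <-] := H i; rewrite derive1E.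
  apply: negligible_bigcup => k; case: insub => [i|]; last exact: negligible_set0.
  exact: hi.
move=> [N [mN N0 NP]].
have NE t : ~ N t -> enorm (qv t) = speed g t.
  by move=> Nt; have /contrapT[_ h] : ~ ~ (derivable g t 1 /\ derive1 g t = qv t);
    [move=> /NP|rewrite /speed h].
have p0 u : 0 <= enorm (qv u) * \1_(~` N) u.
  by apply: mulr_ge0; [exact: enorm_ge0|rewrite indicE].
have mp : measurable_fun setT (fun u => enorm (qv u) * \1_(~` N) u).
  by apply: measurable_funM => //; apply: measurable_indic; exact: measurableC.
(* Cutting off the null set [N] makes the bound by the speed hold at every time. *)
exists (fun t => enorm (qv t) * \1_(~` N) t); split => //.
- move=> t; rewrite indicE; case: (boolP (t \in ~` N)) => [/set_mem Nt|_].
    by rewrite mulr1 NE// speed_ge0 lexx.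
  by rewrite mulr0 lexx speed_ge0.
move=> s t st.
have [v0|v0] := eqVneq (enorm (g t - g s)) 0.
  by rewrite v0 integral_ge0// => u _; rewrite lee_fin.
have vgt0 : 0 < enorm (g t - g s) by rewrite lt0r v0 enorm_ge0.
have mst : measurable (`]s, t]%classic : set (measurableTypeR R)) by [].
have qi i : leb.-integrable `]s, t] (EFin \o q i) by have [_ _ /(_ _ _ st)[]] := qP i.
pose v i := (g t - g s) ord0 i.
have vE i : v i = (\int[leb]_(u in `]s, t]) q i u)%R.
  by have [_ _ /(_ _ _ st)[_ <-]] := qP i; rewrite /v !mxE.
have -> : (\int[leb]_(u in `]s, t]) (enorm (qv u) * \1_(~` N) u)%:E =
    \int[leb]_(u in `]s, t]) (enorm (qv u))%:E)%E.
  apply: ge0_ae_eq_integral => //.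
  - by apply/measurable_EFinP; exact: measurable_funTS.
  - by apply/measurable_EFinP; exact: measurable_funTS.
  - by move=> u _; rewrite lee_fin.
  - by move=> u _; rewrite lee_fin enorm_ge0.
  - exists N; split => // u /= /not_implyP[_ h]; apply: contrapT => Nu; apply: h.
    by rewrite indicE mem_set// mulr1.
(* With [v = g t - g s] and [q] the vector of derivatives, multiplication by [|v|] reduces the claim
   to [|v|^2 = int <v, q> <= |v| int |q|], which is Cauchy-Schwarz under the integral. *)
rewrite -(@lee_pmul2l _ (enorm (g t - g s))%:E)//.
rewrite -ge0_integralZl_EFin ?enorm_ge0//; first last.
- by apply/measurable_EFinP; exact: measurable_funTS.
- by move=> u _; rewrite lee_fin enorm_ge0.
rewrite -EFinM -expr2 sqr_enorm.
have mfEq i : leb.-integrable `]s, t] (fun u => (v i)%:E * (q i u)%:E)%E.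
  exact: (integrableZl mst (v i) (qi i)).
apply: (@le_trans _ _ (\int[leb]_(u in `]s, t]) (\sum_i ((v i)%:E * (q i u)%:E))%E)%E).
  rewrite integral_sum// -sumEFin; apply: lee_sum => i _.
  rewrite integralZl//; last exact: qi.
  have -> : (\int[leb]_(u in `]s, t]) (q i u)%:E = (v i)%:E)%E.
    by rewrite vE /Rintegral fineK//; exact: integrable_fin_num (qi i).
  by rewrite -EFinM -expr2.
apply: le_integral => //.
- exact: integrable_sum.
- apply: integrableZl => //.
  apply: (@le_integrable _ _ _ leb _ mst _ (fun u => \sum_i `|(q i u)%:E|)%E) => //.
  + by apply/measurable_EFinP; exact: measurable_funTS.
  + move=> u _; rewrite gee0_abs ?lee_fin ?enorm_ge0//.
    rewrite (eq_bigr (fun i => `|q i u|%:E))// sumEFin lee_fin;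
      apply: le_trans (enorm_le_sum _) (le_trans _ (ler_norm _)).
    by apply: ler_sum => i _; rewrite mxE.
  + by apply: (integrable_sum mst) => i _; exact: (integrable_abse (qi i)).
move=> u _; rewrite sumEFin lee_fin.
apply: le_trans (enorm_dot (g t - g s) (qv u)).
by apply: ler_sum => i _; rewrite /v !mxE.
Qed.

End curve_speed.

(** * Topology and Borel sets of the space of curves *)

Section curve_topology.
Context {R : realType} {d : nat}.
Implicit Types (g : curve R d) (s t : R).
Local Notation fam := {family (@compactly_in R `[0, +oo[), R -> 'rV[R]_d}.

Lemma curve_fun_continuous : continuous (@curve_fun R d : curve R d -> fam).
Proof. exact: (@initial_continuous (curve R d) fam (@curve_fun R d)). Qed.

Lemma curve_eval_near g t e : 0 <= t -> 0 < e ->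
  nbhs g [set h : curve R d | enorm (h t - g t) < e].
Proof.
move=> t0 e0; set e' := e / d.+1%:R.
have e'0 : 0 < e' by rewrite divr_gt0.
have H : nbhs (curve_fun g : fam)
    [set f : fam | forall y, [set t] y -> ball (g y) e' (f y)].
  apply: (@fam_nbhs _ _ _ [set t] [set xy | ball xy.1 e' xy.2]).
    exact: (entourage_ball _ (PosNum e'0)).
  split; last exact: compact_set1.
  by move=> _ ->; rewrite /= in_itv /= t0.
apply: (@filterS _ (nbhs g) _ _ _ _ (curve_fun_continuous H)) => h /(_ t erefl) /=.
rewrite -ball_normE /= distrC => gh.
apply: le_lt_trans (enorm_le_mx_norm _) _.
apply: (@le_lt_trans _ _ (d.+1%:R * `|h t - g t|)); first by rewrite ler_wpM2r// ler_nat.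
by rewrite mulrC -ltr_pdivlMr.
Qed.

(** The points [k / (N + 1)] fill [[0, N + 1]] with step [1 / (N + 1)]. As both curves are
    1-Lipschitz, closeness within [1 / (N + 1)] at these points gives closeness within [3 / (N + 1)]
    on the whole interval, hence uniformly on compact sets as [N] grows. *)
Lemma curve_nbhs_grid g (W : set (curve R d)) : nbhs g W ->
  exists N : nat, [set h : curve R d | forall k, (k <= N.+1 ^ 2)%N ->
    enorm (h (k%:R / N.+1%:R) - g (k%:R / N.+1%:R)) < N.+1%:R^-1] `<=` W.
Proof.
move=> gW; apply: contrapT => /forallNP H.
have /choice[h hP] : forall N, exists h : curve R d, (forall k, (k <= N.+1 ^ 2)%N ->
    enorm (h (k%:R / N.+1%:R) - g (k%:R / N.+1%:R)) < N.+1%:R^-1) /\ ~ W h.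
  by move=> N; have /existsNP[h /not_implyP[? ?]] := H N; exists h.
suff : (h n : curve R d) @[n --> \oo] --> g.
  by move=> /(_ _ gW)[n _ /(_ n (leqnn n))]; have [_] := hP n.
suff : (h n : fam) @[n --> \oo] --> (curve_fun g : fam).
  move=> hg V; case=> B; case; case=> O oO BO Og OV.
  rewrite -{}BO in Og OV.
  have HO : nbhs (curve_fun g : fam) O by exact: open_nbhs_nbhs.
  exact: (@filterS _ \oo _ _ _ (fun n => OV (h n)) (hg _ HO)).
apply/fam_cvgP => A [A0 cA].
have [M M0 AM] : exists2 M, 0 < M & forall t, A t -> t <= M.
  have [M [_ /(_ (`|M| + 1))]] := compact_bounded cA.
  rewrite (le_lt_trans (ler_norm M)) ?ltrDl// => /(_ isT) AM.
  exists (`|M| + 1); first by rewrite ltr_wpDl.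
  by move=> t /AM; exact: le_trans (ler_norm _).
move=> P /uniform_nbhs[E [entE EP]].
have [r /= r0 rE] : exists2 r : R, 0 < r & [set xy | ball xy.1 r xy.2] `<=` E.
  by move: entE; rewrite -entourage_ballE => -[r r0 rE]; exists r.
change (\forall n \near \oo, P (h n)); near=> n; apply: EP => y Ay; apply: rE => /=.
have y0 : 0 <= y by have := A0 _ Ay; rewrite /= in_itv /= andbT.
have yM := AM _ Ay.
have nM : M <= n.+1%:R.
  apply: (@le_trans _ _ n%:R); last by rewrite ler_nat.
  by near: n; exact: nbhs_infty_ger.
have nr : 3 / n.+1%:R < r.
  rewrite ltr_pdivrMr// -ltr_pdivrMl//; rewrite mulrC; apply: (@lt_le_trans _ _ n%:R);
    last by rewrite ler_nat.
  by near: n; exact: nbhs_infty_gtr.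
set m := n.+1%:R in nM nr; have m0 : 0 < m :> R by rewrite ltr0n.
pose k := Num.truncn (y * m).
have /andP[k1 k2] : k%:R <= y * m < k.+1%:R by apply: truncn_itv; rewrite mulr_ge0// ltW.
have kn : (k <= n.+1 ^ 2)%N.
  rewrite -(ler_nat R) natrX expr2; apply: le_trans k1 _.
  by rewrite ler_wpM2r ?(ltW m0)// (le_trans yM).
have [/(_ k kn) hk _] := hP n.
rewrite -ball_normE /=; apply: le_lt_trans nr.
apply: le_trans (mx_norm_le_enorm _) _; rewrite enormB.
have yk : `|y - k%:R / m| <= m^-1.
  have -> : y - k%:R / m = (y * m - k%:R) / m by field; exact: lt0r_neq0.
  rewrite ger0_norm; last by rewrite divr_ge0 ?subr_ge0// ltW.
  rewrite ler_piMl ?invr_ge0 ?(ltW m0)//; move: k2; rewrite -natr1; lra.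
have -> : 3 / m = m^-1 + m^-1 + m^-1 by field; exact: lt0r_neq0.
apply: le_trans (ler_enorm_trans _ (g (k%:R / m)) _) _.
apply: lerD; last first.
  by apply: le_trans (curve_lip _ _ _) _; rewrite distrC.
apply: le_trans (ler_enorm_trans _ (h n (k%:R / m)) _) _.
apply: lerD; last exact: ltW.
exact: le_trans (curve_lip _ _ _) _.
Unshelve. all: by end_near. Qed.

Lemma rat_vec_approx (x : 'rV[R]_d) e : 0 < e ->
  exists q : 'rV[rat]_d, enorm (x - map_mx ratr q) < e.
Proof.
move=> e0; set e' := e / d.+1%:R.
have e'0 : 0 < e' by rewrite divr_gt0.
have /choice[q qx] : forall i, exists q : rat, `|x ord0 i - ratr q| < e'.
  move=> i; have [q] := @rat_in_itvoo R (x ord0 i) (x ord0 i + e') (ltr_pwDr e'0 (lexx _)).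
  rewrite in_itv /= => /andP[q1 q2]; exists q.
  by rewrite distrC ger0_norm ?subr_ge0 1?ltW// ltrBlDl.
exists (\row_i q i).
apply: le_lt_trans (enorm_le_sum _) _.
apply: (@le_lt_trans _ _ (\sum_(i < d) e')).
  by apply: ler_sum => i _; rewrite !mxE ltW.
rewrite sumr_const card_ord -mulr_natl mulrCA gtr_pMr// ltr_pdivrMr// mul1r ltr_nat.
exact: ltnSn.
Qed.

(** A countable family of which every open set of curves is a union. The radius is half of that in
    [curve_nbhs_grid]; the other half absorbs the rational approximation of the values of a
    curve. *)
Definition grid_cell (c : nat * seq 'rV[rat]_d) : set (curve R d) :=
  [set h | forall k, (k <= c.1.+1 ^ 2)%N ->
    enorm (h (k%:R / c.1.+1%:R) - map_mx ratr (nth 0 c.2 k)) < c.1.+1%:R^-1 / 2].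

Lemma curve_open_grid (W : set (curve R d)) : open W ->
  W = \bigcup_(c in [set c | grid_cell c `<=` W]) grid_cell c.
Proof.
move=> oW; apply/seteqP; split => [g Wg|g [c /= cW /cW]]//.
have [N NW] : exists N : nat, [set h : curve R d | forall k, (k <= N.+1 ^ 2)%N ->
    enorm (h (k%:R / N.+1%:R) - g (k%:R / N.+1%:R)) < N.+1%:R^-1] `<=` W.
  by apply: curve_nbhs_grid; exact: open_nbhs_nbhs.
have e0 : 0 < N.+1%:R^-1 / 2 :> R by rewrite divr_gt0.
have /choice[q qP] := fun k : nat => rat_vec_approx (g (k%:R / N.+1%:R)) e0.
have nthq k : (k <= N.+1 ^ 2)%N -> nth 0 (mkseq q (N.+1 ^ 2).+1) k = q k.
  by move=> kN; rewrite nth_mkseq.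
exists (N, mkseq q (N.+1 ^ 2).+1); last by move=> k /= kN; rewrite nthq.
move=> h hc; apply: NW => k kN.
rewrite [ltRHS]splitr; apply: le_lt_trans (ler_enorm_trans _ (map_mx ratr (q k)) _) _.
apply: ltrD; last by rewrite enormB.
by have := hc k kN; rewrite /= nthq.
Qed.

Lemma curve_eval_open t (x : 'rV[R]_d) e : 0 <= t ->
  open [set h : curve R d | enorm (h t - x) < e].
Proof.
move=> t0; rewrite openE => h /= hx.
have e0 : 0 < e - enorm (h t - x) by rewrite subr_gt0.
apply: filterS (curve_eval_near h t0 e0) => k /=.
rewrite ltrBrDr; apply: le_lt_trans; exact: ler_enorm_trans.
Qed.

Lemma Gamma_open_measurable (W : set (curve R d)) :
  open W -> measurable (W : set (Gamma R d)).
Proof. by move=> oW; exact: sub_gen_smallest. Qed.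

(** Open sets are countable unions of grid cells, and a cell constrains only finitely many
    evaluations; so evaluations detect measurability. *)
Lemma measurable_to_Gamma d' (T : measurableType d') (f : T -> Gamma R d) :
  (forall t (x : 'rV[R]_d) e, 0 <= t ->
    measurable [set w | enorm ((f w : curve R d) t - x) < e]) ->
  measurable_fun setT f.
Proof.
move=> mf.
have E : @measurable _ (Gamma R d) = <<s @open (curve R d) >> by [].
apply: (measurability _ E) => _ [W oW <-]; rewrite setTI.
rewrite (curve_open_grid oW) preimage_bigcup bigcup_mkcond.
apply: countable_bigcupT_measurable => // c; case: ifP => // _.
rewrite (_ : _ @^-1` _ = \bigcap_(k in [set k | (k <= c.1.+1 ^ 2)%N])
    [set w | enorm ((f w : curve R d) (k%:R / c.1.+1%:R) - map_mx ratr (nth 0 c.2 k)) <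
      c.1.+1%:R^-1 / 2]).
  by apply: bigcap_measurable => [|k _]; [exists 0%N|exact: mf].
by apply/seteqP; split.
Qed.

End curve_topology.

(** * Length of curves *)

Section variation.
Context {R : realType} {d : nat}.
Implicit Types (g : curve R d) (x y s t : R) (u : seq R).
Local Notation leb := (@lebesgue_measure R).

Fixpoint poly_length (g : R -> 'rV[R]_d) (x : R) (u : seq R) : R :=
  if u is y :: u' then enorm (g y - g x) + poly_length g y u' else 0.

Definition subdivisions (t : R) : set (seq R) :=
  [set u | path <=%R 0 u /\ last 0 u <= t].

(** The length of the arc over [[0, t]]. Being a supremum of finite sums of chords, it depends on
    the curve in a lower semicontinuous, hence Borel, way; no derivative enters. *)
Definition var g t : R := sup [set poly_length g 0 u | u in subdivisions t].

Lemma path_le_last x u : path <=%R x u -> x <= last x u.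
Proof. by elim: u x => //= y u ih x /andP[xy /ih]; exact: le_trans. Qed.

Lemma poly_length_le g x u : path <=%R x u -> poly_length g x u <= last x u - x.
Proof.
elim: u x => [|y u ih] x /=; first by rewrite subrr.
move=> /andP[xy /ih h]; have := curve_lip g x y.
by rewrite ger0_norm ?subr_ge0//; lra.
Qed.

Lemma poly_length_rcons g x u t :
  poly_length g x (rcons u t) = poly_length g x u + enorm (g t - g (last x u)).
Proof. by elim: u x => [|y u ih] x /=; rewrite ?addr0 ?add0r// ih addrA. Qed.

Lemma poly_length_has_sup g t : 0 <= t ->
  has_sup [set poly_length g 0 u | u in subdivisions t].
Proof.
move=> t0; split; first by exists 0, [::].
exists t => _ [u [pu ut] <-].
by apply: le_trans (poly_length_le _ pu) _; rewrite subr0.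
Qed.

Lemma poly_length_le_var g u t : path <=%R 0 u -> last 0 u <= t ->
  poly_length g 0 u <= var g t.
Proof.
move=> pu ut; have t0 : 0 <= t by exact: le_trans (path_le_last pu) ut.
by apply: (ub_le_sup (poly_length_has_sup g t0).2); exists u.
Qed.

Lemma var_le g t (M : R) : 0 <= t ->
  (forall u, path <=%R 0 u -> last 0 u <= t -> poly_length g 0 u <= M) -> var g t <= M.
Proof.
move=> t0 h; apply: ge_sup; first by have [] := poly_length_has_sup g t0.
by move=> _ [u [pu ut] <-]; exact: h.
Qed.

Lemma var_ge0 g t : 0 <= t -> 0 <= var g t.
Proof. by move=> t0; apply: (@poly_length_le_var g [::]). Qed.

Lemma var_enorm g s t : 0 <= s -> s <= t -> enorm (g t - g s) + var g s <= var g t.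
Proof.
move=> s0 st; rewrite -lerBrDl; apply: var_le => // u pu us.
rewrite lerBrDl.
have pu' : path <=%R 0 (rcons (rcons u s) t) by rewrite !rcons_path pu us last_rcons.
have := @poly_length_le_var g _ t pu'; rewrite last_rcons lexx => /(_ isT).
apply: le_trans; rewrite !poly_length_rcons last_rcons addrC -addrA lerD2l.
by rewrite lerDr enorm_ge0.
Qed.

Lemma var_nd g s t : 0 <= s -> s <= t -> var g s <= var g t.
Proof.
move=> s0 st; apply: le_trans (var_enorm g s0 st).
by rewrite lerDr enorm_ge0.
Qed.

(** Inserting [s] as a further vertex can only lengthen the polygon, by the triangle inequality. *)
Lemma poly_length_split g x u s t : path <=%R x u -> x <= s -> s <= t ->
  last x u <= t ->
  exists u1 u2, [/\ path <=%R x u1, last x u1 <= s, path <=%R s u2, last s u2 <= t &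
    poly_length g x u <= poly_length g x u1 + poly_length g s u2].
Proof.
elim: u x => [|y u ih] x /=; first by move=> _ xs st _; exists [::], [::]; rewrite /= addr0.
move=> /andP[xy pu] xs st ut; have [ys|sy] := leP y s.
  have [u1 [u2 [p1 l1 p2 l2 h]]] := ih y pu ys st ut.
  exists (y :: u1), u2; split => //=; first by rewrite xy.
  by rewrite -addrA lerD2l.
exists [:: s], (y :: u); split => //=; rewrite ?xs ?(ltW sy)//.
by rewrite addr0 addrA lerD2r addrC ler_enorm_trans.
Qed.

Lemma var_split g s t (M : R) : 0 <= s -> s <= t ->
  (forall u, path <=%R s u -> last s u <= t -> poly_length g s u <= M) ->
  var g t <= var g s + M.
Proof.
move=> s0 st h; apply: var_le => [|u pu ut]; first exact: le_trans st.
have [u1 [u2 [p1 l1 p2 l2 hu]]] := poly_length_split g pu s0 st ut.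
apply: le_trans hu _; apply: lerD; last exact: h.
exact: poly_length_le_var.
Qed.

Lemma var_lip g s t : 0 <= s -> s <= t -> var g t <= var g s + (t - s).
Proof.
move=> s0 st; apply: var_split => // u pu ut.
by apply: le_trans (poly_length_le _ pu) _; rewrite lerD2r.
Qed.

Lemma var_dist g s t : 0 <= s -> 0 <= t -> enorm (g t - g s) <= `|var g t - var g s|.
Proof.
wlog st : s t / s <= t.
  move=> h s0 t0; have [|/ltW] := leP s t; first by move=> ?; exact: h.
  by move=> ?; rewrite enormB distrC; exact: h.
move=> s0 _; rewrite ger0_norm ?subr_ge0 ?var_nd//.
by rewrite lerBrDr var_enorm.
Qed.

Lemma var_norm_lip g s t : 0 <= s -> 0 <= t -> `|var g t - var g s| <= `|t - s|.
Proof.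
wlog st : s t / s <= t.
  move=> h s0 t0; have [|/ltW] := leP s t; first by move=> ?; exact: h.
  by move=> ?; rewrite distrC [leRHS]distrC; exact: h.
move=> s0 _; rewrite !ger0_norm ?subr_ge0 ?var_nd//.
by rewrite lerBlDl var_lip.
Qed.

Lemma var0 g : var g 0 = 0.
Proof.
apply/eqP; rewrite eq_le var_ge0// andbT.
by apply: var_le => // u pu u0; apply: le_trans (poly_length_le _ pu) _; rewrite subr0.
Qed.

(** The variation is continuous in time, so each intermediate arc length is attained; this provides
    the arc-length parameter without constructing an inverse function. *)
Lemma var_IVT g t v : 0 <= t -> 0 <= v -> v <= var g t ->
  exists s, [/\ 0 <= s, s <= t & var g s = v].
Proof.
move=> t0 v0 vt.
pose h x := var g (Num.max x 0).
have ch : continuous h.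
  move=> x; apply/(@cvgrPdist_le _ _ _ (nbhs x)) => e e0; near=> y.
  have mx0 (z : R) : 0 <= Num.max z 0 by rewrite le_max lexx orbT.
  apply: le_trans (var_norm_lip _ _ _) _; rewrite ?mx0//.
  apply: (@le_trans _ _ `|x - y|); last by near: y; apply: cvgr_dist_le.
  by case: (leP x 0) => ?; case: (leP y 0) => ?; rewrite ler_norml; apply/andP; split;
    have := ler_norm (x - y); have := ler_norm (y - x); rewrite distrC; lra.
have [||s st hs] := @IVT R h 0 t v t0.
- exact: continuous_subspaceT.
- rewrite /h maxxx var0 (max_l t0) min_l ?max_r//; first by rewrite v0.
  + exact: var_ge0.
  + exact: var_ge0.
move: st hs; rewrite in_itv /= => /andP[s0 st']; rewrite /h (max_l s0) => <-.
by exists s.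
Unshelve. all: by end_near. Qed.

Lemma var_le_integral g (p : R -> R) : measurable_fun setT p -> (forall t, 0 <= p t) ->
  (forall s t, s <= t -> ((enorm (g t - g s))%:E <= \int[leb]_(u in `]s, t]) (p u)%:E)%E) ->
  forall s t, 0 <= s -> s <= t ->
  ((var g t - var g s)%:E <= \int[leb]_(u in `]s, t]) (p u)%:E)%E.
Proof.
move=> mp p0 pg s t s0 st.
case I : (\int[leb]_(u in `]s, t]) (p u)%:E)%E => [r| |]; last 2 first.
- by rewrite leey.
- suff : (0 <= \int[leb]_(u in `]s, t]) (p u)%:E)%E by rewrite I.
  by apply: integral_ge0 => u _; rewrite lee_fin.
rewrite lee_fin lerBlDl; apply: var_split => // u pu ut.
rewrite -lee_fin -I; elim: u s {I s0 st} pu ut => [|y u ih] s /=.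
  by move=> _ st; apply: integral_ge0 => u _; rewrite lee_fin.
move=> /andP[sy pu] ut; have yt : y <= t.
  exact: le_trans (path_le_last pu) ut.
have -> : `]s, t]%classic = `]s, y]%classic `|` `]y, t]%classic.
  by apply: itv_bndbnd_setU; rewrite bnd_simp.
rewrite ge0_integral_setU//=.
- by rewrite EFinD; apply: leeD; [exact: pg|exact: ih].
- by apply/measurable_EFinP; exact: measurable_funTS.
- by move=> z _; rewrite lee_fin.
- apply/disj_set2P; apply/seteqP; split => // z [/=]; rewrite !in_itv/=.
  by move=> /andP[_ zy] /andP[yz _]; move: (lt_le_trans yz zy); rewrite ltxx.
Qed.

Lemma poly_length_continuous x u (c : R) : 0 <= x -> path <=%R x u ->
  open [set g : curve R d | c < poly_length g x u].
Proof.
move=> x0 pu; rewrite openE => g /= cg.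
set e := poly_length g x u - c.
have e0 : 0 < e by rewrite subr_gt0.
suff : nbhs g [set h : curve R d | poly_length g x u - poly_length h x u < e].
  by apply: filterS => h /=; rewrite /e ltrD2l ltrN2.
clearbody e; elim: u x x0 pu e e0 {cg} => [|y u ih] x x0 /=.
  by move=> _ e e0; apply: filterE => h /=; rewrite subr0.
move=> /andP[xy pu] e e0; have y0 : 0 <= y by exact: le_trans xy.
have e3 : 0 < e / 3 by rewrite divr_gt0.
have H1 := curve_eval_near g x0 e3.
have H2 := curve_eval_near g y0 e3.
have H3 := ih y y0 pu _ e3.
apply: filterS3 H1 H2 H3 => h /= h1 h2 h3.
have : enorm (g y - g x) <= enorm (g y - h y) + enorm (h y - h x) + enorm (h x - g x).
  apply: le_trans (ler_enorm_trans _ (h y) _) _; rewrite -addrA lerD2l.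
  exact: ler_enorm_trans.
rewrite (enormB (g y) (h y)) => h4.
have : e = e / 3 + e / 3 + e / 3 by field.
lra.
Qed.

Lemma var_open t (c : R) : 0 <= t -> open [set g : curve R d | c < var g t].
Proof.
move=> t0; have -> : [set g : curve R d | c < var g t] =
    \bigcup_(u in subdivisions t) [set g : curve R d | c < poly_length g 0 u].
  apply/seteqP; split => [g /= cg|g [u [pu ut] /= cg]].
    have [_ [u ? <-] ?] := sup_gt (poly_length_has_sup g t0).1 cg.
    by exists u.
  exact: lt_le_trans (poly_length_le_var g pu ut).
by apply: bigcup_open => u [pu _]; exact: poly_length_continuous.
Qed.

End variation.

Section truncated_length.
Context {R : realType} {d : nat}.
Implicit Types (g : curve R d) (s t : R).

(* The minimum of [s] and the length of [g]. *)
Definition tlen g s : R := sup [set Num.min s (var g k%:R) | k in [set: nat]].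

Lemma tlen_has_sup g s : has_sup [set Num.min s (var g k%:R) | k in [set: nat]].
Proof.
split; first by exists (Num.min s (var g 0)), 0%N.
by exists s => _ [k _ <-]; rewrite ge_min lexx.
Qed.

Lemma tlen_le g s : tlen g s <= s.
Proof.
apply: ge_sup; first by have [] := tlen_has_sup g s.
by move=> _ [k _ <-]; rewrite ge_min lexx.
Qed.

Lemma tlen_ge g s t : 0 <= t -> Num.min s (var g t) <= tlen g s.
Proof.
move=> t0; pose k := Num.bound t.
have tk : t <= k%:R by rewrite ltW// archi_boundP.
apply: (@le_trans _ _ (Num.min s (var g k%:R))).
  by rewrite le_min ge_min lexx /= ge_min var_nd ?orbT.
by apply: (ub_le_sup (tlen_has_sup g s).2); exists k.
Qed.

Lemma tlen_le_bound g s (M : R) : (forall t, 0 <= t -> Num.min s (var g t) <= M) ->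
  tlen g s <= M.
Proof.
move=> h; apply: ge_sup; first by have [] := tlen_has_sup g s.
by move=> _ [k _ <-]; exact: h.
Qed.

Lemma tlen_ge0 g s : 0 <= s -> 0 <= tlen g s.
Proof. by move=> s0; apply: le_trans (tlen_ge g s (lexx 0)); rewrite var0 le_min s0 lexx. Qed.

Lemma tlen_var g s t : 0 <= t -> `|tlen g s - var g t| <= `|s - var g t|.
Proof.
move=> t0; have h1 := tlen_ge g s t0; have h2 := tlen_le g s.
case: (leP s (var g t)) h1 => st h1.
  by have -> : tlen g s = s by apply/eqP; rewrite eq_le h1 h2.
by rewrite !ger0_norm ?subr_ge0 ?(ltW st)// lerD2r.
Qed.

Lemma tlen_nd g s s' : s <= s' -> tlen g s <= tlen g s'.
Proof.
move=> ss'; apply: tlen_le_bound => t t0; apply: le_trans (tlen_ge g s' t0).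
by rewrite le_min !ge_min ss' lexx /= orbT.
Qed.

Lemma tlen_lip g s s' : `|tlen g s - tlen g s'| <= `|s - s'|.
Proof.
wlog ss' : s s' / s <= s'.
  move=> h; have [|/ltW] := leP s s'; first exact: h.
  by move=> ?; rewrite distrC [leRHS]distrC; exact: h.
rewrite distrC [leRHS]distrC !ger0_norm ?subr_ge0 ?tlen_nd//.
rewrite lerBlDr; apply: tlen_le_bound => t t0.
have := tlen_ge g s t0; case: (leP s (var g t)) => h1 h2; case: (leP s' (var g t)) => h3; lra.
Qed.

(** If the curve reaches length [s], some time has variation exactly [s]; otherwise an integer time
    nearly attains the supremum. Moving on to a nearby rational time costs little, the variation
    being 1-Lipschitz. *)
Lemma tlen_approx g s e : 0 < e -> 0 <= s ->
  exists q : rat, 0 <= ratr q :> R /\ `|var g (ratr q) - tlen g s| < e.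
Proof.
move=> e0 s0; have e2 : 0 < e / 2 by rewrite divr_gt0.
have [t t0 te] : exists2 t, 0 <= t & `|var g t - tlen g s| < e / 2.
  have [_ [k _ <-] ke] := sup_adherent e2 (tlen_has_sup g s).
  rewrite -/(tlen g s) in ke.
  have k0 : 0 <= k%:R :> R by [].
  have [sk|ks] := leP s (var g k%:R).
    have [t [t0 _ vt]] := var_IVT k0 s0 sk; exists t => //.
    have := tlen_ge g s t0; have := tlen_le g s; rewrite vt minxx => h1 h2.
    by have -> : tlen g s = s; [lra|rewrite subrr normr0].
  exists k%:R => //; have := tlen_ge g s k0.
  rewrite min_r ?(ltW ks)// in ke * => h.
  by rewrite distrC ger0_norm ?subr_ge0//; lra.
have [q] := @rat_in_itvoo R t (t + e / 2) (ltr_pwDr e2 (lexx _)).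
rewrite in_itv /= => /andP[tq qt].
have q0 : 0 <= ratr q :> R by rewrite (le_trans t0)// ltW.
exists q; split => //.
rewrite [ltRHS]splitr -(subrK (var g t) (var g _)) -addrA.
apply: le_lt_trans (ler_normD _ _) _; apply: ler_ltD => //.
by apply: le_trans (var_norm_lip _ _ _) _ => //; rewrite ger0_norm; lra.
Qed.

Lemma tlen_open s (c : R) : open [set g : curve R d | c < tlen g s].
Proof.
have -> : [set g : curve R d | c < tlen g s] =
    \bigcup_(k in [set: nat]) [set g : curve R d | c < s /\ c < var g k%:R].
  apply/seteqP; split => [g /= cg|g [k _ /= [cs cg]]].
    have [_ [k _ <-] ck] := sup_gt (tlen_has_sup g s).1 cg.
    by exists k => //=; move: ck; rewrite lt_min => /andP.
  by apply: lt_le_trans (tlen_ge g s (ler0n _ k)); rewrite lt_min cs cg.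
apply: bigcup_open => k _.
have [cs|sc] := ltP c s; last first.
  by rewrite (_ : mkset _ = set0); [exact: open0|apply/seteqP; split => g // [] ].
rewrite (_ : mkset _ = [set g : curve R d | c < var g k%:R]); first exact: var_open.
by apply/seteqP; split => g //= [].
Qed.

Lemma measurable_var t : 0 <= t -> measurable_fun setT (fun g : Gamma R d => var (g : curve R d) t).
Proof.
move=> t0; apply: (measurability _ (RGenOInfty.measurableE R)) => //.
move=> _ [_ [x ->] <-]; rewrite setTI.
rewrite (_ : _ @^-1` _ = [set g : curve R d | x < var g t]); last first.
  by apply/seteqP; split => g /=; rewrite in_itv /= andbT.
by apply: Gamma_open_measurable; exact: var_open.
Qed.

Lemma measurable_tlen s : measurable_fun setT (fun g : Gamma R d => tlen (g : curve R d) s).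
Proof.
apply: (measurability _ (RGenOInfty.measurableE R)) => //.
move=> _ [_ [x ->] <-]; rewrite setTI.
rewrite (_ : _ @^-1` _ = [set g : curve R d | x < tlen g s]); last first.
  by apply/seteqP; split => g /=; rewrite in_itv /= andbT.
by apply: Gamma_open_measurable; exact: tlen_open.
Qed.

End truncated_length.

(** * Multiplicity, and lower bounds for weighted lengths *)

Section multiplicity.
Context {R : realType} {d : nat}.
Implicit Types (g : curve R d) (s t : R).

(** On the compact interval [[0, M]] a curve meets [x] as soon as it comes within every
    [1 / (j + 1)] of it. The set is thus a countable union over [M] of countable intersections over
    [j] of open sets. *)
Lemma measurable_hits (x : 'rV[R]_d) :
  measurable ([set g | curve_image g x] : set (Gamma R d)).
Proof.
have -> : ([set g | curve_image g x] : set (Gamma R d)) =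
    \bigcup_(M : nat) \bigcap_(j : nat)
      \bigcup_(t in [set t : R | 0 <= t <= M%:R]) [set g : curve R d | enorm (g t - x) <
        j.+1%:R^-1].
  apply/seteqP; split => [g [t /=]|g [M _ gM]].
    rewrite in_itv /= andbT => t0 gx; exists (Num.bound t) => // j _.
    exists t; first by rewrite /= t0 ltW// archi_boundP.
    by rewrite /= gx subrr enorm0 invr_gt0.
  have /choice[t tP] : forall j : nat, exists t : R, 0 <= t <= M%:R /\ enorm (g t - x) < j.+1%:R^-1.
    by move=> j; have [t /= ? ?] := gM j I; exists t.
  have [l tl _] : exists2 l, t n @[n --> hyper] --> l & `|l| <= M%:R.
    apply: hyper_bounded_cvg; apply: nearW => n.
    by have [/andP[? ?] _] := tP n; rewrite ger0_norm.
  have l0 : 0 <= l by apply: (cvgr_to_ge tl); apply: nearW => n; have [/andP[]] := tP n.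
  exists l; first by rewrite /= in_itv /= l0.
  apply/eqP; rewrite -subr_eq0; apply/eqP/enorm_eq0/eqP.
  rewrite eq_le enorm_ge0 andbT; apply/ler_addgt0Pr => e e0; rewrite add0r.
  have e2 : 0 < e / 2 by rewrite divr_gt0.
  have near1 : \forall n \near hyper, `|l - t n| < e / 2 by apply: cvgr_dist_lt.
  have near2 : \forall n \near hyper, n.+1%:R^-1 < e / 2.
    by apply: hyper_free; exact: (near_infty_natSinv_lt (PosNum e2)).
  have [n [h1 h2]] := hyper_both near1 near2.
  have [_ h3] := tP n.
  apply: le_trans (ler_enorm_trans _ (g (t n)) _) _; rewrite [leRHS]splitr.
  apply: lerD; last by rewrite ltW// (lt_trans h3).
  by apply: le_trans (curve_lip _ _ _) _; rewrite ltW.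
apply: bigcupT_measurable => M; apply: bigcapT_measurable => j.
apply: Gamma_open_measurable; apply: bigcup_open => t /= /andP[t0 _].
exact: curve_eval_open.
Qed.

Lemma multiplicity_le1 (eta : probability (Gamma R d) R) x : (multiplicity eta x <= 1)%E.
Proof. by apply: probability_le1; exact: measurable_hits. Qed.

Lemma multiplicity_ge0 (eta : probability (Gamma R d) R) x : (0 <= multiplicity eta x)%E.
Proof. exact: measure_ge0. Qed.

End multiplicity.

Section weighted_length.
Context {R : realType} {d : nat}.
Implicit Types (g : curve R d) (s t : R).
Local Notation leb := (@lebesgue_measure R).

(** A lower Riemann sum in the arc-length parameter. The time [tau k] has arc length [k h], so the
    speed integrates to at least [h] over each of the disjoint intervals []tau k, tau k.+1]]. Since
    [W] enters only through lower bounds on the cells, it may be any nonnegative function. *)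
Lemma weighted_length_ge (W : 'rV[R]_d -> \bar R) g (K : nat) (h T : R) (c : nat -> R) :
  (forall x, 0 <= W x)%E -> 0 < h -> (forall k, 0 <= c k) ->
  0 <= T -> K%:R * h <= var g T ->
  (forall k t, (k < K)%N -> 0 <= t -> k%:R * h <= var g t <= k.+1%:R * h ->
    ((c k)%:E <= W (g t))%E) ->
  ((\sum_(k < K) c k * h)%:E <= \int[leb]_(t in `[0%R, +oo[) (W (g t) * (speed g t)%:E))%E.
Proof.
move=> W0 h0 c0 T0 KT cW.
have /choice[tau tauP] : forall k, exists t, (k <= K)%N -> 0 <= t /\ var g t = k%:R * h.
  move=> k; have [kK|] := leqP k K; last by exists 0.
  have [||t [t0 _ vt]] := @var_IVT _ _ g T (k%:R * h) T0; last by exists t.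
  - by rewrite mulr_ge0// ltW.
  - by apply: le_trans KT; rewrite ler_wpM2r ?(ltW h0)// ler_nat.
have tau_lt k : (k < K)%N -> tau k < tau k.+1.
  move=> kK; have [t0 vt] := tauP _ (ltnW kK); have [t1 vt1] := tauP _ kK.
  rewrite ltNge; apply/negP => /(var_nd g t1); rewrite vt vt1.
  by rewrite ler_pM2r// ler_nat ltnn.
have [p [mp p0 pg]] := speed_minorant g.
have p0' t : 0 <= p t by have /andP[] := p0 t.
have vp := var_le_integral mp p0' pg.
pose I k := `]tau k, tau k.+1]%classic.
have mI k : measurable (I k : set (measurableTypeR R)) by exact: measurable_itv.
have mfk k : measurable_fun setT (fun t => (c k * p t * \1_(I k) t)%:E).
  apply/measurable_EFinP; apply: measurable_funM; first exact: measurable_funM.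
  by apply: measurable_indic; exact: mI.
have fk0 k t : (0 <= (c k * p t * \1_(I k) t)%:E)%E.
  by rewrite lee_fin; apply: mulr_ge0; [exact: mulr_ge0|rewrite indicE].
apply: (@le_trans _ _ (\int[leb]_(t in `[0%R, +oo[)
    (\sum_(k < K) (c k * p t * \1_(I k) t)%:E))%E).
  rewrite ge0_integral_sum//; last by move=> k; exact: measurable_funTS (mfk _).
  rewrite -sumEFin; apply: lee_sum => k _.
  have [t0 vt] := tauP _ (ltnW (ltn_ord k)); have [t1 vt1] := tauP _ (ltn_ord k).
  have tt : tau k <= tau k.+1 by rewrite ltW// tau_lt.
  apply: (@le_trans _ _ (\int[leb]_(t in I k) ((c k)%:E * (p t)%:E))%E).
    rewrite ge0_integralZl_EFin//; last 2 first.
    - by move=> t _; rewrite lee_fin.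
    - by apply/measurable_EFinP; exact: measurable_funTS.
    rewrite EFinM lee_wpmul2l ?lee_fin//.
    apply: le_trans (vp _ _ t0 tt).
    by rewrite vt vt1 lee_fin -mulrBl -natrB// subSnn mul1r.
  rewrite [leLHS]integral_mkcond [leRHS]integral_mkcond.
  apply: ge0_le_lower_integral => t _.
    by rewrite /patch; case: ifP => // _; rewrite -EFinM lee_fin mulr_ge0.
  rewrite /patch; case: ifPn => [tI|_]; last by case: ifP.
  have -> : t \in `[0%R, +oo[%classic.
    move/set_mem : tI; rewrite /I /= in_itv /= => /andP[tt' _].
    by rewrite inE /= in_itv /= andbT ltW// (le_lt_trans t0).
  by rewrite indicE tI mulr1.
apply: ge0_le_lower_integral => t /=; first by move=> _; apply: sume_ge0.
rewrite in_itv /= andbT => t0.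
have Wsp : (0 <= W (g t) * (speed g t)%:E)%E by rewrite mule_ge0// lee_fin speed_ge0.
have [[k kI]|nk] := pselect (exists k : 'I_K, t \in I k); last first.
  rewrite big1// => k _; rewrite indicE; case: (boolP (t \in I k)) => [tk|_].
    by exfalso; apply: nk; exists k.
  by rewrite mulr0.
rewrite (bigD1 k)//= big1 ?adde0; last first.
  move=> j jk; rewrite indicE; case: (boolP (t \in I j)) => [tj|_]; last by rewrite mulr0.
  have tau_le a b : (a <= b)%N -> (b <= K)%N -> tau a <= tau b.
    move=> /subnK <-; elim: (b - a)%N => [|n ih]; first by rewrite add0n.
    by rewrite addSn => nK; rewrite (le_trans (ih (ltnW nK)))// ltW// tau_lt.
  exfalso; move: jk tj kI; wlog jk : j k / (j < k)%N.
    move=> H; rewrite neq_ltn => /orP[jk|kj] tj tk.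
      by apply: (H j k) => //; rewrite neq_ltn jk.
    by apply: (H k j) => //; rewrite neq_ltn kj.
  move=> _ /set_mem + /set_mem; rewrite /I /= !in_itv /= => /andP[_ tj] /andP[tk _].
  have := tau_le _ _ jk (ltnW (ltn_ord k)); lra.
rewrite indicE kI mulr1 EFinM; apply: lee_pmul; rewrite ?lee_fin//.
  apply: cW; rewrite ?ltn_ord//.
  move/set_mem : kI; rewrite /I /= in_itv /= => /andP[tk1 tk2].
  have [t1 v1] := tauP _ (ltnW (ltn_ord k)); have [t2 v2] := tauP _ (ltn_ord k).
  by rewrite -v1 -v2 !var_nd// ltW.
by have /andP[] := p0 t.
Qed.

End weighted_length.

(** * Ultralimits of curves *)

Section hyper_limits.
Context {R : realType} {d : nat}.
Implicit Types (x y : nat -> 'rV[R]_d) (l : 'rV[R]_d) (r : nat -> R).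

Definition hconv x l := forall e : R, 0 < e -> \forall n \near hyper, enorm (x n - l) < e.

Definition hsmall r := forall e : R, 0 < e -> \forall n \near hyper, r n < e.

Lemma hsmall_inv : hsmall (fun n => n.+1%:R^-1).
Proof.
by move=> e e0; apply: hyper_free; exact: (near_infty_natSinv_lt (PosNum e0)).
Qed.

Lemma hsmallD r r' : hsmall r -> hsmall r' -> hsmall (fun n => r n + r' n).
Proof.
move=> hr hr' e e0; have e2 : 0 < e / 2 by rewrite divr_gt0.
near=> n; rewrite [ltRHS]splitr ltrD//; near: n; [exact: hr|exact: hr'].
Unshelve. all: by end_near. Qed.

Lemma hsmall_le r r' : hsmall r -> (\forall n \near hyper, r' n <= r n) -> hsmall r'.
Proof.
move=> hr rr' e e0; have h := hr e e0; near=> n.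
by apply: (@le_lt_trans _ _ (r n)); near: n.
Unshelve. all: by end_near. Qed.

Lemma cvg_hsmall r (c : R) : r n @[n --> hyper] --> c -> hsmall (fun n => `|r n - c|).
Proof.
move=> rc e e0; have : \forall n \near hyper, `|c - r n| < e by apply: cvgr_dist_lt.
by apply: filterS => n; rewrite distrC.
Qed.

Lemma hsmall_cvg r (c : R) : hsmall (fun n => `|r n - c|) -> r n @[n --> hyper] --> c.
Proof.
move=> rc; apply/cvgrPdist_lt => e e0; apply: filterS (rc e e0) => n.
by rewrite distrC.
Qed.

Lemma hconv_hsmall x l : hconv x l -> hsmall (fun n => enorm (x n - l)).
Proof. by []. Qed.

Lemma hconv_le x y l r : hconv x l -> hsmall r ->
  (\forall n \near hyper, enorm (y n - x n) <= r n) -> hconv y l.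
Proof.
move=> xl hr yx; have h := hsmallD hr (hconv_hsmall xl).
apply: (hsmall_le h); apply: filterS yx => n yxn.
by apply: le_trans (ler_enorm_trans _ (x n) _) _; rewrite lerD2r.
Qed.

Lemma hconv_enorm_le x y l l' r (c : R) : hconv x l -> hconv y l' -> hsmall r ->
  (\forall n \near hyper, enorm (x n - y n) <= c + r n) -> enorm (l - l') <= c.
Proof.
move=> xl yl' hr xy; apply/ler_addgt0Pr => e e0.
have h := hsmallD (hsmallD xl yl') hr.
have [n [h1 h2]] := hyper_both (h e e0) xy.
apply: le_trans (ler_enorm_trans _ (x n) _) _.
rewrite enormB; have := ler_enorm_trans (x n) (y n) l'; lra.
Qed.

Lemma hconv_unique x l l' : hconv x l -> hconv x l' -> l = l'.
Proof.
move=> xl xl'; apply/eqP; rewrite -subr_eq0; apply/eqP/enorm_eq0/eqP.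
rewrite eq_le enorm_ge0 andbT; apply: (hconv_enorm_le xl xl' hsmall_inv).
by apply: nearW => n; rewrite subrr enorm0 add0r invr_ge0.
Qed.

Lemma hconv_bounded x (M : R) : (\forall n \near hyper, enorm (x n) <= M) ->
  exists l, hconv x l.
Proof.
move=> xM; have /choice[l lP] : forall i : 'I_d, exists c : R, hsmall (fun n => `|x n ord0 i - c|).
  move=> i; have [|c xc _] := @hyper_bounded_cvg R (fun n => x n ord0 i) M.
    by apply: filterS xM => n; apply: le_trans; exact: coord_le_enorm.
  by exists c; exact: cvg_hsmall.
exists (\row_i l i) => e e0.
set e' := e / d.+1%:R; have e'0 : 0 < e' by rewrite divr_gt0.
have : \forall n \near hyper, forall i : 'I_d, `|x n ord0 i - l i| < e'.
  by apply: filter_forall => i; exact: lP.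
apply: filterS => n xn; apply: le_lt_trans (enorm_le_sum _) _.
apply: (@le_lt_trans _ _ (\sum_(i < d) e')).
  by apply: ler_sum => i _; rewrite !mxE ltW.
rewrite sumr_const card_ord -mulr_natl mulrCA gtr_pMr// ltr_pdivrMr// mul1r ltr_nat.
exact: ltnSn.
Qed.

End hyper_limits.

Section arc_limit.
Context {R : realType} {d : nat}.
Implicit Types (g : curve R d) (w : nat -> curve R d) (s t : R).

(* Rational times, so that evaluation at [time_at] is measurable in the curve. *)
Definition time_at g s (n : nat) : rat :=
  xget 0 [set q : rat | 0 <= ratr q :> R /\ `|var g (ratr q) - tlen g s| < n.+1%:R^-1].

Lemma time_atP g s n : 0 <= s ->
  0 <= ratr (time_at g s n) :> R /\
  `|var g (ratr (time_at g s n)) - tlen g s| < n.+1%:R^-1.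
Proof.
move=> s0; rewrite /time_at; case: xgetP => [q _ //|H].
have n0 : 0 < n.+1%:R^-1 :> R by [].
by have [q qP] := tlen_approx g n0 s0; case: (H q qP).
Qed.

(** Subtracting the starting point keeps these points in the ball of radius [s + 1] whatever the
    sequence [w], so the ultralimit exists for every [w] and [arc_lim] is a total function. *)
Definition arc_point w s (n : nat) : 'rV[R]_d :=
  w n (ratr (time_at (w n) s n)) - w n 0.

Definition arc_lim_fun w t : 'rV[R]_d :=
  xget 0 [set l | hconv (arc_point w (Num.max t 0)) l].

Lemma arc_point_le w s n : 0 <= s -> enorm (arc_point w s n) <= s + 1.
Proof.
move=> s0; have [t0 tP] := time_atP (w n) n s0.
apply: le_trans (var_dist _ (lexx 0) t0) _; rewrite var0 subr0.
rewrite ger0_norm ?var_ge0//.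
have := tlen_le (w n) s.
have : n.+1%:R^-1 <= 1 :> R by rewrite invf_le1// ler1n.
move: tP; rewrite ltr_norml => /andP[_].
move: (n.+1%:R^-1) (var _ _) (tlen _ _) => a b c; lra.
Qed.

Lemma arc_lim_fun_hconv w s : 0 <= s -> hconv (arc_point w s) (arc_lim_fun w s).
Proof.
move=> s0; rewrite /arc_lim_fun max_l//; case: xgetP => [l _ //|H].
have [l lP] : exists l, hconv (arc_point w s) l.
  by apply: (@hconv_bounded _ _ _ (s + 1)); apply: nearW => n; exact: arc_point_le.
by case: (H l lP).
Qed.

Lemma arc_lim_lipschitz w s t : 0 <= s -> 0 <= t ->
  enorm (arc_lim_fun w t - arc_lim_fun w s) <= `|t - s|.
Proof.
move=> s0 t0.
apply: (hconv_enorm_le (arc_lim_fun_hconv w t0) (arc_lim_fun_hconv w s0)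
  (hsmallD hsmall_inv hsmall_inv)).
apply: nearW => n; have [ht1 ht2] := time_atP (w n) n t0; have [hs1 hs2] := time_atP (w n) n s0.
rewrite /arc_point opprB addrA subrK.
apply: le_trans (var_dist _ hs1 ht1) _.
set vt := var _ _ in ht2 *; set vs := var _ (ratr (time_at (w n) s n)) in hs2 *.
have := tlen_lip (w n) t s.
have := ler_normD (vt - tlen (w n) t) (tlen (w n) t - tlen (w n) s).
have := ler_normD (vt - tlen (w n) s) (tlen (w n) s - vs).
rewrite [`|tlen _ _ - vs|]distrC !addrA !subrK.
by move: ht2 hs2; move: (n.+1%:R^-1) => a; lra.
Qed.

Lemma arc_lim_nonpos w t : t <= 0 -> arc_lim_fun w t = arc_lim_fun w 0.
Proof. by move=> t0; rewrite /arc_lim_fun (max_r t0) maxxx. Qed.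

(* The ultralimit of the arc-length reparametrizations of the curves [w n],
   translated so as to start at the origin. *)
Definition arc_lim w : curve R d := Curve (@arc_lim_lipschitz w) (@arc_lim_nonpos w).

(** The distance between two points of a curve is at most the difference of their arc lengths. Any
    times whose arc lengths are infinitely close to [tlen (w n) s] therefore compute the same limit
    as the rational ones. *)
Lemma arc_lim_hconv w (u : nat -> R) s : 0 <= s ->
  (\forall n \near hyper, 0 <= u n) ->
  hsmall (fun n => `|var (w n) (u n) - tlen (w n) s|) ->
  hconv (fun n => w n (u n) - w n 0) (arc_lim w s).
Proof.
move=> s0 u0 us; apply: hconv_le (arc_lim_fun_hconv w s0) (hsmallD us hsmall_inv) _.
apply: filterS u0 => n un0; have [h1 h2] := time_atP (w n) n s0.
rewrite /arc_point opprB addrA subrK.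
apply: le_trans (var_dist _ h1 un0) _.
set v := var _ (ratr _) in h2 *.
have := ler_normD (var (w n) (u n) - tlen (w n) s) (tlen (w n) s - v).
rewrite [`|tlen _ _ - v|]distrC addrA subrK.
by move: h2; move: (n.+1%:R^-1) => a; lra.
Qed.

Lemma arc_lim_hconv_var w (u : nat -> R) s : 0 <= s ->
  (\forall n \near hyper, 0 <= u n) ->
  var (w n) (u n) @[n --> hyper] --> s ->
  hconv (fun n => w n (u n) - w n 0) (arc_lim w s).
Proof.
move=> s0 u0 us; apply: arc_lim_hconv => //.
apply: hsmall_le (cvg_hsmall us) _; apply: filterS u0 => n un0.
by rewrite distrC [leRHS]distrC; exact: tlen_var.
Qed.

Lemma arc_lim0 w : arc_lim w 0 = 0.
Proof.
apply: (@hconv_unique _ _ (fun n => w n 0 - w n 0)).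
  apply: (@arc_lim_hconv_var w (fun=> 0)) => //.
    exact: nearW.
  by apply: cvg_near_cst; apply: nearW => n; rewrite var0.
by move=> e e0; apply: nearW => n; rewrite !subrr enorm0.
Qed.

Lemma eval2_open t (x : 'rV[R]_d) (e : R) : 0 <= t ->
  open [set h : curve R d | enorm (h t - h 0 - x) < e].
Proof.
move=> t0; rewrite openE => g /= gx.
have e0 : 0 < (e - enorm (g t - g 0 - x)) / 2 by rewrite divr_gt0// subr_gt0.
have H1 := curve_eval_near g t0 e0; have H2 := curve_eval_near g (lexx 0) e0.
apply: filterS2 H1 H2 => h /= h1 h2.
have -> : h t - h 0 - x = (h t - g t) + ((g 0 - h 0) + (g t - g 0 - x)).
  by apply/rowP => i; rewrite !mxE; ring.
have := ler_enormD (h t - g t) ((g 0 - h 0) + (g t - g 0 - x)).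
have := ler_enormD (g 0 - h 0) (g t - g 0 - x).
rewrite (enormB (g 0)); lra.
Qed.

(** The limit lies within [e] of [x] exactly when, for some [j] and almost all [n], a rational time
    of nearly the right arc length puts [w n] within [e - 1 / (j + 1)] of [x]. For each [j] this is
    an internal condition, with measurable components because the times range over a countable
    set. *)
Lemma measurable_arc_lim :
  measurable_fun setT (arc_lim : @loeb_sigma _ (Gamma R d) -> Gamma R d).
Proof.
apply: measurable_to_Gamma => t x e t0.
pose B (n : nat) (q : rat) (c : R) := [set g : curve R d |
  0 <= ratr q :> R /\ (`|var g (ratr q) - tlen g t| < n.+1%:R^-1 /\
  enorm (g (ratr q) - g 0 - x) < c)].
pose A (j n : nat) : set (Gamma R d) := \bigcup_(q : rat) B n q (e - j.+1%:R^-1).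
have mB n q c : measurable (B n q c : set (Gamma R d)).
  have [q0|q0] := leP 0 (ratr q : R); last first.
    rewrite (_ : B n q c = set0)//; apply/seteqP; split => // g [].
    by rewrite leNgt q0.
  rewrite (_ : B n q c = [set g : Gamma R d | `|var (g : curve R d) (ratr q) - tlen (g : curve
    R d) t| < n.+1%:R^-1] `&`
      [set g : curve R d | enorm (g (ratr q) - g 0 - x) < c]); last first.
    by apply/seteqP; split => [g [_ []]//|g [? ?]]; split.
  apply: measurableI; last by apply: Gamma_open_measurable; exact: eval2_open.
  have mf : measurable_fun setT (fun g : Gamma R d =>
      `|var (g : curve R d) (ratr q) - tlen (g : curve R d) t|).
    apply: measurableT_comp => //; apply: measurable_funB; first exact: measurable_var.
    exact: measurable_tlen.
  have := mf measurableT (`]-oo, n.+1%:R^-1[%classic) (measurable_itv _).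
  rewrite setTI; congr measurable; apply/seteqP; split => g /=; by rewrite in_itv.
have -> : [set w : @loeb_sigma _ (Gamma R d) | enorm ((arc_lim w : curve R d) t - x) < e] =
    \bigcup_j (internal (A j) : set (@loeb_sigma _ (Gamma R d))).
  apply/seteqP; split => [w /= wx|w [j _ wA] /=].
    have r0 : 0 < e - enorm (arc_lim w t - x) by rewrite subr_gt0.
    set r := e - _ in r0; have r2 : 0 < r / 2 by rewrite divr_gt0.
    have [j _ /(_ j (leqnn j)) jr] := near_infty_natSinv_lt (PosNum r2).
    exists j => //; have := arc_lim_fun_hconv w t0 r2; apply: filterS => n wn.
    have [h1 h2] := time_atP (w n) n t0.
    exists (time_at (w n) t n) => //; split => //; split => //.
    apply: le_lt_trans (ler_enorm_trans _ (arc_lim w t) _) _.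
    move: wn jr; rewrite /arc_point /r /=; move: (j.+1%:R^-1) => a; lra.
  have /choice[u uP] : forall n, exists q, A j n (w n) -> B n q (e - j.+1%:R^-1) (w n).
    move=> n; have [[q _ Bq]|nA] := pselect (A j n (w n)); first by exists q.
    by exists 0.
  have uB : \forall n \near hyper, B n (u n) (e - j.+1%:R^-1) (w n).
    by apply: filterS wA => n /uP.
  have hu : hconv (fun n => w n (ratr (u n)) - w n 0) (arc_lim w t).
    apply: arc_lim_hconv => //; first by apply: filterS uB => n [].
    by apply: hsmall_le hsmall_inv _; apply: filterS uB => n [_ [/ltW]].
  have j0 : 0 < j.+1%:R^-1 :> R by [].
  apply: (@le_lt_trans _ _ (e - j.+1%:R^-1)); last by rewrite ltrBlDr ltrDl.
  apply: (hconv_enorm_le hu (y := fun=> x) (r := fun n => n.+1%:R^-1)).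
  - by move=> e' e'0; apply: nearW => n; rewrite subrr enorm0.
  - exact: hsmall_inv.
  - apply: filterS uB => n [_ [_ /ltW h]]; apply: le_trans h _.
    by rewrite lerDl invr_ge0.
apply: bigcupT_measurable => j; apply: sub_sigma_algebra; exists (A j) => // n.
by apply: countable_bigcupT_measurable.
Qed.

End arc_limit.

(** * The weight and its semicontinuity along ultralimits *)

Section pow_infty.
Context {R : realType}.
Implicit Types (x : \bar R) (r c : R).

Lemma pow_infty_ge0 x r : (0 <= pow_infty x r)%E.
Proof. by rewrite /pow_infty; case: ifP => // _; exact: poweR_ge0. Qed.

(** A negative power is decreasing, so sublevel sets of the weight are superlevel sets of the
    multiplicity. Upper semicontinuity of the one becomes lower semicontinuity of the other. *)
Lemma pow_infty_le x r c : r < 0 -> (0 <= x <= 1)%E -> 0 < c ->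
  (pow_infty x r <= c%:E)%E = ((c `^ r^-1)%:E <= x)%E.
Proof.
move=> r0; case: x => [x| |] //; last by move=> /andP[].
rewrite !lee_fin => /andP[x0 x1] c0; rewrite /pow_infty.
case: eqVneq => [[->]|xn0].
  rewrite leye_eq /=; apply/esym/negbTE; rewrite -ltNge.
  exact: powR_gt0.
have xgt0 : 0 < x by rewrite lt0r x0 andbT; apply: contraNneq xn0 => ->.
rewrite poweR_EFin !lee_fin.
have rN : 0 < - r by rewrite oppr_gt0.
have -> : x `^ r = (x `^ (- r))^-1 by rewrite -powRN opprK.
have -> : c `^ r^-1 = (c `^ (- r)^-1)^-1 by rewrite invrN -powRN opprK.
set s := - r in rN *; set k := (c `^ s^-1)^-1.
have k0 : 0 < k by rewrite invr_gt0 powR_gt0.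
have ks : k `^ s = c^-1.
  by rewrite /k -powRN -powRrM mulNr mulVf ?gt_eqF// powR_inv1// ltW.
rewrite -[in LHS](invrK c) lef_pV2 ?posrE ?powR_gt0 ?invr_gt0// -ks.
have [kx|xk] := leP k x.
  by apply: (ge0_ler_powR (ltW rN)) => //; rewrite nnegrE ltW.
by apply/negbTE; rewrite -ltNge; apply: gt0_ltr_powR => //; rewrite nnegrE ltW.
Qed.

Lemma pow_infty_ge1 x r : r < 0 -> (0 <= x <= 1)%E -> (1 <= pow_infty x r)%E.
Proof.
move=> r0; case: x => [x| |] //; last by move=> /andP[].
rewrite !lee_fin => /andP[x0 x1]; rewrite /pow_infty.
case: eqVneq => [_|xn0]; first by rewrite leey.
have xgt0 : 0 < x by rewrite lt0r x0 andbT; apply: contraNneq xn0 => ->.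
rewrite poweR_EFin lee_fin.
have -> : x `^ r = (x `^ (- r))^-1 by rewrite -powRN opprK.
rewrite invf_ge1 ?powR_gt0//; have {1}<- : 1 `^ (- r) = 1 :> R by rewrite powR1.
by apply: ge0_ler_powR => //; rewrite ?nnegrE ?oppr_ge0 ltW.
Qed.

End pow_infty.

Section hyper_limit_plan.
Context {R : realType} {d : nat}.
Local Notation Gam := (Gamma R d).
Implicit Types (w : nat -> curve R d) (s t : R).
Variables (eta : nat -> probability Gam R) (etaL : probability Gam R).
Variable alpha : R.
Hypothesis alpha1 : alpha < 1.
Local Notation P := (loeb_measure eta).

Definition tame w := (\forall n \near hyper, w n 0 = 0) /\
  exists M : R, \forall n \near hyper, forall t, 0 <= t -> var (w n) t <= M.

Variable N : set (@loeb_sigma _ Gam).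
Hypothesis mN : measurable N.
Hypothesis PN0 : P N = 0%E.
Hypothesis tameN : forall w, ~ N w -> tame w.
Hypothesis etaLE : forall A, measurable A ->
  etaL A = P ((arc_lim : @loeb_sigma _ Gam -> Gam) @^-1` A).

(** The bound on the lengths makes the arc lengths at the hitting times converge to some finite [s],
    and the limit curve passes through [l] at [s]. *)
Lemma tame_hits w (x : nat -> 'rV[R]_d) l : tame w -> hconv x l ->
  (\forall n \near hyper, curve_image (w n) (x n)) -> curve_image (arc_lim w) l.
Proof.
move=> [w0 [M wM]] xl wx.
have /choice[u uP] : forall n, exists t, curve_image (w n) (x n) -> 0 <= t /\ w n t = x n.
  move=> n; have [[t /= t0 wt]|nx] := pselect (curve_image (w n) (x n)); last by exists 0.
  by exists t => _; split => //; move: t0; rewrite in_itv /= andbT.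
have u0 : \forall n \near hyper, 0 <= u n by apply: filterS wx => n /uP[].
have ux : \forall n \near hyper, w n (u n) = x n by apply: filterS wx => n /uP[].
have [s us _] : exists2 s, var (w n) (u n) @[n --> hyper] --> s & `|s| <= M.
  apply: hyper_bounded_cvg; apply: filterS2 u0 wM => n un0 wnM.
  by rewrite ger0_norm ?var_ge0// wnM.
have s0 : 0 <= s by apply: (cvgr_to_ge us); apply: filterS u0 => n; exact: var_ge0.
have h := arc_lim_hconv_var s0 u0 us.
suff -> : l = arc_lim w s by exists s => //=; rewrite in_itv /= s0.
apply: hconv_unique xl _; apply: hconv_le h hsmall_inv _.
apply: filterS2 ux w0 => n -> ->; rewrite subr0 subrr enorm0.
by rewrite invr_ge0.
Qed.

(** The sequences [w] such that [w n] meets [x n] for almost all [n] form an internal set, whose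
    Loeb measure is the ultralimit of the multiplicities. Outside the null set [N], the limit curve
    of such a sequence meets [l]. *)
Lemma multiplicity_usc (x : nat -> 'rV[R]_d) l (k : R) : hconv x l ->
  (\forall n \near hyper, (k%:E <= multiplicity (eta n) (x n))%E) ->
  (k%:E <= multiplicity etaL l)%E.
Proof.
move=> xl kx.
pose A n : set Gam := [set g | curve_image (g : curve R d) (x n)].
have mA n : measurable (A n) by exact: measurable_hits.
apply: (@le_trans _ _ (P (internal A))).
  rewrite loeb_measureE//.
  have := loeb_contentE mA => /(_ R eta) h.
  rewrite /loeb_content lee_fin; apply: (cvgr_to_ge h).
  by apply: filterS kx => n; rewrite -lee_fin fineK// fin_num_measure.
rewrite /multiplicity etaLE; last exact: measurable_hits.
set B := _ @^-1` _.
have mB : measurable (B : set (@loeb_sigma _ Gam)).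
  rewrite -[X in measurable X]setTI; apply: measurable_arc_lim => //.
  exact: measurable_hits.
apply: (@le_trans _ _ (P (B `|` N))).
  apply: le_measure; rewrite ?inE.
  - by apply: sub_sigma_algebra; exists A.
  - exact: measurableU.
  - move=> w wA; have [Nw|/tameN tw] := pselect (N w); first by right.
    by left; exact: (tame_hits tw xl).
by rewrite measureU0.
Qed.

Local Notation W := (fun x : 'rV[R]_d => pow_infty (multiplicity etaL x) (alpha - 1)).
Local Notation Wn := (fun n (x : 'rV[R]_d) => pow_infty (multiplicity (eta n) x) (alpha - 1)).

Lemma weight_lsc w (u : nat -> R) s (c : R) : tame w -> 0 <= s -> 0 < c ->
  (\forall n \near hyper, 0 <= u n) ->
  var (w n) (u n) @[n --> hyper] --> s ->
  (\forall n \near hyper, (Wn n (w n (u n)) <= c%:E)%E) -> (W (arc_lim w s) <= c%:E)%E.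
Proof.
move=> [w0 _] s0 c0 u0 us Wc.
have r0 : alpha - 1 < 0 by rewrite subr_lt0.
rewrite pow_infty_le ?multiplicity_le1 ?multiplicity_ge0//.
apply: (@multiplicity_usc (fun n => w n (u n))).
  apply: hconv_le (arc_lim_hconv_var s0 u0 us) hsmall_inv _.
  by apply: filterS w0 => n ->; rewrite subr0 subrr enorm0 invr_ge0.
apply: filterS Wc => n; rewrite pow_infty_le ?multiplicity_le1 ?multiplicity_ge0//.
Qed.

End hyper_limit_plan.

Section total_length.
Context {R : realType} {d : nat}.
Implicit Types (g : curve R d) (w : nat -> curve R d) (s t : R).

Lemma tlen_le_total g s (M : R) : (forall t, 0 <= t -> var g t <= M) -> tlen g s <= tlen g M.
Proof.
move=> gM; apply: tlen_le_bound => t t0; apply: le_trans (tlen_ge g M t0).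
by rewrite (min_r (gM t t0)) ge_min lexx orbT.
Qed.

Lemma tlen_min_total g s (M : R) : (forall t, 0 <= t -> var g t <= M) ->
  Num.min s (tlen g M) <= tlen g s.
Proof.
move=> gM; rewrite ge_min; case: leP => //= sl; apply: tlen_le_bound => t t0.
have := tlen_ge g s t0; rewrite ge_min => /orP[|h]; first by rewrite leNgt sl.
by rewrite ge_min h orbT.
Qed.

(** Here [l] is the ultralimit of the lengths, read off as [tlen (w n) M] for a common bound [M] of
    the lengths. The times [u n] exhaust the lengths up to [1 / (n + 1)]; the limit curve takes the
    limit of [w n (u n)] at every [s >= l], so it is constant from [l] on. *)
Lemma tame_length w : tame w -> exists l : R, [/\ 0 <= l,
  forall v, v < l -> \forall n \near hyper, exists T, 0 <= T /\ v <= var (w n) T &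
  exists u : nat -> R, [/\ forall n, 0 <= u n,
    \forall n \near hyper, forall t, 0 <= t -> var (w n) t <= var (w n) (u n) + n.+1%:R^-1 &
    forall s, l <= s -> hconv (fun n => w n (u n) - w n 0) (arc_lim w s)]].
Proof.
move=> [w0 [M' wM']]; pose M := Num.max M' 0.
have M0 : 0 <= M by rewrite le_max lexx orbT.
have wM : \forall n \near hyper, forall t, 0 <= t -> var (w n) t <= M.
  by apply: filterS wM' => n h t t0; rewrite le_max h.
have [l Ll _] : exists2 l, tlen (w n) M @[n --> hyper] --> l & `|l| <= M.
  apply: hyper_bounded_cvg; apply: nearW => n.
  by rewrite ger0_norm ?tlen_ge0 ?tlen_le.
have l0 : 0 <= l by apply: (cvgr_to_ge Ll); apply: nearW => n; exact: tlen_ge0.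
exists l; split => //.
  move=> v vl; have : \forall n \near hyper, v < tlen (w n) M by exact: (cvgr_gt l).
  apply: filterS => n vn; apply: contrapT => nT.
  suff : tlen (w n) M <= v by rewrite leNgt vn.
  apply: tlen_le_bound => t t0; rewrite ge_min; apply/orP; right.
  by rewrite leNgt; apply/negP => /ltW vt; apply: nT; exists t.
pose u n : R := ratr (time_at (w n) M n).
have uP n := time_atP (w n) n M0.
exists u; split; first by move=> n; have [] := uP n.
  apply: filterS wM => n wnM t t0.
  have h1 : var (w n) t <= tlen (w n) M.
    by apply: le_trans (tlen_ge _ _ t0); rewrite min_r ?wnM.
  have [_] := uP n; rewrite distrC ltr_norml => /andP[_]; rewrite /u.
  by move: (n.+1%:R^-1) => e; lra.
move=> s ls; apply: arc_lim_hconv; first exact: le_trans ls.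
  by apply: nearW => n; have [] := uP n.
apply: hsmall_le (hsmallD hsmall_inv (cvg_hsmall Ll)) _.
apply: filterS wM => n wnM.
have [_ h] := uP n.
have h1 : `|tlen (w n) M - tlen (w n) s| <= `|tlen (w n) M - l|.
  have h2 := tlen_le_total s wnM; have h3 := tlen_min_total s wnM.
  rewrite ger0_norm ?subr_ge0//; move: h3; case: (leP s (tlen (w n) M)) => h4 h3.
    by apply: (le_trans _ (ler_norm _)); lra.
  by apply: (le_trans _ (normr_ge0 _)); lra.
have := ler_normD (var (w n) (u n) - tlen (w n) M) (tlen (w n) M - tlen (w n) s).
rewrite addrA subrK; move: h; rewrite /u; move: (n.+1%:R^-1) => e; lra.
Qed.

(** Difference quotients from the right vanish. This also settles [t = l], where the derivative, if
    there is one, agrees with the one from the right. *)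
Lemma speed_cst_right g (l : R) : (forall s, l <= s -> g s = g l) ->
  forall t, l <= t -> speed g t = 0.
Proof.
move=> gl t lt_; rewrite /speed.
have [dg|ndg] := pselect (derivable g t 1); last by rewrite ndrv_derive1// enorm0.
have hft : h^-1 *: (g (h + t) - g t) @[h --> 0^'] --> derive1 g t.
  have E : (fun h : R => h^-1 *: (g (h *: (1 : R) + t) - g t)) =
           (fun h => h^-1 *: (g (h + t) - g t)).
    by apply/funext => h; have -> : h *: (1 : R) = h by rewrite [LHS]mulr1.
  by rewrite derive1E /derive -E; move: dg => /cvg_ex[v hv]; rewrite (cvg_lim _ hv).
have h0 : n.+1%:R^-1 @[n --> \oo] --> (0:R)^'.
  move=> A A0; change (\forall n \near \oo, A (n.+1%:R^-1)).
  have H : \forall n \near \oo, @harmonic R n != 0 -> A (harmonic n).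
    exact: (cvg_harmonic A0).
  by apply: filterS H => n; apply; rewrite invr_eq0 pnatr_eq0.
have H1 := cvg_comp _ _ h0 hft.
have H2 : (fun n : nat => n.+1%:R^-1^-1 *: (g (n.+1%:R^-1 + t) - g t)) @ \oo --> (0 : 'rV[R]_d).
  apply: cvg_near_cst; apply: nearW => n.
  rewrite (gl (_ + t)) ?(gl t)// ?subrr ?scaler0//.
  by rewrite (le_trans lt_)// lerDr invr_ge0.
by rewrite (cvg_unique _ H1 H2)// enorm0.
Qed.

End total_length.

(** * Lower semicontinuity of the cost *)

Section dyadic_sums.
Context {R : realType}.
Local Notation leb := (@lebesgue_measure R).
Implicit Types (s l c : R).

Definition mesh (m : nat) : R := (2 ^+ m)^-1.

Lemma mesh_gt0 m : 0 < mesh m.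
Proof. by rewrite invr_gt0 exprn_gt0. Qed.

Definition dyadic_index (m : nat) (s : R) : nat := Num.truncn (s * 2 ^+ m).

Lemma dyadic_indexP m s : 0 <= s ->
  (dyadic_index m s)%:R * mesh m <= s < (dyadic_index m s).+1%:R * mesh m.
Proof.
move=> s0; have p2 : 0 < 2 ^+ m :> R by rewrite exprn_gt0.
rewrite /mesh ler_pdivrMr// ltr_pdivlMr//.
by apply: truncn_itv; rewrite mulr_ge0// ltW.
Qed.

Lemma dyadic_index_eq m s k : 0 <= s ->
  (dyadic_index m s == k) = (k%:R * mesh m <= s < k.+1%:R * mesh m).
Proof.
move=> s0; have p2 : 0 < 2 ^+ m :> R by rewrite exprn_gt0.
rewrite /mesh ler_pdivrMr// ltr_pdivlMr// /dyadic_index truncn_eq//.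
by rewrite mulr_ge0// ltW.
Qed.

Lemma mesh_half m : mesh m.+1 = mesh m / 2.
Proof. by rewrite /mesh exprS invfM mulrC. Qed.

Lemma mesh_le_inv m : mesh m <= m.+1%:R^-1.
Proof.
rewrite lef_pV2 ?posrE ?exprn_gt0// -natrX ler_nat.
exact: ltn_expl.
Qed.

Lemma half_cell m j : (j./2)%:R * mesh m <= j%:R * mesh m.+1 /\
  j.+1%:R * mesh m.+1 <= (j./2).+1%:R * mesh m.
Proof.
have hm := mesh_gt0 m.
have E : j%:R = (odd j)%:R + 2 * (j./2)%:R :> R.
  by rewrite -{1}(odd_double_half j) natrD -mul2n natrM.
have ob : (odd j)%:R <= 1 :> R by case: odd.
have ob0 : 0 <= (odd j)%:R :> R by [].
rewrite mesh_half -![in j.+1%:R]natr1 -[in (j./2).+1%:R]natr1 E.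
by split; nra.
Qed.

Lemma dyadic_index_half m s : 0 <= s -> dyadic_index m s = (dyadic_index m.+1 s)./2.
Proof.
move=> s0; apply/eqP; rewrite dyadic_index_eq//.
have /andP[h1 h2] := dyadic_indexP m.+1 s0.
have [h3 h4] := half_cell m (dyadic_index m.+1 s).
by rewrite (le_trans h3 h1) (lt_le_trans h2 h4).
Qed.

(** The step functions with value [gam m k] on the [k]-th cell of size [mesh m] increase with [m],
    so monotone convergence bounds the integral of their limit by [c]. The hypothesis on [G] places
    [G], measurable or not, below that limit. *)
Lemma lower_integral_dyadic (gam : nat -> nat -> R) l c (G : R -> \bar R) :
  (forall m k, 0 <= gam m k) -> (forall m j, gam m j./2 <= gam m.+1 j) ->
  (forall m k, l <= k.+1%:R * mesh m -> gam m k = 0) ->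
  (forall m K, \sum_(k < K) gam m k * mesh m <= c) ->
  (forall s, 0 <= s -> (0 <= G s)%E) ->
  (forall s (a : R), 0 <= s -> 0 < a -> (a%:E < G s)%E ->
    exists m, a <= gam m (dyadic_index m s)) ->
  (\int[leb]_(s in `[0%R, +oo[) G s <= c%:E)%E.
Proof.
move=> gam0 gam_nd gaml gamc G0 Ggam.
(* Enough cells to cover [[0, |l|]]; further on [gam m] vanishes. *)
pose K m := (Num.truncn (`|l| * 2 ^+ m)).+1.
pose I m k : set (measurableTypeR R) := `[k%:R * mesh m, k.+1%:R * mesh m[%classic.
have mI m k : measurable (I m k) by exact: measurable_itv.
pose F m s : R := \sum_(k < K m) gam m k * \1_(I m k) s.
have mF m : measurable_fun setT (F m).
  by apply: measurable_sum => k; apply: measurable_funM => //; apply: measurable_indic; exact: mI.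
have F0 m s : 0 <= F m s by apply: sumr_ge0 => k _; apply: mulr_ge0; [exact: gam0|rewrite indicE].
have FE m s : 0 <= s -> F m s = gam m (dyadic_index m s).
  move=> s0; have [iK|iK] := ltnP (dyadic_index m s) (K m).
    rewrite /F (bigD1 (Ordinal iK))//= big1 ?addr0; last first.
      move=> j jk; rewrite indicE; case: (boolP (s \in I m j)) => [|_]; last by rewrite mulr0.
      rewrite inE /I /= in_itv /= -dyadic_index_eq// => /eqP ij.
      by move: jk; rewrite -val_eqE /= -ij eqxx.
    rewrite indicE mem_set ?mulr1// /I /= in_itv /=; exact: dyadic_indexP.
  rewrite gaml; last first.
    apply: le_trans (ler_norm l) _.
    rewrite /mesh ler_pdivlMr ?exprn_gt0//.
    have /andP[_ /ltW h] : (Num.truncn (`|l| * 2 ^+ m))%:R <= `|l| * 2 ^+ m < (K m)%:R.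
      by apply: truncn_itv; rewrite mulr_ge0// exprn_ge0.
    by apply: le_trans h _; rewrite ler_nat (leq_trans iK).
  apply: big1 => j _; rewrite indicE; case: (boolP (s \in I m j)) => [|_]; last by rewrite mulr0.
  rewrite inE /I /= in_itv /= -dyadic_index_eq// => /eqP ij.
  by move: iK; rewrite ij leqNgt ltn_ord.
have Fneg m s : s < 0 -> F m s = 0.
  move=> s0; apply: big1 => j _; rewrite indicE; case: (boolP (s \in I m j)) => [|_];
    last by rewrite mulr0.
  rewrite inE /I /= in_itv /= => /andP[h _]; exfalso.
  have : 0 <= j%:R * mesh m by rewrite mulr_ge0// ltW// mesh_gt0.
  by move=> /le_trans/(_ h); rewrite leNgt s0.
have Fnd s : nondecreasing_seq (fun m => (F m s)%:E).
  apply/nondecreasing_seqP => m; rewrite lee_fin.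
  have [s0|s0] := leP 0 s; last by rewrite !Fneg.
  by rewrite !FE// dyadic_index_half.
have intF m : (\int[leb]_s (F m s)%:E <= c%:E)%E.
  rewrite /F integral_sum_indic//.
  apply: le_trans (_ : (\sum_(k < K m) gam m k * mesh m)%:E <= _)%E; last by rewrite lee_fin.
  rewrite -sumEFin; apply: lee_sum => k _.
  rewrite EFinM lee_wpmul2l ?lee_fin//.
  have hm := mesh_gt0 m.
  rewrite [leLHS]lebesgue_measure_itv/= lte_fin; case: ifP => _; last by rewrite lee_fin ltW.
  by rewrite -EFinB -mulrBl -natrB// subSnn mul1r.
have := monotone_convergence leb measurableT (fun m => (measurable_EFinP _ _).2 (mF m))
  (fun m x _ => F0 m x) (fun x _ => Fnd x).
move=> MCT.
apply: (@le_trans _ _ (\int[leb]_s (limn (fun m => (F m s)%:E)))%E).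
  rewrite [leLHS]integral_mkcond; apply: ge0_le_lower_integral => s _.
    rewrite /patch; case: ifP => // /set_mem /=; rewrite in_itv /= andbT; exact: G0.
  have cF := ereal_nondecreasing_is_cvgn (Fnd s).
  have L0 : (0 <= limn (fun m => (F m s)%:E))%E.
    by apply: lime_ge => //; apply: nearW => m; rewrite lee_fin.
  rewrite /patch; case: ifP => // /set_mem /=; rewrite in_itv /= andbT => s0.
  rewrite leNgt; apply/negP => h.
  have [a [a1 a2]] : exists a : R, (limn (fun m => (F m s)%:E) < a%:E)%E /\ (a%:E < G s)%E.
    move: h L0; case: (limn _) => [r| |]//; case: (G s) => [x| |]//.
      rewrite lte_fin => rx _; exists ((r + x) / 2); rewrite !lte_fin.
      by have [? ?] := (midf_lt rx).
    by move=> _ _; exists (r + 1); rewrite lte_fin ltrDl ltry.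
  have a0 : 0 < a by rewrite -lte_fin; exact: le_lt_trans L0 a1.
  have [m am] := Ggam s a s0 a0 a2.
  have : ((F m s)%:E <= limn (fun m => (F m s)%:E))%E.
    have /cvg_lim -> // := ereal_nondecreasing_cvgn (Fnd s).
    by apply: ereal_sup_ubound; exists m.
  by move=> /le_lt_trans/(_ a1); rewrite lte_fin FE// ltNge am.
rewrite [leLHS]MCT.
apply: lime_le; last exact: nearW.
apply: ereal_nondecreasing_is_cvgn => m n mn; apply: ge0_le_lower_integral => s _.
  by rewrite lee_fin.
exact: Fnd.
Qed.

End dyadic_sums.

Section cost_lsc.
Context {R : realType} {d : nat}.
Local Notation Gam := (Gamma R d).
Implicit Types (w : nat -> curve R d) (s t : R).

(** Multiplicities are at most [1], so the weight is at least [1]. A single cell of size [var g t]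
    is used, which is why zero variation is treated apart. *)
Lemma Z_eta_ge_var (eta : probability Gam R) (alpha : R) (g : curve R d) t :
  alpha < 1 -> 0 <= t -> ((var g t)%:E <= Z_eta alpha eta g)%E.
Proof.
move=> alpha1 t0; have r0 : alpha - 1 < 0 by rewrite subr_lt0.
have := var_ge0 g t0; rewrite le_eqVlt => /predU1P[<-|v0].
  apply: integral_ge0 => u _.
  by rewrite mule_ge0 ?pow_infty_ge0// lee_fin speed_ge0.
have := @weighted_length_ge _ _ (fun x => pow_infty (multiplicity eta x) (alpha - 1)) g
  1 (var g t) t (fun=> 1).
rewrite big_ord1 ?mul1r; apply => //.
- by move=> x; exact: pow_infty_ge0.
- move=> _ u _ _ _; apply: pow_infty_ge1 => //.
  by rewrite multiplicity_ge0 multiplicity_le1.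
Qed.

Variables (eta : nat -> probability Gam R) (etaL : probability Gam R).
Variable alpha : R.
Hypothesis alpha1 : alpha < 1.
Variable N : set (@loeb_sigma _ Gam).
Hypothesis mN : measurable N.
Hypothesis PN0 : loeb_measure eta N = 0%E.
Hypothesis tameN : forall w, ~ N w -> tame w.
Hypothesis etaLE : forall A, measurable A ->
  etaL A = loeb_measure eta ((arc_lim : @loeb_sigma _ Gam -> Gam) @^-1` A).
Local Notation W := (fun x : 'rV[R]_d => pow_infty (multiplicity etaL x) (alpha - 1)).
Local Notation Wn := (fun n (x : 'rV[R]_d) => pow_infty (multiplicity (eta n) x) (alpha - 1)).

Let cell_bound w m k (a : R) := \forall n \near hyper, forall t, 0 <= t ->
  k%:R * @mesh R m <= var (w n) t <= k.+1%:R * @mesh R m -> (a%:E <= Wn n (w n t))%E.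

(** Both costs are compared in the arc-length parameter of the [w n]. There the limit curve has
    speed at most [1] and stops at [l], while the cost of [w n] dominates every lower sum over
    dyadic cells. These sums pass to the ultralimit, and refining the cells recovers the weight
    along the limit curve. *)
Lemma Z_eta_lsc w (c : R) : tame w ->
  (\forall n \near hyper, (Z_eta alpha (eta n) (w n) <= c%:E)%E) ->
  (Z_eta alpha etaL (arc_lim w) <= c%:E)%E.
Proof.
move=> tw Zc; have [l [l0 wl [u [u0 _ ul]]]] := tame_length tw.
have Wn0 n x : (0 <= Wn n x)%E by exact: pow_infty_ge0.
(* [gam m k] is the best lower bound, capped at [m], of the weight on the k-th
   dyadic cell of arc length. *)
pose S m k := [set a : R | 0 <= a <= m%:R /\ cell_bound w m k a].
have S0 m k : S m k 0.
  by split; [rewrite lexx ler0n|apply: nearW => n t _ _; exact: Wn0].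
have supS m k : has_sup (S m k).
  by split; [exists 0|exists m%:R => a [/andP[]]].
pose gam m k : R := if k.+1%:R * @mesh R m < l then sup (S m k) else 0.
have gam0 m k : 0 <= gam m k.
  rewrite /gam; case: ifP => // _; apply: (ub_le_sup (supS m k).2); exact: S0.
have Sdown m k a b : 0 <= b -> b <= a -> S m k a -> S m k b.
  move=> b0 ba [/andP[a0 am] aP]; split; first by rewrite b0 (le_trans ba).
  by apply: filterS aP => n h t t0 ht; apply: le_trans (h t t0 ht); rewrite lee_fin.
have gl s' : l <= s' -> arc_lim w s' = arc_lim w l.
  by move=> ls'; exact: hconv_unique (ul _ ls') (ul _ (lexx l)).
apply: (@le_trans _ _ (\int[@lebesgue_measure R]_(s in `[0%R, +oo[)
    (W (arc_lim w s) * (s < l)%R%:R%:E))%E).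
  apply: ge0_le_lower_integral => s /=; rewrite in_itv /= andbT => s0.
    by rewrite mule_ge0 ?pow_infty_ge0// lee_fin speed_ge0.
  apply: lee_wpmul2l; first exact: pow_infty_ge0.
  rewrite lee_fin; case: ltP => sl /=; first exact: speed_le1.
  by rewrite (speed_cst_right gl sl).
apply: (@lower_integral_dyadic _ gam l) => //.
- move=> m j; have [h1 h2] := @half_cell R m j.
  rewrite {2}/gam; case: ifPn => [h3|]; last first.
    rewrite -leNgt => h3; rewrite /gam ltNge (le_trans h3 h2)//.
  rewrite /gam; case: ifP => [_|]; last by move=> _; apply: (ub_le_sup (supS _ _).2); exact: S0.
  apply: ge_sup; first exact: (supS _ _).1.
  move=> a [/andP[a0 am] aP]; apply: (ub_le_sup (supS _ _).2); split.
    by rewrite a0 (le_trans am)// ler_nat.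
  apply: filterS aP => n h t t0 /andP[t1 t2]; apply: h => //.
  by rewrite (le_trans h1 t1) (le_trans t2 h2).
- by move=> m k lk; rewrite /gam ltNge lk.
- move=> m K; have hm := @mesh_gt0 R m.
  elim: K => [|K ih].
    rewrite big_ord0; have [n /= hn] := filter_ex Zc.
    rewrite -lee_fin; apply: le_trans hn; apply: integral_ge0 => t _.
    by rewrite mule_ge0 ?pow_infty_ge0// lee_fin speed_ge0.
  have [lK|Kl] := leP l (K.+1%:R * @mesh R m).
    by rewrite big_ord_recr /= [in X in _ + X]/gam ltNge lK mul0r addr0.
  apply/ler_addgt0Pr => e e0.
  have KM0 : 0 < K.+1%:R * @mesh R m by rewrite mulr_gt0.
  (* A cell bound need not hold at the supremum itself, so each is lowered by [e']; over a total
     size of [K.+1%:R * mesh m] this loses exactly [e]. *)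
  pose e' := e / (K.+1%:R * @mesh R m); have e'0 : 0 < e' by rewrite divr_gt0.
  pose a k := Num.max (gam m k - e') 0.
  have a0 k : 0 <= a k by rewrite le_max lexx orbT.
  have aS k : (k < K.+1)%N -> S m k (a k).
    move=> kK; rewrite /a; case: leP => // g0; rewrite /gam ifT in g0 *; last first.
      by apply: le_lt_trans Kl; rewrite ler_wpM2r ?(ltW hm)// ler_nat.
    have [b Sb bg] := sup_adherent e'0 (supS m k).
    by apply: Sdown Sb; exact: ltW.
  have na : \forall n \near hyper, forall k : 'I_K.+1, forall t, 0 <= t ->
      k%:R * @mesh R m <= var (w n) t <= k.+1%:R * @mesh R m -> ((a k)%:E <= Wn n (w n t))%E.
    by apply: filter_forall => k; have [_] := aS k (ltn_ord k).
  have [n [[T [T0 KT]] [nan Zn]]] : exists n, (exists T, 0 <= T /\ K.+1%:R * @mesh R m <= var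
    (w n) T) /\
     ((forall k : 'I_K.+1, forall t, 0 <= t ->
      k%:R * @mesh R m <= var (w n) t <= k.+1%:R * @mesh R m -> ((a k)%:E <= Wn n (w n t))%E) /\
      (Z_eta alpha (eta n) (w n) <= c%:E)%E).
    by apply: hyper_both; [exact: wl|apply: filterS2 na Zc].
  have := @weighted_length_ge _ _ (Wn n) (w n) K.+1 (@mesh R m) T a (Wn0 n) hm a0 T0 KT.
  move=> /(_ (fun k t kK => nan (Ordinal kK) t)) /le_trans/(_ Zn).
  rewrite lee_fin => ac.
  apply: le_trans (_ : \sum_(k < K.+1) (a k + e') * @mesh R m <= _).
    apply: ler_sum => k _; rewrite ler_wpM2r ?(ltW hm)//.
    by rewrite -lerBlDr le_max lexx.
  under eq_bigr do rewrite mulrDl.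
  rewrite big_split /=; apply: lerD => //.
  rewrite sumr_const card_ord -mulr_natl /e' mulrCA mulfVK ?gt_eqF// .
- by move=> s s0; rewrite mule_ge0 ?pow_infty_ge0// lee_fin.
- move=> s a s0 a0.
  case: (ltP s l) => sl; rewrite ?mule0 ?mule1 => aW; last first.
    by move: aW; rewrite lte_fin ltNge ltW.
  apply: contrapT => /forallNP H.
  have succE m k : k.+1%:R * @mesh R m = k%:R * mesh m + mesh m.
    by rewrite -natr1 mulrDl mul1r.
  have ls0 : 0 < l - s by rewrite subr_gt0.
  have [m1 _ hm1] := near_infty_natSinv_lt (PosNum ls0).
  (* From [m0] on, the cap [m] is at least [a] and the cell containing [s] ends before [l]. *)
  pose m0 := maxn m1 (Num.bound a).
  have hm0 m : (m0 <= m)%N -> a <= m%:R /\ (dyadic_index m s).+1%:R * @mesh R m < l.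
    rewrite geq_max => /andP[mm1 mm2]; split.
      by apply: le_trans (ltW (archi_boundP (ltW a0))) _; rewrite ler_nat.
    have /andP[h1 _] := dyadic_indexP m s0.
    have := hm1 m mm1; have := @mesh_le_inv R m; rewrite /= succE.
    move: (m.+1%:R^-1) => b; lra.
  (* If no cell around [s] has the lower bound [a], each one contains, for almost all [n], a time of
     weight below [a]. The cells are nested, so saturation yields one sequence of times, of arc
     lengths tending to [s], that contradicts [weight_lsc]. *)
  pose Q m n t := [/\ 0 <= t, (dyadic_index (m0 + m) s)%:R * @mesh R (m0 + m) <= var (w n) t,
    var (w n) t <= (dyadic_index (m0 + m) s).+1%:R * @mesh R (m0 + m) &
    (Wn n (w n t) < a%:E)%E].
  have [||v vQ] := @hyper_saturation R Q 0.
  - move=> m n t [t0 t1 t2 t3]; split => //.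
      rewrite addnS in t1; rewrite dyadic_index_half//.
      by have [h _] := @half_cell R (m0 + m) (dyadic_index (m0 + m).+1 s); rewrite (le_trans h).
    rewrite addnS in t2; rewrite dyadic_index_half//.
    by have [_ h] := @half_cell R (m0 + m) (dyadic_index (m0 + m).+1 s); rewrite (le_trans t2).
  - move=> m; have [am il] := hm0 (m0 + m)%N (leq_addr _ _).
    have : ~ cell_bound w (m0 + m) (dyadic_index (m0 + m) s) a.
      move=> cb; apply: (H (m0 + m)%N); rewrite /gam il.
      by apply: (ub_le_sup (supS _ _).2); split => //; rewrite (ltW a0).
    move=> /hyperN; apply: filterS => n /existsNP[t] /not_implyP[t0] /not_implyP[/andP[t1 t2]].
    by move=> /negP; rewrite -ltNge => t3; exists t.
  have v0 : \forall n \near hyper, 0 <= v n by apply: filterS (vQ 0%N) => n [].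
  have vs : var (w n) (v n) @[n --> hyper] --> s.
    apply: hsmall_cvg => e e0.
    have [m _ hm] := near_infty_natSinv_lt (PosNum e0).
    apply: filterS (vQ m) => n [_ t1 t2 _].
    have /andP[s1 s2] := dyadic_indexP (m0 + m) s0.
    have h1 := @mesh_le_inv R (m0 + m); have /= h2 := hm (m0 + m)%N (leq_addl _ _).
    move: s2 t2; rewrite succE ltr_norml.
    move: ((m0 + m).+1%:R^-1) h1 h2 => b h1 h2 s2 t2; apply/andP; split; lra.
  have := weight_lsc alpha1 mN PN0 tameN etaLE tw s0 a0 v0 vs.
  rewrite leNgt aW => /(_ _)/negP; apply => //.
  by apply: filterS (vQ 0%N) => n [_ _ _ /ltW].
Qed.

End cost_lsc.

(** * Endpoints *)

Section curve_end.
Context {R : realType} {d : nat}.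
Implicit Types (g : curve R d) (w : nat -> curve R d) (s t : R).

Lemma curve_eval_preimage_open t (O : set 'rV[R]_d) : 0 <= t -> open O ->
  open [set g : curve R d | O (g t)].
Proof.
move=> t0 oO; rewrite openE => g /= Og.
have : nbhs (g t) O by exact: open_nbhs_nbhs.
move=> /nbhs_ballP[e /= e0 eO].
apply: filterS (curve_eval_near g t0 e0) => h /= he; apply: eO.
rewrite -ball_normE /= distrC; apply: le_lt_trans he; exact: mx_norm_le_enorm.
Qed.

Lemma measurable_to_Rd d' (T : measurableType d') (f : T -> Rd R d) :
  (forall (x : 'rV[R]_d) e, 0 < e -> measurable [set w | ball x e (f w : 'rV[R]_d)]) ->
  measurable_fun setT f.
Proof.
move=> mf.
have E : @measurable _ (Rd R d) = <<s @open 'rV[R]_d >> by [].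
apply: (measurability _ E) => _ [U oU <-]; rewrite setTI.
rewrite (rball_cover oU) preimage_bigcup bigcup_mkcond.
apply: countable_bigcupT_measurable => // c; case: ifP => // _.
exact: mf.
Qed.

(** The Cauchy condition at infinity, written so as to be visibly Borel: the unions under the
    complement are unions of open sets. *)
Definition cauchy_curves : set (curve R d) := \bigcap_(j : nat) \bigcup_(M : nat)
  ~` \bigcup_(st in [set st : R * R | M%:R <= st.1 <= st.2])
     [set g : curve R d | j.+1%:R^-1 < enorm (g st.2 - g st.1)].

Lemma measurable_cauchy_curves : measurable (cauchy_curves : set (Gamma R d)).
Proof.
apply: bigcapT_measurable => j; apply: bigcupT_measurable => M; apply: measurableC.
apply: Gamma_open_measurable; apply: bigcup_open => -[s t] /= /andP[Ms st].
have s0 : 0 <= s by exact: le_trans Ms.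
have p1 : path <=%R s [:: t] by rewrite /= st.
have := @poly_length_continuous R d s [:: t] j.+1%:R^-1 s0 p1.
by congr open; apply/seteqP; split => g /=; rewrite addr0.
Qed.

Lemma curve_cvg_norm g (e : 'rV[R]_d) : g t @[t --> +oo] --> e <->
  forall eps : R, 0 < eps -> exists2 M, 0 <= M & forall t, M <= t -> enorm (g t - e) <= eps.
Proof.
split => [ge eps eps0|H].
  have e0 : 0 < eps / d.+1%:R by rewrite divr_gt0.
  have : \forall t \near +oo, `|e - g t| < eps / d.+1%:R by exact: cvgr_dist_lt.
  move=> [M [_ MP]]; exists (Num.max (M + 1) 0); first by rewrite le_max lexx orbT.
  move=> t; rewrite ge_max => /andP[Mt _].
  apply: le_trans (enorm_le_mx_norm _) _.
  apply: (@le_trans _ _ (d.+1%:R * `|g t - e|)); first by rewrite ler_wpM2r// ler_nat.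
  rewrite mulrC -ler_pdivlMr// distrC ltW//; apply: MP.
  by apply: lt_le_trans Mt; rewrite ltrDl.
apply/cvgrPdist_le => eps eps0; have [M M0 MP] := H eps eps0.
exists M; split; first exact: num_real.
move=> t Mt; rewrite distrC; apply: le_trans (mx_norm_le_enorm _) _.
by apply: MP; exact: ltW.
Qed.

Lemma cauchy_curves_cvg g : cauchy_curves g <-> cvg (g t @[t --> +oo]).
Proof.
split => [gc|/cvg_ex[/= e /curve_cvg_norm ge] j _]; last first.
  have j0 : 0 < j.+1%:R^-1 / 2 :> R by rewrite divr_gt0.
  have [M M0 MP] := ge _ j0; exists (Num.bound M) => //.
  move=> [[s t] /= /andP[Ms st]]; apply/negP; rewrite -leNgt.
  have Ms' : M <= s by apply: le_trans Ms; rewrite ltW// archi_boundP.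
  apply: le_trans (ler_enorm_trans _ e _) _; rewrite [leRHS]splitr.
  by apply: lerD; rewrite 1?[enorm (e - _)]enormB; apply: MP => //; exact: le_trans st.
have gc' j : exists M : R, 0 <= M /\ forall s t, M <= s -> s <= t -> enorm (g t - g s) <=
  j.+1%:R^-1.
  have [M _ MP] := gc j I; exists M%:R; split => // s t Ms st.
  rewrite leNgt; apply/negP => h; apply: MP; exists (s, t) => //=.
  by rewrite Ms.
have [e ge] : exists e, hconv (fun n => g n%:R) e.
  have [M [M0 MP]] := gc' 0%N.
  apply: (@hconv_bounded _ _ _ (1 + enorm (g M))).
  have : \forall n \near hyper, M <= n%:R by apply: hyper_free; exact: nbhs_infty_ger.
  apply: filterS => n Mn; have := MP M n%:R (lexx _) Mn; rewrite invr1 => h.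
  by rewrite -(subrK (g M) (g n%:R)) (le_trans (ler_enormD _ _))// lerD2r.
apply/cvg_ex; exists e; apply/curve_cvg_norm => eps eps0.
have [j _ /(_ j (leqnn j)) /= jeps] := near_infty_natSinv_lt (PosNum eps0).
have [M [M0 MP]] := gc' j; exists M => // t Mt.
apply: le_trans (ltW jeps).
have gt0 : hconv (fun=> g t) (g t) by move=> e' e'0; apply: nearW => n; rewrite subrr enorm0.
apply: (hconv_enorm_le gt0 ge hsmall_inv).
have : \forall n \near hyper, t <= n%:R by apply: hyper_free; exact: nbhs_infty_ger.
apply: filterS => n tn; rewrite enormB; apply: le_trans (MP _ _ Mt tn) _.
by rewrite lerDl invr_ge0.
Qed.

(** Where the curve has no limit, [lim] returns the default [point]; the preimage of a ball is split
    accordingly. On the convergent part, lying in the open ball amounts to staying eventually in a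
    slightly smaller closed one. *)
Lemma measurable_curve_end : measurable_fun setT (@curve_end R d : Gamma R d -> Rd R d).
Proof.
apply: measurable_to_Rd => x e e0.
have -> : [set g : Gamma R d | ball x e (curve_end (g : curve R d) : 'rV[R]_d)] =
  (cauchy_curves `&` \bigcup_(j : nat) \bigcup_(M : nat)
    ~` \bigcup_(t in [set t : R | M%:R <= t])
       [set g : curve R d | e - j.+1%:R^-1 < `|x - g t|]) `|`
  (~` cauchy_curves `&` [set g | `|x - (point : 'rV[R]_d)| < e]).
  apply/seteqP; split => g; rewrite -ball_normE /=.
    move=> ge; have [gc|ngc] := pselect (cauchy_curves g); last first.
      right; split => //; move: ge; rewrite /curve_end dvgP//.
      by move=> /cauchy_curves_cvg.
    left; split => //; move/cauchy_curves_cvg : (gc) => /cvg_ex[v gv].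
    move: ge; rewrite /curve_end (cvg_lim _ gv)// => ge.
    have r0 : 0 < (e - `|x - v|) / 2 by rewrite divr_gt0// subr_gt0.
    have [j _ /(_ j (leqnn j)) /= jr] := near_infty_natSinv_lt (PosNum r0).
    have [M M0 MP] := (curve_cvg_norm _ _).1 gv _ r0.
    exists j => //; exists (Num.bound M) => // -[t /= Mt]; apply/negP; rewrite -leNgt.
    have {}MP := MP t (le_trans (ltW (archi_boundP M0)) Mt).
    have := ler_normD (x - v) (v - g t); rewrite addrA subrK.
    have := mx_norm_le_enorm (v - g t); rewrite enormB.
    move: (j.+1%:R^-1) jr => a jr; lra.
  move=> [[gc [j _ [M _ MP]]]|[ngc]]; last first.
    rewrite /curve_end dvgP//.
    by move=> /cauchy_curves_cvg.
  move/cauchy_curves_cvg : (gc) => /cvg_ex[v gv].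
  rewrite /curve_end (cvg_lim _ gv)//.
  have j0 : 0 < j.+1%:R^-1 / 2 :> R by rewrite divr_gt0.
  have [M' M'0 MP'] := (curve_cvg_norm _ _).1 gv _ j0.
  pose t := Num.max M' M%:R.
  have h1 : enorm (g t - v) <= j.+1%:R^-1 / 2 by apply: MP'; rewrite le_max lexx.
  have h2 : `|x - g t| <= e - j.+1%:R^-1.
    rewrite leNgt; apply/negP => h; case: MP; exists t => //=.
    by rewrite /t le_max lexx orbT.
  have := ler_normD (x - g t) (g t - v); rewrite addrA subrK.
  have := mx_norm_le_enorm (g t - v).
  move: j0 h1 h2; move: (j.+1%:R^-1) => a; lra.
apply: measurableU.
  apply: measurableI; first exact: measurable_cauchy_curves.
  apply: bigcupT_measurable => j; apply: bigcupT_measurable => M; apply: measurableC.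
  apply: Gamma_open_measurable; apply: bigcup_open => t /= Mt.
  have t0 : 0 <= t by exact: le_trans Mt.
  apply: (@curve_eval_preimage_open t [set y | e - j.+1%:R^-1 < `|x - y|]) => //.
  rewrite openE => y /= h; apply/nbhs_ballP; exists (`|x - y| - (e - j.+1%:R^-1)).
    by rewrite /= subr_gt0.
  move=> z; rewrite -ball_normE /= => yz.
  have := ler_normD (x - z) (z - y); rewrite addrA subrK (distrC z).
  by move: yz; move: (j.+1%:R^-1) => a; lra.
apply: measurableI; first by apply: measurableC; exact: measurable_cauchy_curves.
have [h|h] := pselect (`|x - (point : 'rV[R]_d)| < e).
  by rewrite (_ : mkset _ = setT)//; apply/seteqP; split.
by rewrite (_ : mkset _ = set0)//; apply/seteqP; split.
Qed.

Lemma curve_end_near g u e : 0 <= u -> (forall t, 0 <= t -> var g t <= var g u + e) ->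
  cvg (g t @[t --> +oo]) -> enorm ((curve_end g : 'rV[R]_d) - g u) <= e.
Proof.
move=> u0 gu /cvg_ex[v gv]; rewrite /curve_end (cvg_lim _ gv)//.
apply/ler_addgt0Pr => r r0.
have [M M0 MP] := (curve_cvg_norm _ _).1 gv _ r0.
pose t := Num.max M u; have ut : u <= t by rewrite le_max lexx orbT.
have h1 : enorm (g t - v) <= r by apply: MP; rewrite le_max lexx.
have h2 : enorm (g t - g u) <= e.
  have := var_enorm g u0 ut; have := gu t (le_trans u0 ut); lra.
apply: le_trans (ler_enorm_trans _ (g t) _) _; rewrite enormB addrC; exact: lerD.
Qed.

Lemma bounded_var_cvg g (M : R) : (forall t, 0 <= t -> var g t <= M) ->
  cvg (g t @[t --> +oo]).
Proof.
move=> gM; apply/cauchy_curves_cvg => j _.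
have M0 : 0 <= M by apply: le_trans (gM 0 (lexx _)); rewrite var0.
have j0 : 0 < j.+1%:R^-1 / 2 :> R by rewrite divr_gt0.
have [q [q0 qP]] := tlen_approx g j0 M0.
exists (Num.bound (ratr q : R)) => // -[[s t] /= /andP[qs st]]; apply/negP; rewrite -leNgt.
have qs' : ratr q <= s by apply: le_trans qs; rewrite ltW// archi_boundP.
have s0 : 0 <= s by exact: le_trans qs'.
have h1 := var_enorm g s0 st; have h2 := var_nd g q0 qs'.
have h3 : var g t <= tlen g M.
  by apply: le_trans (tlen_ge g M (le_trans s0 st)); rewrite min_r ?gM// (le_trans s0).
move: qP; rewrite ltr_norml => /andP[h4 _].
move: j0 h4; move: (j.+1%:R^-1) => a j0 h4; lra.
Qed.

(** The limit curve ends at its value at [l], which is the limit of [w n (u n)]; the end of [w n] is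
    within [1 / (n + 1)] of that point, because no more length is left after [u n]. *)
Lemma tame_curve_end w : tame w ->
  hconv (fun n => curve_end (w n) : 'rV[R]_d) (curve_end (arc_lim w)).
Proof.
move=> tw; have [l [l0 _ [u [u0 uv ul]]]] := tame_length tw.
have [w0 [M wM]] := tw.
have -> : (curve_end (arc_lim w) : 'rV[R]_d) = arc_lim w l.
  apply/cvg_lim => //; apply: cvg_near_cst.
  exists l; split; first exact: num_real.
  by move=> s /ltW ls; exact: hconv_unique (ul _ ls) (ul _ (lexx l)).
apply: hconv_le (ul _ (lexx l)) hsmall_inv _.
apply: filterS3 w0 uv wM => n w0n un wMn; rewrite w0n subr0.
by apply: curve_end_near => //; exact: bounded_var_cvg wMn.
Qed.

Lemma hconv_open (x : nat -> 'rV[R]_d) l (O : set 'rV[R]_d) : open O -> O l ->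
  hconv x l -> \forall n \near hyper, O (x n).
Proof.
move=> oO Ol xl; have /nbhs_ballP[e /= e0 eO] : nbhs l O by exact: open_nbhs_nbhs.
apply: filterS (xl e e0) => n h; apply: eO; rewrite -ball_normE /= distrC.
by apply: le_lt_trans h; exact: mx_norm_le_enorm.
Qed.

End curve_end.

(** * Measures below Lebesgue measure *)

Section outer_regularity.
Context {R : realType} {d : nat} (m : {measure set (Rd R d) -> \bar R}).
Hypothesis m_fin : (m setT < +oo)%E.

Definition outer_regular (A : set (Rd R d)) := forall e : R, 0 < e ->
  exists O : set 'rV[R]_d, [/\ open O, A `<=` O & (m (O `\` A) <= e%:E)%E].

Lemma outer_regular_open (U : set 'rV[R]_d) : open U -> outer_regular U.
Proof. by move=> oU e e0; exists U; split => //; rewrite setDv measure0 lee_fin ltW. Qed.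

Lemma outer_regular_bigcup (A : nat -> set (Rd R d)) :
  (forall n, measurable (A n)) -> (forall n, outer_regular (A n)) ->
  outer_regular (\bigcup_n A n).
Proof.
move=> mA rA e e0.
have /choice[ O Oapp] : forall n, exists O : set 'rV[R]_d,
    [/\ open O, A n `<=` O & (m (O `\` A n) <= (e / (2 ^ n.+1)%:R)%:E)%E].
  by move=> n; apply: rA; rewrite divr_gt0// ltr0n expn_gt0.
have mO n : measurable (O n : set (Rd R d)).
  by apply: Rd_open_measurable; case: (Oapp n).
exists (\bigcup_n O n); split.
- by apply: bigcup_open => n _; case: (Oapp n).
- by apply: subset_bigcup => n _; case: (Oapp n).
apply: le_trans (epsilon_trick0 xpredT (ltW e0)).
apply: le_trans (_ : (_ <= \sum_(n <oo) m (O n `\` A n))%E) _.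
  apply: measure_sigma_subadditive.
  - by move=> n; exact: measurableD.
  - by apply: measurableD; exact: bigcupT_measurable.
  - by move=> x [[n _ Ox] nA]; exists n => //; split=> // Ax; apply: nA; exists n.
by apply: lee_nneseries => n // _; case: (Oapp n).
Qed.

Lemma outer_regularI (A B : set (Rd R d)) : measurable A -> measurable B ->
  outer_regular A -> outer_regular B -> outer_regular (A `&` B).
Proof.
move=> mA mB rA rB e e0; have e20 : 0 < e / 2 by rewrite divr_gt0.
have [ O [oO AO Oe]] := rA _ e20; have [U [oU BU Ue]] := rB _ e20.
have mO := Rd_open_measurable oO; have mU := Rd_open_measurable oU.
exists (O `&` U); split; [exact: openI|exact: setISS|].
apply: le_trans (_ : (_ <= m ((O `\` A) `|` (U `\` B)))%E) _.
  apply: le_measure; rewrite ?inE.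
  - by apply: measurableD; exact: measurableI.
  - by apply: measurableU; exact: measurableD.
  - move=> x [[Ox Ux] nAB]; have [Ax|nAx] := pselect (A x); [right|left] => //.
    by split => // Bx; apply: nAB.
apply: le_trans (measureU2 _ _ _) _; [exact: measurableD..|].
by rewrite [e]splitr EFinD leeD.
Qed.

(** Finite partial intersections are outer regular and decrease to the whole one. Continuity from
    above, where [m_fin] enters, makes one of them close enough in measure. *)
Lemma outer_regular_bigcap (A : nat -> set (Rd R d)) :
  (forall n, measurable (A n)) -> (forall n, outer_regular (A n)) ->
  outer_regular (\bigcap_n A n).
Proof.
move=> mA rA; pose B n := \big[setI/setT]_(i < n) A i.
have mB n : measurable (B n) by exact: bigsetI_measurable.
have rB n : outer_regular (B n).
  rewrite /B; elim: n => [|n ih]; first by rewrite big_ord0; apply: outer_regular_open openT.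
  by rewrite big_ord_recr; apply: outer_regularI; [exact: bigsetI_measurable|exact: mA|exact:
    ih|exact: rA].
have BE : \bigcap_n A n = \bigcap_n B n.
  apply/seteqP; split => x h n _; first by rewrite /B -bigcap_mkord => i _; exact: h.
  by have := h n.+1 I; rewrite /B -bigcap_mkord; apply => /=.
have mBA : measurable (\bigcap_n B n) by exact: bigcapT_measurable.
have m_fin_num X : measurable X -> m X \is a fin_num.
  move=> mX; rewrite ge0_fin_numE//; apply: le_lt_trans m_fin.
  by apply: le_measure; rewrite ?inE.
have := @nonincreasing_cvg_mu _ _ _ m B _ mB mBA _.
move=> /(_ _ _)/wrap[].
- by rewrite -ge0_fin_numE// m_fin_num.
- move=> i j ij; apply/subsetPset; rewrite /B -!bigcap_mkord.
  by move=> x h k /= ki; apply: h => /=; exact: leq_trans ij.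
move=> Bcvg e e0; have e20 : 0 < e / 2 by rewrite divr_gt0.
have [n nP] : exists n, (m (B n) <= m (\bigcap_n B n) + (e / 2)%:E)%E.
  apply: contrapT => /forallNP h.
  have : (m (\bigcap_n B n) + (e / 2)%:E <= m (\bigcap_n B n))%E.
    rewrite -[leRHS](cvg_lim _ Bcvg)//; apply: lime_ge.
      by apply/cvg_ex; eexists; exact: Bcvg.
    by apply: nearW => n; apply/ltW; rewrite ltNge; exact/negP/h.
  by rewrite -(fineK (m_fin_num _ mBA)) -EFinD lee_fin gerDl leNgt e20.
have [ O [oO BO Oe]] := rB n _ e20; have mO := Rd_open_measurable oO.
have BBn : \bigcap_n B n `<=` B n by move=> x; apply.
exists O; rewrite BE; split => //; first exact: subset_trans BO.
have -> : O `\` \bigcap_n B n = (O `\` B n) `|` (B n `\` \bigcap_n B n).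
  apply/seteqP; split => x.
    by move=> [ Ox nB]; have [Bx|nBx] := pselect (B n x); [right|left].
  by move=> [ [ Ox nB]|[Bx nB]]; split => //; [move=> h; apply: nB; exact: BBn|exact: BO].
apply: le_trans (measureU2 _ _ _) _; [exact: measurableD..|].
rewrite [e]splitr EFinD leeD// measureD// -?ge0_fin_numE ?m_fin_num//.
by rewrite setIidr// leeBlDl ?m_fin_num.
Qed.

(** A closed set is the intersection of its open neighbourhoods of radius [1 / (n + 1)]. *)
Lemma outer_regular_closed (U : set 'rV[R]_d) : open U -> outer_regular (~` U).
Proof.
move=> oU; pose O n := \bigcup_(y in ~` U) ball y (n.+1%:R^-1 : R).
have oO n : open (O n) by apply: bigcup_open => y _; exact: ball_open.
have -> : ~` U = \bigcap_n O n.
  apply/seteqP; split => x; first by move=> nU n _; exists x => //; exact: ballxx.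
  move=> h Ux; have /nbhs_ballP[e /= e0 eU] : nbhs x U by exact: open_nbhs_nbhs.
  have [n _ /(_ n (leqnn n)) /= ne] := near_infty_natSinv_lt (PosNum e0).
  have [y nUy yx] := h n I; apply: nUy; apply: eU; apply: ball_sym.
  by apply: le_ball yx; exact: ltW.
apply: outer_regular_bigcap => n; [exact: Rd_open_measurable|exact: outer_regular_open].
Qed.

(** The sets that are outer regular together with their complements form a sigma-algebra containing
    the open sets. *)
Lemma outer_regular_measurable (A : set (Rd R d)) : measurable A -> outer_regular A.
Proof.
pose C := [set A : set (Rd R d) |
  [/\ measurable A, outer_regular A & outer_regular (~` A)]].
suff : <<s @open 'rV[R]_d >> `<=` C by move=> /[apply] -[].
apply: smallest_sub; last first.
  move=> U oU; split; [exact: Rd_open_measurable|exact: outer_regular_open|].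
  exact: outer_regular_closed.
split => [|B [mB rB rB']|B BC].
- split; [exact: measurable0|exact: outer_regular_open open0|].
  by rewrite setC0; exact: outer_regular_open openT.
- by rewrite setTD; split; [exact: measurableC| |rewrite setCK].
- split; first by apply: bigcupT_measurable => n; case: (BC n).
    by apply: outer_regular_bigcup => n; case: (BC n).
  rewrite setC_bigcup; apply: outer_regular_bigcap => n; case: (BC n) => //.
  by move=> ? _ _; exact: measurableC.
Qed.

End outer_regularity.

Section cube.
Context {R : realType}.

Definition cube (S : set R) {d} : set 'rV[R]_d := [set x | forall i, S (x ord0 i)].

Lemma lebesgue_cube (S : set R) d : measurable (S : set (measurableTypeR R)) ->
  measurable (cube S : set (Rd R d)) /\
  lebesgue_Rd d (cube S : set (Rd R d)) = (lebesgue_measure S ^+ d)%E.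
Proof.
move=> mS; elim: d => [|d [mC ih]].
  have -> : cube S = [set: 'rV[R]_0] by apply/seteqP; split => // x _ [].
  by split; [exact: measurableT|rewrite /= diracT].
have CE : cube S = @Rd_uncons R d @^-1` (S `*` cube S).
  apply/seteqP; split => x.
    by move=> h; split => //= i; rewrite mxE; exact: h.
  move=> [h0 h] i; case: (split_ordP (i : 'I_(1 + d))) => k ->.
    by have -> : lshift d k = @ord0 d by apply/val_inj; rewrite /= ord1.
  by have := h k; rewrite mxE.
split.
  rewrite CE -[X in measurable X]setTI; apply: measurable_Rd_uncons => //.
  exact: measurableX.
rewrite expeS CE /= /lebesgue_step /pushforward -comp_preimage.
rewrite (_ : _ \o _ = id); last exact/funext/Rd_consK.
by rewrite preimage_id product_measure1E// ih.
Qed.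

Lemma cube_open (S : set R) d : open S -> open (cube S : set 'rV[R]_d).
Proof.
move=> oS; rewrite openE => x Sx.
apply: (@filter_forall _ 'I_d (fun i => [set y : 'rV[R]_d | S (y ord0 i)]) (nbhs x)) => i.
have xS : nbhs (x ord0 i) S by rewrite openE in oS; exact: oS (Sx i).
exact: (@coord_continuous R 1 d ord0 i x _ xS).
Qed.

End cube.

Section density.
Context {R : realType} {d : nat} (nu : probability (Rd R d) R).

(** Outer regularity is available for finite measures, so Lebesgue measure is restricted to the open
    cubes []-k, k[^d]. Intersecting with an open cube keeps an approximating set open, and the
    bounds pass to the limit in [k]. *)
Lemma le_lebesgue_Rd_open :
  (forall O : set 'rV[R]_d, open O -> (nu O <= lebesgue_Rd d O)%E) ->
  forall A, measurable A -> (nu A <= lebesgue_Rd d A)%E.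
Proof.
move=> nuO A mA; pose B k := cube `]- k%:R, k%:R[ : set (Rd R d).
have oB k : open (B k : set 'rV[R]_d) by apply: cube_open; exact: interval_open.
have mB k : measurable (B k) by exact: Rd_open_measurable.
have Bfin k : (lebesgue_Rd d (B k) < +oo)%E.
  rewrite (lebesgue_cube d _).2; last exact: measurable_itv.
  rewrite lebesgue_measure_itv/=; case: ifPn => _; last first.
    by rewrite -[0%E]/(0%:E) -EFin_expe ltry.
  by rewrite -EFinB -EFin_expe ltry.
have BT : \bigcup_k (A `&` B k) = A.
  rewrite -setI_bigcupr (_ : \bigcup_k B k = setT) ?setIT//.
  apply/seteqP; split => // x _; exists (Num.bound (`|x : 'rV[R]_d|)) => // i /=.
  rewrite in_itv /= -ltr_norml; apply: le_lt_trans (archi_boundP _) => //.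
  rewrite [leRHS]/Num.Def.normr /= mx_normrE.
  by apply/bigmax_geP; right => /=; exists (ord0, i).
have Bnd : nondecreasing_seq (fun k => A `&` B k).
  move=> i j ij; apply/subsetPset; apply: setIS => x h k; have := h k.
  rewrite /= !in_itv /= => /andP[h1 h2]; have ij' : i%:R <= j%:R :> R by rewrite ler_nat.
  by rewrite (lt_le_trans h2)// andbT (le_lt_trans _ h1)// lerN2.
have mAB k : measurable (A `&` B k) by exact: measurableI.
have := nondecreasing_cvg_mu (mu := nu) mAB; rewrite BT => /(_ mA Bnd) cvgA.
rewrite -(cvg_lim _ cvgA)//; apply: lime_le; first by apply/cvg_ex; eexists; exact: cvgA.
apply: nearW => k.
have rfin : (mrestr (lebesgue_Rd d) (mB k) setT < +oo)%E by rewrite /mrestr setTI.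
have rA := outer_regular_measurable rfin mA.
apply/lee_addgt0Pr => e e0; have [ O [oO AO Oe]] := rA _ e0.
have mO := Rd_open_measurable oO.
apply: le_trans (_ : (_ <= nu (O `&` B k))%E) _.
  by apply: le_measure; rewrite ?inE//; [exact: measurableI|exact: setSI].
apply: le_trans (nuO _ (openI oO (oB k))) _.
apply: le_trans (_ : (_ <= lebesgue_Rd d ((A `&` B k) `|` (O `\` A) `&` B k))%E) _.
  apply: le_measure; rewrite ?inE; first exact: measurableI.
    by apply: measurableU => //; apply: measurableI => //; exact: measurableD.
  move=> x [Ox Bx]; have [Ax|nA] := pselect (A x); [by left|by right].
apply: le_trans (measureU2 _ _ _) _ => //.
  by apply: measurableI => //; exact: measurableD.
apply: leeD => //; apply: le_measure; rewrite ?inE//; exact: subIsetl.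
Qed.

Lemma le_lebesgue_Rd_density_le1 :
  (forall A, measurable A -> (nu A <= lebesgue_Rd d A)%E) -> density_le1 nu.
Proof.
move=> nule; have dom : nu `<< lebesgue_Rd d.
  apply/null_content_dominatesP => A mA lA; apply/eqP.
  by rewrite eq_le measure_ge0 andbT -lA nule.
have [f [f0 ffin fint nuE]] := radon_nikodym_sigma_finite dom.
have mf : measurable_fun setT f by exact: measurable_int fint.
exists (fine \o f); split.
- exact: measurableT_comp.
- by move=> x; exact: fine_ge0.
- pose E := [set x | (1 < f x)%E].
  have mE : measurable E by rewrite -[E]setTI; exact: emeasurable_fun_o_infty.
  have : ae_eq (lebesgue_Rd d) E f (cst 1%E).
    apply: integral_ae_eq => //; first exact: integrableS fint.
    move=> F FE mF; apply/eqP; rewrite eq_le -nuE//.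
    rewrite integral_cst// mul1e nule//= nuE// -[leLHS]mul1e -integral_cst//.
    apply: ge0_le_integral => //.
      exact: measurable_funS mf.
    by move=> x /FE /ltW.
  apply: filterS => x h /=; rewrite leNgt; apply/negP => f1.
  have Ex : E x by rewrite /E /= -(fineK (ffin x)) lte_fin.
  by have := Ex; rewrite /E /= (h Ex) ltxx.
move=> A mA; rewrite nuE//; apply: eq_integral => x _ /=.
by rewrite fineK.
Qed.

End density.

(** * Construction of probability measures *)

(** Normalization serves only to give a measure of total mass one the structure of a [probability];
    its values do not change. *)
Lemma mnormalize_prob {R : realType} {d : measure_display} {T : measurableType d}
    (m : {measure set T -> \bar R}) (x : T) A :
  m setT = 1%E -> mnormalize m \d_x A = m A.
Proof. by move=> mT; rewrite /mnormalize mT/= onee_eq0/= invr1 mule1. Qed.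

Lemma probability_image {R : realType} {d d' : measure_display} {T : measurableType d}
    {T' : measurableType d'} (P : probability T R) (f : T -> T') :
  measurable_fun setT f -> exists Q : probability T' R, forall A, Q A = P (f @^-1` A).
Proof.
move=> mf.
pose m := measure_function_pushforward__canonical__measure_function_Measure P mf.
have mT : m setT = 1%E by rewrite /m /= /pushforward preimage_setT probability_setT.
by exists (mnormalize m \d_point) => A; exact: mnormalize_prob.
Qed.

(** The uniform measure on the unit cube. It is the minimizer exhibited when all costs are
    infinite. *)
Lemma exists_density_le1 (R : realType) d : exists nu : probability (Rd R d) R, density_le1 nu.
Proof.
have [mC lC] := @lebesgue_cube R `[0, 1] d (measurable_itv _).
have {}lC : lebesgue_Rd d (cube (`[0, 1] : set R) : set (Rd R d)) = 1%E.
  by rewrite lC lebesgue_measure_itv /= lte01 sube0 -EFin_expe expr1n.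
pose m := mrestr (lebesgue_Rd d) mC.
have mT : m setT = 1%E by rewrite /m /mrestr setTI.
exists (mnormalize m \d_point); apply: le_lebesgue_Rd_density_le1 => A mA.
rewrite [leLHS]mnormalize_prob// /m /mrestr; apply: le_measure; rewrite ?inE//.
  exact: measurableI.
Qed.

Lemma density_le1_le {R : realType} {d} (nu : probability (Rd R d) R) A :
  density_le1 nu -> measurable A -> (nu A <= lebesgue_Rd d A)%E.
Proof.
move=> [f [mf f0 f1 nuE]] mA; rewrite nuE// -[leRHS]mul1e -integral_cst//.
apply: ae_ge0_le_integral => //.
- by move=> x _; rewrite lee_fin.
- by apply/measurable_EFinP; exact: measurable_funTS.
- by apply: filterS f1 => x h _; rewrite lee_fin.
Qed.

Section loeb_internal.
Context {R : realType} {d : measure_display} {T : measurableType d}.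
Variable eta : nat -> probability T R.

Lemma internal_measurable (A : nat -> set T) : (forall n, measurable (A n)) ->
  measurable (internal A : set (@loeb_sigma _ T)).
Proof. by move=> mA; apply: sub_sigma_algebra; exists A. Qed.

Lemma loeb_measure_le (A : nat -> set T) (c : R) : (forall n, measurable (A n)) ->
  (forall n, eta n (A n) <= c%:E)%E -> (loeb_measure eta (internal A) <= c%:E)%E.
Proof.
move=> mA Ac; rewrite loeb_measureE//.
have := loeb_contentE (eta := eta) mA.
have -> : loeb_content eta (internal A) = (fine (loeb_content eta (internal A)))%:E by [].
rewrite lee_fin => h; apply: (closed_cvg _ (@closed_le _ c) _ _ h).
by apply: nearW => n /=; rewrite -lee_fin fineK// fin_num_measure.
Qed.

End loeb_internal.

(** * The limit plan *)

Section limit_plan.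
Context {R : realType} {d : nat}.
Local Notation Gam := (Gamma R d).
Variables (alpha : R) (eta : nat -> probability Gam R).
Variables (nu : nat -> probability (Rd R d) R) (C : R).
Hypothesis alpha1 : alpha < 1.
Hypothesis etaIP : forall n, IP \d_((0 : 'rV[R]_d) : Rd R d) (nu n) (eta n).
Hypothesis nu1 : forall n, density_le1 (nu n).
Hypothesis costC : forall n, (irrigation_cost alpha (eta n) <= C%:E)%E.
Local Notation P := (loeb_measure eta).
Local Notation Omega := (@loeb_sigma _ Gam).

Lemma measurable_curve_start : measurable_fun setT (@curve_start R d : Gam -> Rd R d).
Proof.
apply: measurable_to_Rd => x e e0; apply: Gamma_open_measurable.
by apply: (@curve_eval_preimage_open R d 0 (ball x e)) => //; exact: ball_open.
Qed.

Let rooted : set Gam := [set g : Gam | (g : curve R d) 0 = 0].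
(* The curves of length greater than [M]. *)
Let long M : set Gam := [set g : Gam | M%:R < tlen (g : curve R d) M.+1%:R].

Let m0 : measurable [set (0 : 'rV[R]_d) : Rd R d].
Proof.
rewrite -[X in measurable X]setCK; apply: measurableC; apply: Rd_open_measurable.
rewrite openE => y /= /eqP y0; apply/nbhs_ballP; exists `|y|; first by rewrite /= normr_gt0.
by move=> z; rewrite -ball_normE /= => + z0; rewrite z0 subr0 ltxx.
Qed.

Let m_rooted : measurable rooted.
Proof.
have := measurable_curve_start measurableT m0; rewrite setTI; congr measurable.
Qed.

Let m_long M : measurable (long M).
Proof.
have := @measurable_tlen R d M.+1%:R measurableT _ (measurable_itv `]M%:R, +oo[).
by rewrite setTI; congr measurable; apply/seteqP; split => g; rewrite /= in_itv/= andbT.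
Qed.

(** The sequences that do not start at the origin for almost all [n], or whose lengths are not
    bounded by a common integer for almost all [n]; the description by internal sets makes it
    measurable. *)
Definition untame : set Omega :=
  ~` internal (fun=> rooted) `|` \bigcap_M internal (fun=> long M).

Lemma untame_measurable : measurable untame.
Proof.
apply: measurableU; first by apply: measurableC; exact: internal_measurable.
by apply: bigcapT_measurable => M; exact: internal_measurable.
Qed.

(** The first part is null since every [eta n] starts at the origin almost surely. For the second,
    [Z_eta] dominates the length, so Markov's inequality bounds the [eta n]-mass of the curves
    longer than [M] by [C / M], uniformly in [n]. *)
Lemma untame0 : P untame = 0%E.
Proof.
have mR : measurable (~` internal (fun=> rooted) : set Omega).
  by apply: measurableC; exact: internal_measurable.
have mL : measurable (\bigcap_M internal (fun=> long M) : set Omega).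
  by apply: bigcapT_measurable => M; exact: internal_measurable.
have R0 : P (~` internal (fun=> rooted)) = 0%E.
  apply/eqP; rewrite eq_le measure_ge0 andbT internalC.
  apply: loeb_measure_le => n; first exact: measurableC.
  rewrite probability_setC//; have [_ + _] := etaIP n.
  move=> /(_ _ m0); rewrite /pushforward /= diracE.
  rewrite (_ : _ @^-1` _ = rooted)// => ->.
  by rewrite mem_set// subee.
rewrite /untame measureU0//.
apply/eqP; rewrite eq_le measure_ge0 andbT; apply/lee_addgt0Pr => e e0; rewrite add0e.
(* This makes [C / e < M.+1], so Markov's inequality for [long M.+1] gives at most [e]. *)
pose M := Num.bound (C / e).
apply: (@le_trans _ _ (P (internal (fun=> long M.+1)))).
  by apply: le_measure; rewrite ?inE//; [exact: internal_measurable|move=> w; apply].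
apply: loeb_measure_le => // n.
have h : ((M.+1)%:R%:E * eta n (long M.+1) <= C%:E)%E.
  apply: le_trans (costC n).
  rewrite -[X in (_ * eta n X)%E]setIT -integral_indic// -ge0_integralZl//.
  - apply: ge0_le_lower_integral => [g _|g _].
      by rewrite mule_ge0 ?lee_fin.
    rewrite indicE; case: (boolP (g \in _)) => [|_]; last first.
      by rewrite mule0; apply: le_trans (Z_eta_ge_var _ _ alpha1 (lexx 0)); rewrite lee_fin var_ge0.
    rewrite inE mule1 => gM.
    have [t t0 Mt] : exists2 t, 0 <= t & M.+1%:R <= var g t.
      apply: contrapT => h; move: gM; rewrite /long /=; apply/negP; rewrite -leNgt.
      apply: tlen_le_bound => t t0; rewrite ge_min; apply/orP; right.
      by rewrite leNgt; apply/negP => Mt; apply: h; exists t => //; exact: ltW.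
    by apply: le_trans (Z_eta_ge_var _ _ alpha1 t0); rewrite lee_fin.
  - by apply/measurable_EFinP; exact: measurable_indic.
have C0 : 0 <= C by rewrite -lee_fin; apply: le_trans h; rewrite mule_ge0 ?lee_fin.
have Me : C <= e * M.+1%:R.
  rewrite mulrC -ler_pdivrMr// ltW//; apply: lt_trans (archi_boundP _) _.
    by rewrite divr_ge0// ltW.
  by rewrite ltr_nat.
rewrite -(@lee_pmul2l _ M.+1%:R%:E)//; apply: le_trans h _.
by rewrite -EFinM lee_fin mulrC.
Qed.

Lemma untameN w : ~ untame w -> tame w.
Proof.
move=> /not_orP[/contrapT w0 /existsNP[M /not_implyP[_ wM]]]; split => //.
exists M%:R; apply: filterS (hyperN wM) => n /= /negP; rewrite -leNgt => h t t0.
have := le_trans (tlen_ge (w n) M.+1%:R t0) h.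
by rewrite ge_min ler_nat ltnn.
Qed.

(** Semicontinuity is stated through eventual upper bounds [c], so it yields both the finiteness of
    the limit cost, with [C], and its minimality, with bounds tending to the infimum. *)
Lemma limit_plan : exists (etaL : probability Gam R) (nuL : probability (Rd R d) R),
  [/\ IP \d_((0 : 'rV[R]_d) : Rd R d) nuL etaL, density_le1 nuL &
    forall c : R, (\forall n \near \oo, irrigation_cost alpha (eta n) <= c%:E)%E ->
      (irrigation_cost alpha etaL <= c%:E)%E].
Proof.
have [etaL etaLE] := probability_image P (@measurable_arc_lim R d).
have [nuL nuLE] := probability_image etaL (@measurable_curve_end R d).
have Z0 (q : probability Gam R) (g : curve R d) : (0 <= Z_eta alpha q g)%E.
  by apply: le_trans (Z_eta_ge_var _ _ alpha1 (lexx 0)); rewrite lee_fin var_ge0.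
have lim_cost c : (\forall n \near \oo, irrigation_cost alpha (eta n) <= c%:E)%E ->
    (irrigation_cost alpha etaL <= c%:E)%E.
  move=> /hyper_free hc.
  apply: (loeb_fatou (@measurable_arc_lim R d) (fun A _ => etaLE A) _ _ untame_measurable
    untame0 hc) => //.
  (* By contraposition: if [b <= Z_eta] does not hold for almost all [n], then [Z_eta <= b] does,
     and semicontinuity bounds the limit by [b]. *)
  move=> w nw b bZ; have [//|h] := pselect (\forall n \near hyper, (b%:E <= Z_eta alpha (eta n)
    (w n))%E).
  exfalso; move: bZ; apply/negP; rewrite -leNgt.
  apply: (Z_eta_lsc alpha1 untame_measurable untame0 untameN (fun A _ => etaLE A) (untameN nw)).
  by apply: filterS (hyperN h) => n /negP; rewrite -ltNge => /ltW.
exists etaL, nuL; split => //.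
- split.
  (* As the weight is at least [1], the mean length is at most the cost of the limit plan, hence at
     most [C]. *)
  + rewrite /irrigation_plan; apply: (@le_lt_trans _ _ C%:E); last exact: ltry.
    apply: le_trans (lim_cost C _); last by apply: nearW.
    apply: ge0_le_lower_integral => g _.
      by apply: integral_ge0 => t _; rewrite lee_fin speed_ge0.
    apply: ge0_le_lower_integral => t _; first by rewrite lee_fin speed_ge0.
    rewrite -[leLHS]mul1e; apply: lee_pmul => //; first by rewrite lee_fin speed_ge0.
    by apply: pow_infty_ge1; rewrite ?subr_lt0// multiplicity_ge0 multiplicity_le1.
  + move=> A mA; rewrite /pushforward /= diracE etaLE.
    have st (w : Omega) : curve_start (arc_lim w) = (0 : 'rV[R]_d) by exact: arc_lim0.
    have [A0|A0] := pselect (A (0 : 'rV[R]_d)).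
      rewrite mem_set// (_ : _ @^-1` _ = setT) ?probability_setT//.
      by apply/seteqP; split => // w _; change (A (curve_start (arc_lim w))); rewrite st.
    rewrite memNset// (_ : _ @^-1` _ = set0) ?measure0//.
    by apply/seteqP; split => // w; change (A (curve_start (arc_lim w)) -> False); rewrite st.
  + by move=> A mA; rewrite nuLE.
- apply: le_lebesgue_Rd_density_le1; apply: le_lebesgue_Rd_open => O oO.
  have mO := Rd_open_measurable oO.
  have mend : measurable (@curve_end R d @^-1` O : set Gam).
    by rewrite -[X in measurable X]setTI; exact: measurable_curve_end.
  case E : (lebesgue_Rd d O) => [c| |]; [|by rewrite leey|]; last first.
    by have : (0 <= lebesgue_Rd d O)%E := measure_ge0 _ _; rewrite E.
  rewrite nuLE etaLE.
  (* Endpoints converge outside [untame] and [O] is open, so a limit ending in [O] forces almost all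
     [w n] to end in [O]. Each [eta n] gives such curves a mass of at most the Lebesgue measure of
     [O]. *)
  apply: (@le_trans _ _ (P (internal (fun=> @curve_end R d @^-1` O) `|` untame))).
    apply: le_measure; rewrite ?inE.
    + by rewrite -[X in measurable X]setTI; exact: measurable_arc_lim.
    + by apply: measurableU; [exact: internal_measurable|exact: untame_measurable].
    + move=> w Ow; have [nw|/untameN tw] := pselect (untame w); [by right|left].
      exact: hconv_open oO Ow (tame_curve_end tw).
  apply: le_trans (measureU2 _ _ _) _.
  + exact: internal_measurable.
  + exact: untame_measurable.
  + rewrite [X in (_ + X)%E]untame0 adde0; apply: loeb_measure_le => // n.
    by rewrite -E; have [_ _ /(_ _ mO) nuO] := etaIP n; rewrite (_ : eta n _ = nu n O)//;
      exact: density_le1_le.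
Qed.

End limit_plan.

Theorem theorem2p1 (R : realType) (d : nat) (alpha : R)
    (d_ge1 : (1 <= d)%N) (alpha_itv : 1 - d%:R^-1 < alpha < 1) :
  exists nu : probability (Rd R d) R,
    density_le1 nu /\
    forall nu' : probability (Rd R d) R,
      density_le1 nu' -> (X_alpha alpha nu <= X_alpha alpha nu')%E.
Proof.
have /andP[_ alpha1] := alpha_itv.
pose D0 : probability (Rd R d) R := \d_((0 : 'rV[R]_d) : Rd R d).
(* Competitor and plan vary together, so that one sequence of plans approaches the infimum of
   [X_alpha] over all competitors. *)
pose costs := [set c : \bar R |
  exists (nu : probability (Rd R d) R) (eta : probability (Gamma R d) R),
  [/\ density_le1 nu, IP D0 nu eta & c = irrigation_cost alpha eta]].
have costs_ge0 c : costs c -> (0 <= c)%E.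
  move=> [nu [eta [_ _ ->]]]; apply: integral_ge0 => g _.
  by apply: le_trans (Z_eta_ge_var _ _ alpha1 (lexx 0)); rewrite lee_fin var_ge0.
have le_X (nu : probability (Rd R d) R) : density_le1 nu -> (ereal_inf costs <= X_alpha alpha nu)%E.
  move=> nu1; by apply/ereal_infP => _ [eta etaIP <-]; apply: ereal_inf_lbound; exists nu, eta.
have m0 : (0 <= ereal_inf costs)%E by apply/ereal_infP => c /costs_ge0.
case mE : (ereal_inf costs) m0 => [m| |] // m0; last first.
  have [nu nu1] := exists_density_le1 R d; exists nu; split => // nu' /le_X.
  by rewrite mE leye_eq => /eqP ->; rewrite leey.
have /choice[p pP] : forall n, exists p : probability (Rd R d) R * probability (Gamma R d) R,
    [/\ density_le1 p.1, IP D0 p.1 p.2 & (irrigation_cost alpha p.2 <= (m + n.+1%:R^-1)%:E)%E].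
  move=> n; have mfin : ereal_inf costs \is a fin_num by rewrite mE.
  have n0 : 0 < n.+1%:R^-1 :> R by rewrite invr_gt0.
  have [_ [nu [eta [nu1 etaIP ->]]]] := lb_ereal_inf_adherent n0 mfin.
  by rewrite mE -EFinD => /ltW h; exists (nu, eta).
have [|etaL [nuL [etaIP nuL1 cost_le]]] :=
  @limit_plan R d alpha (fun n => (p n).2) (fun n => (p n).1)
  (m + 1) alpha1 (fun n => let: And3 _ h _ := pP n in h) (fun n => let: And3 h _ _ := pP n in h).
  move=> n; have [_ _ h] := pP n; apply: le_trans h _.
  by rewrite lee_fin lerD2l invf_le1 ?ltr0n// ler1n.
exists nuL; split => // nu' /le_X; apply: le_trans; rewrite mE.
apply: le_trans (_ : (_ <= irrigation_cost alpha etaL)%E) _.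
  by apply: ereal_inf_lbound; exists etaL.
(* The costs are at most [m + 1 / (n + 1)], hence eventually below [m + e] for each [e > 0], and the
   limit plan inherits this bound. *)
apply/lee_addgt0Pr => e e0; rewrite -EFinD; apply: cost_le.
near=> n; have [_ _ h] := pP n; apply: le_trans h _.
rewrite lee_fin lerD2l ltW//; near: n; exact: near_infty_natSinv_lt (PosNum e0).
Unshelve. all: by end_near. Qed.
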